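(* Let $1\le k\le n$ and let $\mu\in\mathbb{N}^n$ be packed of type $(k,n)$, i.e. $\mu_i\ne0$ for $i\le k$ and $\mu_i=0$ for $i>k$. Then $$f^*_\mu(x_1,\dots,x_n)=\prod_{i=1}^k\left(x_i-t^{-n+1}\right)\sum_{\nu\in\mathbb{N}^n}a^\nu_\mu\, q^{|\nu^-|}f^*_{\nu^-}\!\left(\frac{x_1}{q},\dots,\frac{x_n}{q}\right),$$ where $\nu^-=(\max(\nu_1-1,0),\dots,\max(\nu_n-1,0))$.
   Context: Polynomials are in $x_1,\dots,x_n$ over $\mathbb{Q}(q,t)$. For $\mu\in\mathbb{N}^n$ let $k_i(\mu)=\#\{j<i:\mu_j>\mu_i\}+\#\{j>i:\mu_j\ge\mu_i\}$ and $\widetilde\mu=(q^{\mu_1}t^{-k_1(\mu)},\dots,q^{\mu_n}t^{-k_n(\mu)})$. For $\mu\in\mathbb{N}^n$, $|\mu|=d$, $E^*_\mu$ is the unique polynomial of degree at most $d$ with coefficient of $x^\mu$ equal to $1$ and $E^*_\mu(\widetilde\nu)=0$ for all $\nu\in\mathbb{N}^n$, $|\nu|\le d$, $\nu\ne\mu$. $S_n$ acts on compositions by $\sigma\cdot\mu=(\mu_{\sigma^{-1}(1)},\dots,\mu_{\sigma^{-1}(n)})$ and on polynomials by permuting variables; $s_i=(i,i+1)$; $T_i=t-\frac{tx_i-x_{i+1}}{x_i-x_{i+1}}(1-s_i)$; $T_\sigma=T_{i_1}\cdots T_{i_\ell}$ for a reduced word. For a composition $\mu$ with sorted partition $\lambda$,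 $\sigma_\mu$ is the shortest permutation with $\sigma_\mu(\lambda)=\mu$, and $f^*_\mu=T_{\sigma_\mu}E^*_\lambda$. Generalized two-line queues and $a^\nu_\mu$. For $\nu,\mu\in\mathbb{N}^n$ (top row $\nu$, bottom row $\mu$), require: $\nu$ has no part equal to $1$; $\#\{i:\mu_i=j\}=\#\{i:\nu_i=j\}$ for every $j>1$; and for each $i$, $\mu_i=0$ or $\nu_i\le\mu_i$. Place a ball labeled $\nu_i$ in column $i$ of the top row when $\nu_i>0$, and a ball labeled $\mu_i$ in column $i$ of the bottom row when $\mu_i>0$. A generalized two-line queue in $\mathcal{Q}^\nu_\mu$ is a bijection pairing each top ball with a bottom ball of the same label, such that whenever a top ball of label $a$ lies directly above a bottom ball of label $a$, they are paired to each other (trivial pairing); each pairing is drawn as the shortest strand going straight down or left to right, wrapping around cyclically (columns mod $n$). Weights: process top balls in decreasing order of label, ties broken right to left. For a nontrivial pairing $p$ joining a top ball of label $a$ in column $j$ to a bottom ball in column $j'$, the free balls for $p$ are the bottom-row balls not matched before $p$ (excluding bottom balls of label $a$ that are trivially paired); $\mathrm{free}(p)$ is their number, and $\mathrm{skipped}(p)$ is the number of free balls in columns $j+1,\dots,j'-1$ (mod $n$). Set $\mathrm{wt}(p)=\frac{(1-t)t^{\mathrm{skipped}(p)}}{1-q^{a-1}t^{\mathrm{free}(p)}}q^{a-1}$ if $j'<j$ and $\frac{(1-t)t^{\mathrm{skipped}(p)}}{1-q^{a-1}t^{\mathrm{free}(p)}}$ if $j'>j$. Then $a^\nu_\mu=\sum_{Q\in\mathcal{Q}^\nu_\mu}\prod_{p\text{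 nontrivial}}\mathrm{wt}(p)$ (which is $0$ if $\mathcal{Q}^\nu_\mu$ is empty). *)

(* Defs.v *)
From HB Require Import structures.
From mathcomp Require Import all_boot all_order all_algebra all_fingroup.
From mathcomp Require Import fraction.
From mathcomp.multinomials Require Import mpoly.
From Stdlib Require Import ClassicalEpsilon.

Set Implicit Arguments.
Unset Strict Implicit.
Unset Printing Implicit Defensive.

Import GRing.Theory.
Local Open Scope ring_scope.

Definition Kqt : fieldType := {fraction {poly {poly rat}}}.
Definition qpar : Kqt := tofrac (('X : {poly rat})%:P).
Definition tpar : Kqt := tofrac ('X : {poly {poly rat}}).

Section Defs.
Variable n : nat.

Local Notation P := {mpoly Kqt[n]}.
(* compositions mu in N^n are represented by monomials 'X_{1..n} *)
Local Notation comp := 'X_{1..n}.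

Definition kidx (mu : comp) (i : 'I_n) : nat :=
  (#|[set j : 'I_n | (j < i)%N && (mu i < mu j)%N]|
   + #|[set j : 'I_n | (i < j)%N && (mu i <= mu j)%N]|)%N.

Definition spec (mu : comp) (i : 'I_n) : Kqt :=
  qpar ^+ (mu i) * tpar ^- (kidx mu i).

Definition IsEstar (mu : comp) (p : P) : Prop :=
  [/\ (msize p <= (mdeg mu).+1)%N  (* total degree at most |mu| *),
      p@_mu = 1 &
      forall nu : comp, (mdeg nu <= mdeg mu)%N -> nu != mu ->
        p.@[spec nu] = 0].

Definition Estar (mu : comp) : P := epsilon (inhabits 0) (IsEstar mu).

Lemma adjR_proof (i : 'I_n.-1) : (i.+1 < n)%N.
Proof. by rewrite -ltn_predRL. Qed.
Definition adjL (i : 'I_n.-1) : 'I_n := Ordinal (ltnW (adjR_proof i)).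
Definition adjR (i : 'I_n.-1) : 'I_n := Ordinal (adjR_proof i).

Definition sadj (i : 'I_n.-1) : 'S_n := tperm (adjL i) (adjR i).

Definition spoly (i : 'I_n.-1) (p : P) : P := msym (sadj i) p.

(* Demazure-Lusztig operator
   T_i f = t f - (t x_i - x_{i+1})/(x_i - x_{i+1}) (f - s_i f),
   defined as the unique g with (x_i - x_{i+1}) g = (x_i - x_{i+1}) t f
   - (t x_i - x_{i+1}) (f - s_i f)  (the division is exact). *)
Definition Top (i : 'I_n.-1) (f : P) : P :=
  epsilon (inhabits 0) (fun g : P =>
    ('X_(adjL i) - 'X_(adjR i)) * g =
    ('X_(adjL i) - 'X_(adjR i)) * (tpar *: f)
    - (tpar *: 'X_(adjL i) - 'X_(adjR i)) * (f - spoly i f)).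

(* the permutation s_{i_1} o ... o s_{i_l} of a word [:: i_1; ...; i_l] *)
Fixpoint wperm (w : seq 'I_n.-1) : 'S_n :=
  match w with
  | [::] => 1%g
  | i :: w' => (wperm w' * sadj i)%g
  end.

(* Coxeter length = number of inversions *)
Definition plen (s : 'S_n) : nat :=
  #|[set p : 'I_n * 'I_n | (p.1 < p.2)%N && (s p.2 < s p.1)%N]|.

Definition Tperm (s : 'S_n) (f : P) : P :=
  let w := epsilon (inhabits [::])
             (fun w : seq 'I_n.-1 => wperm w = s /\ size w = plen s) in
  foldr (fun i acc => Top i acc) f w.

Definition pact (s : 'S_n) (mu : comp) : comp :=
  [multinom mu ((s^-1)%g i) | i < n].

Definition sortpart (mu : comp) : comp :=
  epsilon (inhabits mu) (fun la : comp =>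
    (exists s : 'S_n, pact s la = mu) /\
    forall i j : 'I_n, (i <= j)%N -> (la j <= la i)%N).

Definition sigmamu (mu : comp) : 'S_n :=
  epsilon (inhabits 1%g) (fun s : 'S_n =>
    pact s (sortpart mu) = mu /\
    forall s' : 'S_n, pact s' (sortpart mu) = mu -> (plen s <= plen s')%N).

Definition fstar (mu : comp) : P := Tperm (sigmamu mu) (Estar (sortpart mu)).

Definition substq (p : P) : P := p \mPo [tuple qpar^-1 *: 'X_i | i < n].

Definition mminus (nu : comp) : comp := [multinom (nu i).-1 | i < n].

(* admissibility of the pair (top row nu, bottom row mu) *)
Definition tlq_adm (nu mu : comp) : bool :=
  [&& [forall i : 'I_n, nu i != 1%N],
      perm_eq [seq nu i | i <- enum 'I_n & (1 < nu i)%N]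
              [seq mu i | i <- enum 'I_n & (1 < mu i)%N] &
      [forall i : 'I_n, (mu i == 0%N) || (nu i <= mu i)%N]].

(* A queue is encoded by pi : column of top ball -> column of its bottom
   ball (pi j = j when there is no top ball in column j).  It pairs each
   top ball with a bottom ball of the same label, injectively (hence
   bijectively onto the bottom balls of label > 1), and trivial pairings
   are forced. *)
Definition inQ (nu mu : comp) (pi : {ffun 'I_n -> 'I_n}) : bool :=
  [&& tlq_adm nu mu,
      [forall j : 'I_n, if (0 < nu j)%N then mu (pi j) == nu j
                         else pi j == j],
      [forall j1 : 'I_n, forall j2 : 'I_n,
         [&& (0 < nu j1)%N, (0 < nu j2)%N & pi j1 == pi j2] ==> (j1 == j2)] &
      [forall j : 'I_n, ((0 < nu j)%N && (nu j == mu j)) ==> (pi j == j)]].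

(* top ball j2 is processed before top ball j: larger label first,
   ties broken right to left *)
Definition before (nu : comp) (j2 j : 'I_n) : bool :=
  (0 < nu j2)%N &&
  ((nu j < nu j2)%N || ((nu j2 == nu j) && (j < j2)%N)).

Definition freeset (nu mu : comp) (pi : {ffun 'I_n -> 'I_n}) (j : 'I_n)
  : {set 'I_n} :=
  [set b : 'I_n |
     [&& (0 < mu b)%N,
         b \notin [set pi j2 | j2 in [set j2 : 'I_n | before nu j2 j]] &
         ~~ [&& mu b == nu j, nu b == mu b & pi b == b]]].

Definition cdist (j c : 'I_n) : nat := ((c + n - j) %% n)%N.

Definition nskipped (nu mu : comp) (pi : {ffun 'I_n -> 'I_n}) (j : 'I_n)
  : nat :=
  #|[set b in freeset nu mu pi j |
       (0 < cdist j b)%N && (cdist j b < cdist j (pi j))%N]|.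

Definition wt (nu mu : comp) (pi : {ffun 'I_n -> 'I_n}) (j : 'I_n) : Kqt :=
  let a := nu j in
  (1 - tpar) * tpar ^+ (nskipped nu mu pi j)
  / (1 - qpar ^+ a.-1 * tpar ^+ #|freeset nu mu pi j|)
  * (if (pi j < j)%N then qpar ^+ a.-1 else 1).

Definition acoef (nu mu : comp) : Kqt :=
  \sum_(pi : {ffun 'I_n -> 'I_n} | inQ nu mu pi)
     \prod_(j : 'I_n | (0 < nu j)%N && (pi j != j)) wt nu mu pi j.

End Defs.

(* Main.v *)
(* Write n = m + 1, number the columns 0..m, and let Omega be the substitution
   x_j -> x_(j+1), x_m -> x_0 / q, so that Omega^n is x -> x / q.  Let P_mu denote a multiple of
   E*_mu.  Then (x_0 - t^-m) Omega P_mu is P_(up mu), where up rotates mu and adds 1 to the new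
   first part.  If the first r parts of eta vanish, P_eta itself equals Omega^r h for some h of
   degree |eta| vanishing at all spectral vectors of lower degree.  For a partition with k
   nonzero parts both facts give E*_la = prod_(i < k) (x_i - t^-m) h(x / q), and applying T_i
   with i < k gives the same shape for f*_mu with mu packed.  Since h is determined by its top
   homogeneous part, the theorem reduces to its top homogeneous part.

   For the top part let F_mu = x^(supp mu) sum_nu a^nu_mu F_(nu^-).  The two-line queue weights
   factor over the labels, and they satisfy exchange relations for adjacent columns and a
   rotation relation, from which T_i F_mu = F_(s_i mu) when mu_i > mu_(i+1), T_i F_mu = t F_mu
   when mu_i = mu_(i+1), and Omega F_mu = q^(-mu_m) F_(rot mu).  So for a partition la, F_la is a
   joint eigenvector of the Cherednik operators; modulo lower degree the P_ka are joint
   eigenvectors with pairwise distinct spectra, hence F_la is the top part of P_la.  The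
   coefficient of x^mu in F_mu is 1, which gives the existence of E*_la, and f*_mu has top part
   F_mu by following a reduced word of sigma_mu. *)

Require Import Defs.
From HB Require Import structures.
From mathcomp Require Import all_boot all_order all_algebra all_fingroup.
From mathcomp Require Import fraction.
From mathcomp.multinomials Require Import mpoly.
From mathcomp Require Import ring zify.
From Stdlib Require Import ClassicalEpsilon.

Set Implicit Arguments.
Unset Strict Implicit.
Unset Printing Implicit Defensive.

Import GRing.Theory.
Local Open Scope ring_scope.

(** The constant t^-m is the first spectral coordinate of every composition that begins with 0,
    since all m other columns then rank before column 0. The remaining compositions are exactly the
    values of [up], so one linear factor deals with one half of the vanishing conditions and [Omega]
    with the other. Two obstacles shape the queue part. Equal labels are processed from right to
    left, an order respected neither by exchanging adjacent columns nor by rotating them; so the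
    total weight of a label is first shown not to depend on that order. And one label relation has
    three terms: with z = u t^|F|, the strand to the next column weighs (1 - t)/(1 - z), the strand
    around the whole circle, times t, weighs (1 - t) z/(1 - z), and their difference 1 - t accounts
    for a trivial pairing. On the queue side the powers of t in the eigenvalues stay unspecified,
    because the exponents of q alone separate the spectra. The vanishing conditions do not show that
    x^la occurs in P_la, so P is normalised by its value at its own spectral vector until it can be
    compared with F_la. *)

Lemma qt_monomial_inj (a b c e : nat) :
  qpar ^+ a * tpar ^+ b = qpar ^+ c * tpar ^+ e -> a = c /\ b = e.
Proof.
rewrite /qpar /tpar -!rmorphXn -!rmorphM /= => /eqP.
rewrite tofrac_eq => /eqP E.
(* Reading off the coefficient of t^b forces b = e, since a power of q is not 0; the degree in q
   then gives a = c. *)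
have C k l : (('X ^+ k)%:P * 'X^l : {poly {poly rat}})`_b =
    ('X^k : {poly rat}) *+ (b == l).
  by rewrite coefCM coefXn; case: eqP => _; rewrite ?mulr1 ?mulr0.
have {}E : ('X ^+ a)%:P * 'X^b = ('X ^+ c)%:P * 'X^e :> {poly {poly rat}} := E.
have := congr1 (fun p : {poly {poly rat}} => p`_b) E.
rewrite !C eqxx mulr1n; case: eqP => [->|_] /=; last first.
  by move/eqP; rewrite mulr0n expf_eq0 polyX_eq0 andbF.
rewrite mulr1n => /(congr1 (fun p : {poly rat} => size p)).
by rewrite !size_polyXn => -[->].
Qed.

Lemma qpar_neq0 : qpar != 0.
Proof. by rewrite tofrac_eq0 polyC_eq0 polyX_eq0. Qed.

Lemma tpar_neq0 : tpar != 0.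
Proof. by rewrite tofrac_eq0 polyX_eq0. Qed.

Lemma one_sub_qt_neq0 (a b : nat) : (0 < a + b)%N -> 1 - qpar ^+ a * tpar ^+ b != 0.
Proof.
move=> ab; rewrite subr_eq0; apply/eqP => E.
have [] := @qt_monomial_inj 0 0 a b; first by rewrite mulr1 -E.
by move=> ea eb; rewrite -ea -eb in ab.
Qed.

Lemma tpar_neq1 : 1 - tpar != 0.
Proof. by have := @one_sub_qt_neq0 0 1 isT; rewrite mul1r. Qed.

Lemma q_eq_qt_inj (a b c e : nat) :
  qpar ^+ a * tpar ^- b = qpar ^+ c * tpar ^- e -> a = c /\ b = e.
Proof.
have t0 k : tpar ^+ k != 0 by rewrite expf_neq0 // tpar_neq0.
by move/eqP; rewrite eqr_div // => /eqP /qt_monomial_inj [-> ->].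
Qed.

Strategy opaque [qpar tpar mpoly_add mpoly_opp mpoly_scale mpoly_mul mpolyC mcoeff
  mmap comp_mpoly meval msym mmeasure
  FracField.add FracField.opp FracField.mul FracField.inv].

(** * Demazure-Lusztig operators *)

Section DemazureLusztig.
Variable n : nat.
Local Notation P := {mpoly Kqt[n]}.
Implicit Types (i : 'I_n.-1) (f g p : P).

Lemma adj_neq i : adjL i != adjR i.
Proof. by rewrite -val_eqE /= neq_ltn leqnn. Qed.

Lemma sadjL i : sadj i (adjL i) = adjR i. Proof. exact: tpermL. Qed.
Lemma sadjR i : sadj i (adjR i) = adjL i. Proof. exact: tpermR. Qed.
Lemma sadjK i : involutive (sadj i). Proof. exact: tpermK. Qed.
Lemma sadjV i : ((sadj i)^-1)%g = sadj i. Proof. exact: tpermV. Qed.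

Lemma subX_neq0 (j k : 'I_n) : j != k -> 'X_j - 'X_k != 0 :> P.
Proof.
move=> jk; apply/eqP => /(congr1 (mcoeff U_(j)%MM)) /eqP.
by rewrite mcoeffB !mcoeffX eqxx eq_mnm1 [k == j]eq_sym (negbTE jk) subr0 mcoeff0 oner_eq0.
Qed.

Lemma spolyX i (j : 'I_n) : spoly i 'X_j = 'X_(sadj i j) :> P.
Proof.
rewrite /spoly msymX; congr mpolyX; apply/mnmP => k.
by rewrite !mnmE -(inj_eq (@perm_inj _ (sadj i))) permKV.
Qed.

Lemma spolyK i : involutive (@spoly n i).
Proof. by move=> f; rewrite /spoly -msymMm tperm2 msym1m. Qed.

Lemma spoly1 i : spoly i 1 = 1 :> P. Proof. exact: msym1. Qed.

Lemma spolyZ i c f : spoly i (c *: f) = c *: spoly i f.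
Proof. exact: msymZ. Qed.

Lemma spolyM i f g : spoly i (f * g) = spoly i f * spoly i g.
Proof. exact: msymM. Qed.

Lemma spolyB i f g : spoly i (f - g) = spoly i f - spoly i g.
Proof. exact: msymB. Qed.

Lemma spolyD i f g : spoly i (f + g) = spoly i f + spoly i g.
Proof. exact: msymD. Qed.

Lemma meval_spoly i f v : (spoly i f).@[v] = f.@[v \o sadj i].
Proof.
rewrite -[LHS]/(meval v (msym (sadj i) f)) -[msym _ _]comp_mpoly_id msym_mPo comp_mpoly_meval.
by apply: meval_eq => j /=; rewrite !tnth_mktuple mevalXU.
Qed.

(** Suited to identities between algebra morphisms such as [spoly], [Omega] and [substq], where only
    the variables need a computation. *)
Lemma mpoly_alg_ind (D : P -> Prop) :
  D 1 -> (forall j, D 'X_j) -> (forall f g, D f -> D g -> D (f * g)) ->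
  (forall f g, D f -> D g -> D (f + g)) -> (forall c f, D f -> D (c *: f)) ->
  forall f, D f.
Proof.
move=> D1 DX DM DD DZ.
have DXn j k : D ('X_j ^+ k).
  by elim: k => [|k IH]; rewrite ?expr0 // exprS; apply: DM.
have DX' u : D 'X_[u] by rewrite mpolyXE_id; apply: (big_ind D).
elim/mpolyind => [|c u f _ _ Df]; first by rewrite -(scale0r (1 : P)); apply: DZ.
by apply: DD => //; apply: DZ.
Qed.

(** The product case is the twisted Leibniz rule f g - s(f g) = (f - s f) g + s f (g - s g). It
    makes the division in [Top] exact, so that the [epsilon] there denotes the operator. *)
Lemma dvd_sub_spoly i f : exists g, ('X_(adjL i) - 'X_(adjR i)) * g = f - spoly i f.
Proof.
elim/mpoly_alg_ind: f => [|j|f1 f2 [g1 e1] [g2 e2]|f1 f2 [g1 e1] [g2 e2]|c f [g e]].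
- by exists 0; rewrite /spoly msym1 subrr mulr0.
- rewrite spolyX /sadj; case: tpermP => [->|->|_ _].
  + by exists 1; rewrite mulr1.
  + by exists (-1); rewrite mulrN1 opprB.
  + by exists 0; rewrite mulr0 subrr.
- exists (g1 * f2 + spoly i f1 * g2).
  rewrite spolyM; move: (_ - 'X_(adjR i)) (spoly i f1) (spoly i f2) e1 e2 => x s1 s2 e1 e2.
  transitivity ((x * g1) * f2 + s1 * (x * g2)); first by ring.
  by rewrite e1 e2; ring.
- by exists (g1 + g2); rewrite spolyD mulrDr e1 e2 opprD addrACA.
- by exists (c *: g); rewrite spolyZ -scalerAr e scalerBr.
Qed.

Lemma TopP i f :
  ('X_(adjL i) - 'X_(adjR i)) * Top i f =
    ('X_(adjL i) - 'X_(adjR i)) * (tpar *: f)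
    - (tpar *: 'X_(adjL i) - 'X_(adjR i)) * (f - spoly i f).
Proof.
rewrite /Top; set Q := (fun g : P => _ = _).
suff: exists g, Q g by move/(epsilon_spec (inhabits 0)).
have [g e] := dvd_sub_spoly i f; rewrite /Q -e {Q}.
exists (tpar *: f - (tpar *: 'X_(adjL i) - 'X_(adjR i)) * g).
by move: (_ - 'X_(adjR i)) (_ - 'X_(adjR i)) (tpar *: f) => x y z; ring.
Qed.

Strategy opaque [Top spoly].

(** The polynomial ring is a domain, so identities for T_i may be checked after multiplication by
    x_i - x_(i+1). *)
Lemma Top_unique i f g :
  ('X_(adjL i) - 'X_(adjR i)) * g =
    ('X_(adjL i) - 'X_(adjR i)) * (tpar *: f)
    - (tpar *: 'X_(adjL i) - 'X_(adjR i)) * (f - spoly i f) -> g = Top i f.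
Proof. by move=> e; apply: (mulfI (subX_neq0 (adj_neq i))); rewrite TopP. Qed.

Lemma TopD i f g : Top i (f + g) = Top i f + Top i g.
Proof.
symmetry; apply: Top_unique; rewrite spolyD scalerDr; move: (TopP i f) (TopP i g).
move: (_ - _) (_ - 'X_(adjR i)) (Top i f) (Top i g) (spoly i f) (spoly i g).
move: (tpar *: f) (tpar *: g) => tf tg x y a b c d e1 e2.
by rewrite mulrDr e1 e2; ring.
Qed.

Lemma TopZ i c f : Top i (c *: f) = c *: Top i f.
Proof.
symmetry; apply: Top_unique; rewrite spolyZ -!mul_mpolyC; move: (TopP i f).
rewrite -!mul_mpolyC; move: (_ - _) (_ - 'X_(adjR i)) (Top i f) (spoly i f).
move: (tpar%:MP) (c%:MP) => t c' x y a b e.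
by rewrite mulrCA e; ring.
Qed.

Lemma Top0 i : Top i 0 = 0.
Proof. by rewrite -[X in Top i X](scale0r (0 : P)) TopZ scale0r. Qed.

Lemma TopB i f g : Top i (f - g) = Top i f - Top i g.
Proof. by rewrite TopD -scaleN1r TopZ scaleN1r. Qed.

Lemma Top_sum (I : Type) (r : seq I) (Q : pred I) (F : I -> P) i :
  Top i (\sum_(j <- r | Q j) F j) = \sum_(j <- r | Q j) Top i (F j).
Proof. exact: (big_morph _ (@TopD i) (@Top0 i)). Qed.

Lemma Top_mul_sym i g f : spoly i g = g -> Top i (g * f) = g * Top i f.
Proof.
move=> e; symmetry; apply: Top_unique; move: (TopP i f); rewrite spolyM e -!mul_mpolyC.
move: 'X_(adjL i) 'X_(adjR i) (tpar%:MP) (Top i f) (spoly i f) => x y t a b e'.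
by rewrite mulrCA e'; ring.
Qed.

Lemma Top_sym i f : spoly i f = f -> Top i f = tpar *: f.
Proof. by move=> e; symmetry; apply: Top_unique; rewrite e subrr mulr0 subr0. Qed.

(** The Hecke relation (T_i - t)(T_i + 1) = 0. The defining equation and its image under s_i express
    both T_i f and s_i (T_i f) through f and s_i f. *)
Lemma Top_quadratic i f : Top i (Top i f) = (tpar - 1) *: Top i f + tpar *: f.
Proof.
symmetry; apply: Top_unique.
have e1 := TopP i f.
have e2 := congr1 (spoly i) e1.
rewrite !(spolyM, spolyB, spolyZ, spolyX, spolyK, sadjL, sadjR) in e2.
apply: (mulfI (subX_neq0 (adj_neq i))).
move: e1 e2; rewrite -!mul_mpolyC.
move: (Top i f) (spoly i (Top i f)) (spoly i f) => g h k.
rewrite !(rmorphB, rmorph1) /=.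
move: 'X_(adjL i) 'X_(adjR i) (tpar%:MP) => x y t e1 e2.
have {}e2 : (x - y) * h = (x - y) * (t * k) - (t * y - x) * (k - f) * -1.
  have -> : (x - y) * h = - ((y - x) * h) by ring.
  by rewrite e2; ring.
transitivity ((x - y) * ((t - 1) * ((x - y) * g) + (x - y) * (t * f))); first by ring.
transitivity ((x - y) * (t * ((x - y) * g)) - (t * x - y) * ((x - y) * g - (x - y) * h)); last by ring.
by rewrite e1 e2; ring.
Qed.

(** Since T_i + 1 - t = t T_i^-1, this is the relation T_i x_i = t x_(i+1) T_i^-1 of the affine
    Hecke algebra. It will account for a bottom ball that moves into an empty column. *)
Lemma Top_mulXL i f :
  Top i ('X_(adjL i) * f) = 'X_(adjR i) * (Top i f + (1 - tpar) *: f).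
Proof.
symmetry; apply: Top_unique; move: (TopP i f).
rewrite spolyM spolyX sadjL -!mul_mpolyC rmorphB rmorph1 /=.
move: 'X_(adjL i) 'X_(adjR i) (tpar%:MP) (Top i f) (spoly i f) => x y t a b e.
by rewrite mulrCA mulrDr e; ring.
Qed.

Definition Tinv i f : P := tpar^-1 *: (Top i f + (1 - tpar) *: f).

Lemma TopK i : cancel (Top i) (Tinv i).
Proof.
move=> f; rewrite /Tinv Top_quadratic addrAC -scalerDl addrC.
have -> : tpar - 1 + (1 - tpar) = 0 :> Kqt by ring.
by rewrite scale0r addr0 scalerA mulVf ?tpar_neq0 // scale1r.
Qed.

Lemma TinvK i : cancel (Tinv i) (Top i).
Proof.
move=> f; rewrite /Tinv TopZ TopD TopZ Top_quadratic addrAC -scalerDl addrC.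
have -> : tpar - 1 + (1 - tpar) = 0 :> Kqt by ring.
by rewrite scale0r addr0 scalerA mulVf ?tpar_neq0 // scale1r.
Qed.

Lemma msizeD_leq f g d : (msize f <= d -> msize g <= d -> msize (f + g) <= d)%N.
Proof. by move=> hf hg; apply: (leq_trans (mmeasureD_le _ _ _)); rewrite geq_max hf. Qed.

Lemma msizeZ_leq c f d : (msize f <= d -> msize (c *: f) <= d)%N.
Proof. exact/leq_trans/msizeZ_le. Qed.

Lemma msizeB_leq f g d : (msize f <= d -> msize g <= d -> msize (f - g) <= d)%N.
Proof. by move=> hf hg; rewrite msizeD_leq // -scaleN1r msizeZ_leq. Qed.

Lemma msize_subX (j k : 'I_n) : j != k -> msize ('X_j - 'X_k : P) = 2.
Proof.
move=> jk; apply/eqP; rewrite eqn_leq; apply/andP; split.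
  by rewrite msizeB_leq // msizeX mdeg1.
have : U_(j)%MM \in msupp ('X_j - 'X_k : P).
  by rewrite mcoeff_msupp mcoeffB !mcoeffX eqxx eq_mnm1 [k == j]eq_sym (negbTE jk) subr0 oner_eq0.
by move/msize_mdeg_lt; rewrite mdeg1.
Qed.

Lemma msize_sum_leq (I : Type) (r : seq I) (Q : pred I) (F : I -> P) d :
  (forall j, Q j -> msize (F j) <= d)%N -> (msize (\sum_(j <- r | Q j) F j) <= d)%N.
Proof.
move=> h; elim/big_rec: _ => [|j x Qj hx]; first by rewrite msize0.
by apply: msizeD_leq => //; apply: h.
Qed.

(** [msize] is the degree plus one, and 0 at the zero polynomial; hence the shift in one factor
    only. *)
Lemma msizeM_leq f g a b : (msize f <= a.+1 -> msize g <= b -> msize (f * g) <= a + b)%N.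
Proof.
have [->|f0] := eqVneq f 0; first by rewrite mul0r msize0.
have [->|g0] := eqVneq g 0; first by rewrite mulr0 msize0.
move=> hf hg; rewrite msizeM //.
have := leq_add hf hg; rewrite addSn; by case: (_ + _)%N.
Qed.

Lemma msize_cancel f g d : (1 < msize f -> msize (f * g) <= d.+1 -> msize g <= d)%N.
Proof.
have [->|f0] := eqVneq f 0; first by rewrite msize0.
have [->|g0] := eqVneq g 0; first by rewrite msize0.
move=> hf; rewrite msizeM //; case: (msize f) hf => [|[|k]] // _.
by rewrite !addSn /= ltnS => /(leq_trans (leq_addl _ _)).
Qed.

Lemma msize_spoly i f : msize (spoly i f) = msize f.
Proof.
have le g : (msize (spoly i g) <= msize g)%N.
  rewrite [X in (X <= _)%N]msizeE; apply/bigmax_leqP_seq => u.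
  rewrite mcoeff_msupp mcoeff_sym -mcoeff_msupp => /msize_mdeg_lt.
  by rewrite mdeg_mperm.
by apply/eqP; rewrite eqn_leq le -{1}(spolyK i f) le.
Qed.

Lemma msize_Top i f d : (msize f <= d -> msize (Top i f) <= d)%N.
Proof.
move=> hf; apply: (@msize_cancel ('X_(adjL i) - 'X_(adjR i))).
  by rewrite msize_subX // adj_neq.
rewrite TopP; apply: msizeB_leq.
  by apply: (@msizeM_leq _ _ 1); rewrite ?msize_subX ?adj_neq ?msizeZ_leq.
apply: (@msizeM_leq _ _ 1); last by rewrite msizeB_leq ?msize_spoly.
by apply: msizeB_leq; rewrite ?msizeZ_leq ?msizeX ?mdeg1.
Qed.

Lemma msize_Tinv i f d : (msize f <= d -> msize (Tinv i f) <= d)%N.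
Proof. by move=> hf; rewrite msizeZ_leq ?msizeD_leq ?msizeZ_leq ?msize_Top. Qed.

Lemma meval_Top i f (v : 'I_n -> Kqt) :
  (v (adjL i) - v (adjR i)) * (Top i f).@[v] =
    (v (adjL i) - v (adjR i)) * (tpar * f.@[v])
    - (tpar * v (adjL i) - v (adjR i)) * (f.@[v] - f.@[v \o sadj i]).
Proof.
have := congr1 (meval v) (TopP i f).
by rewrite !(mevalM, mevalB, mevalZ, mevalXU) meval_spoly.
Qed.

End DemazureLusztig.

Lemma DL_value_solve (F : fieldType) (t x y u v w : F) : x - y != 0 ->
  (x - y) * w = (x - y) * (t * u) - (t * x - y) * (u - v) ->
  w = ((1 - t) * y) / (x - y) * u + (t * x - y) / (x - y) * v.
Proof. by move=> xy e; apply: (mulfI xy); rewrite e; field. Qed.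

(** * Spectral vectors and the values of T_i on them *)

Section SpectralVectors.
Variable n : nat.
Implicit Types (mu nu : 'X_{1..n}) (i : 'I_n.-1).

Definition swp i mu : 'X_{1..n} := pact (sadj i) mu.

Lemma swpE i mu j : swp i mu j = mu (sadj i j).
Proof. by rewrite mnmE sadjV. Qed.

Lemma swpL i mu : swp i mu (adjL i) = mu (adjR i).
Proof. by rewrite swpE sadjL. Qed.

Lemma swpR i mu : swp i mu (adjR i) = mu (adjL i).
Proof. by rewrite swpE sadjR. Qed.

Lemma swpK i : involutive (swp i).
Proof. by move=> mu; apply/mnmP => j; rewrite !swpE sadjK. Qed.

Lemma swp_id i mu : mu (adjL i) = mu (adjR i) -> swp i mu = mu.
Proof.
by move=> e; apply/mnmP => j; rewrite swpE /sadj; case: tpermP => [->|->|].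
Qed.

Lemma mdeg_swp i mu : mdeg (swp i mu) = mdeg mu.
Proof.
rewrite !mdegE (reindex_inj (@perm_inj _ (sadj i))) /=.
by apply: eq_bigr => j _; rewrite swpE sadjK.
Qed.

Lemma sadj_lt i (j k : 'I_n) :
  ~~ (((j == adjL i) && (k == adjR i)) || ((j == adjR i) && (k == adjL i))) ->
  (sadj i j < sadj i k)%N = (j < k)%N.
Proof.
have aL := erefl (val (adjL i)); have aR := erefl (val (adjR i)).
rewrite /sadj -!val_eqE /= in aL aR *.
by case: tpermP => [->|->|/eqP + /eqP]; case: tpermP => [->|->|/eqP + /eqP];
  rewrite -?val_eqE /=; lia.
Qed.

(** In this form k_j is the rank of column j when the columns are sorted by decreasing part, ties
    from right to left; swaps and rotations then simply transport the counted set. *)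
Lemma kidxE mu (j : 'I_n) :
  kidx mu j = #|[set k : 'I_n | (mu j < mu k)%N || ((mu j == mu k) && (j < k)%N)]|.
Proof.
rewrite /kidx -cardsUI [X in (_ + X)%N](_ : _ = 0%N) ?addn0; last first.
  by apply: eq_card0 => k; rewrite !inE; case: (ltngtP k j) => //= _; rewrite andbF.
apply: eq_card => k; rewrite !inE.
have [->|/eqP jk] := eqVneq k j; first by rewrite !ltnn eqxx.
have : nat_of_ord k <> nat_of_ord j by move/val_inj.
by lia.
Qed.

Lemma kidx_swp i mu (j : 'I_n) : mu (adjL i) != mu (adjR i) ->
  kidx (swp i mu) j = kidx mu (sadj i j).
Proof.
move=> ne; rewrite !kidxE -[RHS](card_imset _ (@perm_inj _ (sadj i))).
apply: eq_card => k; rewrite -[in RHS](sadjK i k) mem_imset; last exact: perm_inj.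
rewrite !inE !swpE; case: eqP => e; rewrite ?andbF //= sadj_lt //.
apply/negP => /orP[] /andP[/eqP ej /eqP ek]; move: e; rewrite ej ek ?(sadjL, sadjR) => e;
by rewrite e eqxx in ne.
Qed.

Lemma kidx_adj_eq i mu : mu (adjL i) = mu (adjR i) ->
  kidx mu (adjL i) = (kidx mu (adjR i)).+1.
Proof.
move=> e; rewrite !kidxE (cardsD1 (adjR i)) !inE e eqxx /= ltnS leqnn orbT add1n.
congr _.+1; apply: eq_card => k; rewrite !inE.
have [->|] := eqVneq k (adjR i); first by rewrite !ltnn eqxx.
by rewrite -val_eqE /= => /eqP ne; lia.
Qed.

Lemma spec_swp i mu (j : 'I_n) : mu (adjL i) != mu (adjR i) ->
  spec (swp i mu) j = spec mu (sadj i j).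
Proof. by move=> ne; rewrite /spec kidx_swp // swpE. Qed.

(** Equal adjacent parts make t x_i - x_(i+1) vanish, so the permuted point, which need not be a
    spectral vector, does not enter the value of T_i f. *)
Lemma spec_adj_eq i mu : mu (adjL i) = mu (adjR i) ->
  spec mu (adjR i) = tpar * spec mu (adjL i).
Proof.
move=> e; rewrite /spec kidx_adj_eq // e exprS invfM mulrCA.
by rewrite mulVKf ?tpar_neq0.
Qed.

Lemma spec_neq mu (j k : 'I_n) : mu j != mu k -> spec mu j != spec mu k.
Proof. by apply: contraNneq => /q_eq_qt_inj [-> _]. Qed.

(** Different parts give different exponents of q, whatever the powers of t. This keeps the second
    coefficient in [Top_spec] nonzero. *)
Lemma tspec_neq mu (j k : 'I_n) : mu j != mu k -> tpar * spec mu j != spec mu k.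
Proof.
apply: contraNneq; rewrite /spec mulrCA => /eqP.
rewrite [X in _ == X](_ : _ = qpar ^+ mu k * (tpar / tpar ^+ (kidx mu k).+1)); last first.
  by rewrite exprS invfM mulVKf ?tpar_neq0.
rewrite !mulrA eqr_div ?expf_neq0 ?tpar_neq0 // -!mulrA -!exprS => /eqP.
by move/qt_monomial_inj=> [-> _].
Qed.

Lemma spec_neq0 mu j : spec mu j != 0.
Proof.
exact: (mulf_neq0 (expf_neq0 _ qpar_neq0) (invr_neq0 (expf_neq0 _ tpar_neq0))).
Qed.

Lemma Top_spec_eq i f mu : mu (adjL i) = mu (adjR i) ->
  (Top i f).@[spec mu] = tpar * f.@[spec mu].
Proof.
move=> e; have := meval_Top i f (spec mu); rewrite spec_adj_eq // subrr mul0r subr0.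
apply: (@mulfI Kqt); rewrite -{1}[spec _ _](@mul1r Kqt) -(@mulrBl Kqt).
exact: (mulf_neq0 tpar_neq1 (spec_neq0 _ _)).
Qed.

(** Only the spectral vectors of mu and s_i mu occur, and these compositions have the same degree;
    this is why T_i respects vanishing conditions given by degree. *)
Lemma Top_spec i f mu : mu (adjL i) != mu (adjR i) ->
  let x := spec mu (adjL i) in let y := spec mu (adjR i) in
  (Top i f).@[spec mu] =
    ((1 - tpar) * y) / (x - y) * f.@[spec mu]
    + (tpar * x - y) / (x - y) * f.@[spec (swp i mu)].
Proof.
move=> ne x y; have xy : x - y != 0 by rewrite subr_eq0 spec_neq.
have := meval_Top i f (spec mu); rewrite -/x -/y.
rewrite [f.@[_ \o _]](@meval_eq _ _ _ (spec (swp i mu))); last first.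
  by move=> j; rewrite spec_swp.
exact: DL_value_solve.
Qed.

End SpectralVectors.

(** * Rotation and interpolation *)

Section Rotation.
Variable m : nat.
Local Notation P := {mpoly Kqt[m.+1]}.
Local Notation Top := (@Top m.+1).
Local Notation spoly := (@spoly m.+1).
Local Notation adjL := (@adjL m.+1).
Local Notation adjR := (@adjR m.+1).
Local Notation sadj := (@sadj m.+1).
Implicit Types (mu nu u : 'X_{1..m.+1}) (i j : 'I_m) (f g : P).

Definition rotm mu : 'X_{1..m.+1} := [multinom mu (ord_pred i) | i < m.+1].
Definition up mu : 'X_{1..m.+1} := (rotm mu + U_(ord0))%MM.

Lemma rotmE mu k : rotm mu (ordS k) = mu k.
Proof. by rewrite mnmE ordSK. Qed.

Lemma ordS_val (k : 'I_m.+1) : val (ordS k) = if k == ord_max then 0%N else k.+1.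
Proof.
rewrite -val_eqE /=; case: eqP => [->|km]; first by rewrite modnn.
by rewrite modn_small // ltnS ltn_neqAle -ltnS ltn_ord andbT; apply/eqP.
Qed.

Lemma ordS_eq0 (k : 'I_m.+1) : (ordS k == ord0) = (k == ord_max).
Proof. by rewrite -[LHS]val_eqE ordS_val; case: (k == ord_max). Qed.

Lemma upE mu k : up mu (ordS k) = (mu k + (k == ord_max))%N.
Proof. by rewrite mnmDE rotmE mnm1E eq_sym ordS_eq0. Qed.

Lemma rotm_inj : injective rotm.
Proof. by move=> u v e; apply/mnmP => k; rewrite -(rotmE u) -(rotmE v) e. Qed.

Lemma rotm_surj u : exists v, u = rotm v.
Proof.
by exists [multinom u (ordS k) | k < m.+1]; apply/mnmP => k; rewrite !mnmE ord_predK.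
Qed.

Lemma up_surj u : u ord0 != 0%N -> exists v, u = up v.
Proof.
move=> u0; have [v e] := rotm_surj (u - U_(ord0))%MM; exists v.
by rewrite /up -e submK //; apply/mnm_lepP => k; rewrite mnm1E; case: eqP => // <-; rewrite lt0n.
Qed.

Lemma mdeg_rotm mu : mdeg (rotm mu) = mdeg mu.
Proof.
rewrite !mdegE (reindex_inj (@ordS_inj m.+1)) /=.
by apply: eq_bigr => k _; rewrite rotmE.
Qed.

Lemma mdeg_up mu : mdeg (up mu) = (mdeg mu).+1.
Proof. by rewrite mdegD mdeg_rotm mdeg1 addn1. Qed.

(** The last column wins every tie. Moved to the front it would lose them, but the added 1 turns
    them into strict inequalities, so all ranks are kept. *)
Lemma kidx_up mu k : kidx (up mu) (ordS k) = kidx mu k.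
Proof.
rewrite !kidxE -[RHS](card_imset _ (@ordS_inj m.+1)).
apply: eq_card => l; rewrite -[in RHS](ord_predK l) mem_imset; last exact: ordS_inj.
rewrite -(ord_predK l); move: (ord_pred l) => {}l; rewrite !inE ordSK !upE !ordS_val.
have kn := ltn_ord k; have ln := ltn_ord l.
case: (eqVneq k ord_max) => [->|k0]; case: (eqVneq l ord_max) => [->|l0];
  try rewrite -val_eqE /= in k0; try rewrite -val_eqE /= in l0; rewrite ?ltnn //=; lia.
Qed.

Lemma spec_up mu k :
  spec (up mu) (ordS k) = (if k == ord_max then qpar else 1) * spec mu k.
Proof.
rewrite /spec kidx_up upE; case: eqP => _; rewrite ?addn0 ?mul1r //.
by rewrite addn1 exprS mulrA.
Qed.

(** A zero in column 0 loses every comparison and every tie, so its rank is m. Together with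
    [spec0_neq], the factor x_0 - t^-m vanishes on exactly those spectral vectors that do not come
    from [up]. *)
Lemma spec0_eq mu : mu ord0 = 0%N -> spec mu ord0 = tpar ^- m.
Proof.
move=> e; rewrite /spec e expr0 mul1r kidxE; congr (_ ^- _).
rewrite (eq_card (B := predC1 ord0)) => [|k]; first by rewrite cardC1 card_ord.
rewrite !inE e; case: (posnP (mu k)) => [->|k0]; first by rewrite eqxx -val_eqE /= lt0n.
by apply/esym/eqP => ek; rewrite ek e in k0.
Qed.

Lemma spec0_neq mu : mu ord0 != 0%N -> spec mu ord0 != tpar ^- m.
Proof.
apply: contraNneq => h; have [] := @q_eq_qt_inj (mu ord0) (kidx mu ord0) 0 m; last by move->.
by rewrite expr0 mul1r -h.
Qed.

Definition Omega f : P :=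
  f \mPo [tuple (if i == ord_max then qpar^-1 else 1) *: 'X_(ordS i) | i < m.+1].

Lemma OmegaX k : Omega 'X_k = (if k == ord_max then qpar^-1 else 1) *: 'X_(ordS k).
Proof. by rewrite /Omega comp_mpolyXU -tnth_nth tnth_mktuple. Qed.

Lemma OmegaD f g : Omega (f + g) = Omega f + Omega g.
Proof. exact: comp_mpolyD. Qed.

Lemma OmegaB f g : Omega (f - g) = Omega f - Omega g.
Proof. exact: comp_mpolyB. Qed.

Lemma OmegaZ c f : Omega (c *: f) = c *: Omega f.
Proof. exact: comp_mpolyZ. Qed.

Lemma OmegaM f g : Omega (f * g) = Omega f * Omega g.
Proof. exact: (rmorphM (comp_mpoly _)). Qed.

Lemma Omega1 : Omega 1 = 1. Proof. exact: comp_mpoly1. Qed.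
Lemma Omega0 : Omega 0 = 0. Proof. exact: comp_mpoly0. Qed.

Lemma Omega_sum (I : Type) (r : seq I) (Q : pred I) (F : I -> P) :
  Omega (\sum_(k <- r | Q k) F k) = \sum_(k <- r | Q k) Omega (F k).
Proof. exact: (big_morph _ OmegaD Omega0). Qed.

Lemma OmegaXm u : Omega 'X_[u] = qpar ^- (u ord_max) *: 'X_[rotm u].
Proof.
rewrite /Omega comp_mpolyX [X in _ *: X]mpolyXE_id [X in _ *: X](reindex_inj (@ordS_inj m.+1)) /=.
rewrite (eq_bigr (fun k => (if k == ord_max then qpar^-1 else 1) ^+ (u k) *: 'X_(ordS k) ^+ rotm u (ordS k))); last first.
  by move=> k _; rewrite tnth_mktuple exprZn rotmE.
rewrite scaler_prod; congr (_ *: _).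
rewrite (bigD1 ord_max) //= eqxx big1 ?mulr1 ?exprVn // => k /negbTE ->.
by rewrite expr1n.
Qed.

Lemma mcoeff_Omega f u : (Omega f)@_(rotm u) = qpar ^- (u ord_max) * f@_u.
Proof.
elim/mpolyind: f => [|c v f _ _ IH]; first by rewrite Omega0 !mcoeff0 mulr0.
rewrite OmegaD OmegaZ OmegaXm !mcoeffD IH mulrDr !mcoeffZ !mcoeffX (inj_eq rotm_inj).
congr (_ + _); case: eqP => [->|_]; last by rewrite !mulr0.
by rewrite !mulr1 mulrC.
Qed.

(** The factor 1/q in [Omega] cancels the q gained by the part that [up] increases. *)
Lemma meval_Omega_up f mu : (Omega f).@[spec (up mu)] = f.@[spec mu].
Proof.
rewrite comp_mpoly_meval; apply: meval_eq => k; rewrite tnth_mktuple mevalZ mevalXU spec_up.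
by case: eqP => _; rewrite ?mul1r // mulKf ?qpar_neq0.
Qed.

Strategy opaque [Omega].

Lemma Omega_inj : injective Omega.
Proof.
move=> f g e; apply/mpolyP => u.
have q0 := invr_neq0 (expf_neq0 (u ord_max) qpar_neq0).
by apply: (@mulfI Kqt _ q0); rewrite -(mcoeff_Omega f) -(mcoeff_Omega g) e.
Qed.

Lemma msize_Omega f d : (msize f <= d -> msize (Omega f) <= d)%N.
Proof.
apply: leq_trans; rewrite [X in (X <= _)%N]msizeE; apply/bigmax_leqP_seq => v.
have [u ->] := rotm_surj v; rewrite mcoeff_msupp mcoeff_Omega mdeg_rotm => h _.
apply: msize_mdeg_lt; rewrite mcoeff_msupp; apply: contraNneq h => ->.
by rewrite mulr0.
Qed.

(** As j = i + 1 is a valid index, the variables exchanged by s_i exclude the last one, and the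
    factor 1/q is not touched. *)
Lemma Omega_spoly i j f : val j = i.+1 -> Omega (spoly i f) = spoly j (Omega f).
Proof.
move=> ij.
have S0 : ordS (adjL i) = adjL j.
  apply: val_inj; rewrite ordS_val -val_eqE /= ij; case: eqP => // h.
  by have := ltn_ord i; rewrite h ltnn.
have S1 : ordS (adjR i) = adjR j.
  apply: val_inj; rewrite ordS_val -val_eqE /= ij; case: eqP => // h.
  by have := ltn_ord j; rewrite ij h ltnn.
have Sj k : ordS (sadj i k) = sadj j (ordS k).
  rewrite /Defs.sadj; case: (tpermP (adjL i)) => [->|->|h1 h2]; rewrite ?S0 ?S1 ?tpermL ?tpermR //.
  by rewrite tpermD // -?S0 -?S1 (inj_eq (@ordS_inj _)) eq_sym; apply/eqP.
have im k : (sadj i k == ord_max) = (k == ord_max).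
  rewrite /Defs.sadj; case: tpermP => [->|->|//]; rewrite -!val_eqE /=;
  have := ltn_ord j; rewrite ij; lia.
elim/mpoly_alg_ind: f => [|k|f g|f g|c f].
- by rewrite spoly1 Omega1 spoly1.
- by rewrite spolyX !OmegaX spolyZ spolyX Sj im.
- move=> e1 e2; rewrite (@spolyM m.+1 i f g) (OmegaM (spoly i f)) (OmegaM f g).
  transitivity (spoly j (Omega f) * spoly j (Omega g)); last exact/esym/(@spolyM m.+1).
  exact (f_equal2 (fun a b : P => a * b) e1 e2).
- move=> e1 e2; rewrite (@spolyD m.+1 i f g) (OmegaD (spoly i f)) (OmegaD f g).
  transitivity (spoly j (Omega f) + spoly j (Omega g)); last exact/esym/(@spolyD m.+1).
  exact (f_equal2 (fun a b : P => a + b) e1 e2).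
- move=> e; rewrite (@spolyZ m.+1 i c f) (OmegaZ c (spoly i f)) (OmegaZ c f).
  transitivity (c *: spoly j (Omega f)); last exact/esym/(@spolyZ m.+1).
  exact (f_equal (fun a : P => c *: a) e).
Qed.

Lemma Omega_Top i j f : val j = i.+1 -> Omega (Top i f) = Top j (Omega f).
Proof.
move=> ij; apply: Top_unique; rewrite -(Omega_spoly f ij).
have := congr1 Omega (@TopP m.+1 i f).
have i1 : (i.+1 < m)%N by rewrite -ij ltn_ord.
have XL : Omega 'X_(adjL i) = 'X_(adjL j).
  rewrite OmegaX -val_eqE /= (ltn_eqF (ltnW i1)) scale1r; congr ('X_ _).
  by apply: val_inj; rewrite ordS_val -val_eqE /= (ltn_eqF (ltnW i1)).
have XR : Omega 'X_(adjR i) = 'X_(adjR j).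
  rewrite OmegaX -val_eqE /= (ltn_eqF i1) scale1r; congr ('X_ _).
  by apply: val_inj; rewrite ordS_val -val_eqE /= (ltn_eqF i1) ij.
by rewrite !(OmegaM, OmegaB, OmegaZ) XL XR.
Qed.

End Rotation.

Section Interpolation.
Variable m : nat.
Local Notation P := {mpoly Kqt[m.+1]}.
Local Notation Top := (@Top m.+1).
Local Notation adjL := (@adjL m.+1).
Local Notation adjR := (@adjR m.+1).
Local Notation swp := (@swp m.+1).
Implicit Types (mu nu u : 'X_{1..m.+1}) (i j : 'I_m) (f g p : P).

(** Unlike [IsEstar], this asks for a nonzero value at the spectral vector of nu. Existence is then
    accessible by induction, whereas the coefficient of x^nu is not visible at this stage. *)
Definition isP nu p : Prop :=
  [/\ (msize p <= (mdeg nu).+1)%N, p.@[spec nu] != 0 &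
      forall nu', (mdeg nu' <= mdeg nu)%N -> nu' != nu -> p.@[spec nu'] = 0].

Definition linf : P := 'X_ord0 - (tpar ^- m)%:MP.

Lemma msize_linf : (msize linf <= 2)%N.
Proof.
apply: msizeB_leq; first by rewrite msizeX mdeg1.
by rewrite mmeasureC; case: (_ != _).
Qed.

Lemma meval_linf v : linf.@[v] = v ord0 - tpar ^- m.
Proof. by rewrite mevalB mevalXU mevalC. Qed.

(** A vector whose composition begins with 0 is killed by the linear factor; any other comes from
    [up u] with u of degree one less, where the condition on p applies. *)
Lemma isP_up nu p : isP nu p -> isP (up nu) (linf * Omega p).
Proof.
move=> [sp vp zp]; split.
- by rewrite mdeg_up; apply: (@msizeM_leq _ _ _ 1); rewrite ?msize_linf ?msize_Omega.
- rewrite mevalM meval_Omega_up meval_linf; apply: (@mulf_neq0 Kqt) vp.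
  by rewrite subr_eq0 spec0_neq // mnmDE mnm1E eqxx addn1.
move=> nu' d ne; rewrite mevalM meval_linf.
have [e|/eqP n0] := eqVneq (nu' ord0) 0%N; first by rewrite spec0_eq // subrr mul0r.
have [u eu] := up_surj (introN eqP n0).
rewrite eu meval_Omega_up zp ?mulr0 //.
  by rewrite eu !mdeg_up in d.
by apply: contraNneq ne => e; rewrite eu e.
Qed.

Lemma isP_swp i mu p : mu (adjL i) != mu (adjR i) -> isP mu p ->
  exists2 c, isP (swp i mu) (Top i p - c *: p) & (Top i p - c *: p).@[spec mu] = 0.
Proof.
move=> ne [sp vp zp].
have ne' : swp i mu (adjL i) != swp i mu (adjR i) by rewrite swpL swpR eq_sym.
have sne : swp i mu != mu by apply: contraNneq ne => e; rewrite -(@swpL m.+1 i) e.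
have E c v : (Top i p - c *: p).@[v] = (Top i p).@[v] - c * p.@[v].
  by rewrite mevalB mevalZ.
have z1 : p.@[spec (swp i mu)] = 0 by apply: zp => //; rewrite mdeg_swp.
pose c := (Top i p).@[spec mu] / p.@[spec mu].
have ec : (Top i p - c *: p).@[spec mu] = 0.
  by rewrite E divfK // subrr.
exists c; last exact: ec.
split.
- rewrite mdeg_swp; apply: msizeB_leq; first exact: msize_Top.
  exact: msizeZ_leq.
- rewrite E z1 (Top_spec p ne') swpK z1 !mulr0 subr0 add0r.
  apply: (@mulf_neq0 Kqt) vp; apply: (@mulf_neq0 Kqt); last first.
    by rewrite invr_neq0 // subr_eq0 spec_neq.
  by rewrite subr_eq0 tspec_neq.
move=> nu'; rewrite mdeg_swp => d ne1.
have [->|n2] := eqVneq nu' mu; first exact: ec.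
rewrite E (zp _ d n2) mulr0 subr0.
have [e|n3] := eqVneq (nu' (adjL i)) (nu' (adjR i)).
  by rewrite Top_spec_eq // (zp _ d n2) mulr0.
rewrite (Top_spec p n3) (zp _ d n2) mulr0 add0r zp ?mulr0 ?mdeg_swp //.
by apply: contraNneq ne1 => <-; rewrite swpK.
Qed.

(** Double induction, on the degree and on the position of a nonzero part: exchanges with zeros
    bring that part to column 0, where [up] can be inverted. *)
Lemma isP_exists mu : exists p, isP mu p.
Proof.
have [d] := ubnP (mdeg mu); elim: d mu => // d IHd mu; rewrite ltnS => dmu.
have [->|mu0] := eqVneq mu 0%MM.
  exists 1; split; rewrite ?mdeg0 ?mmeasure1 ?meval1 ?oner_neq0 // => nu'.
  by rewrite leqn0 mdeg_eq0 => /eqP ->; rewrite eqxx.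
have H (k : nat) (nu : 'X_{1..m.+1}) (kn : (k < m.+1)%N) :
    mdeg nu = mdeg mu -> nu (Ordinal kn) != 0%N -> exists p, isP nu p.
  elim: k nu kn => [|k IHk] nu kn dnu nz.
    have [u eu] : exists u, nu = up u.
      by apply: up_surj; move: nz; congr (nu _ != _); apply: val_inj.
    have [|p pP] := IHd u; last by exists (linf * Omega p); rewrite eu; apply: isP_up.
    by rewrite -mdeg_up -eu dnu.
  have [e|nz'] := eqVneq (nu (Ordinal (ltnW kn))) 0%N; last exact: (IHk nu (ltnW kn)).
  have km : (k < m)%N by [].
  pose i : 'I_m := Ordinal km.
  have eL : Ordinal (ltnW kn) = adjL i by apply: val_inj.
  have eR : Ordinal kn = adjR i by apply: val_inj.
  rewrite eL in e; rewrite eR in nz.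
  have [||p pP] := IHk (swp i nu) (ltnW kn); rewrite ?mdeg_swp //.
    by rewrite eL swpL.
  have [|c] := @isP_swp i (swp i nu) p _ pP; first by rewrite swpL swpR e.
  by rewrite swpK => pP' _; exists (Top i p - c *: p).
have [k nz] : exists k, mu k != 0%N.
  apply/existsP; apply: contraNT mu0; rewrite negb_exists => /forallP h.
  by apply/eqP/mnmP => k; rewrite mnm0E; move: (h k); rewrite negbK => /eqP.
by apply: (H k mu (ltn_ord k)) => //; move: nz; congr (mu _ != _); apply: val_inj.
Qed.

(* The values at the spectral points of degree at most d determine a polynomial of degree
   at most d: the evaluation matrix is square, and pairing a left-kernel vector with the
   polynomials of isP_exists, in decreasing degree, shows that it is row-free. *)
Lemma vanish_eq0 d p : (msize p <= d.+1)%N ->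
  (forall nu, (mdeg nu <= d)%N -> p.@[spec nu] = 0) -> p = 0.
Proof.
move=> sp zp; pose I := 'X_{1..m.+1 < d.+1}.
pose A := \matrix_(k < #|{: I}|, l < #|{: I}|)
  ('X_[enum_val k] : P).@[spec (enum_val l : I)].
pose rowof (f : P) := \row_(k < #|{: I}|) f@_(enum_val k : I).
have rowA f l : (msize f <= d.+1)%N -> (rowof f *m A) ord0 l = f.@[spec (enum_val l : I)].
  move=> sf; rewrite mxE [f in RHS](mpolywE sf) raddf_sum /=.
  rewrite [RHS](reindex (fun k : 'I_#|{: I}| => enum_val k)) /=; last first.
    by exists enum_rank => k _; rewrite ?enum_valK ?enum_rankK.
  by apply: eq_bigr => k _; rewrite !mxE mevalZ.
have uA : A \in unitmx.
  rewrite -unitmx_tr -row_free_unit -kermx_eq0; apply/rowV0P => c.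
  move/sub_kermxP => cA.
  have ce f : (msize f <= d.+1)%N -> \sum_l c ord0 l * f.@[spec (enum_val l : I)] = 0.
    move=> sf; have : (rowof f *m A *m c^T) = 0.
      by rewrite -mulmxA -[A]trmxK -trmx_mul cA trmx0 mulmx0.
    move/matrixP/(_ ord0 ord0); rewrite mxE [RHS]mxE => h; rewrite -[RHS]h.
    by apply: eq_bigr => l _; rewrite rowA // mxE mulrC.
  apply/rowP => l; rewrite mxE.
  have [e] := ubnP (d - mdeg (enum_val l : I)); elim: e l => // e IH l; rewrite ltnS => le.
  have [f [sf vf zf]] := isP_exists (enum_val l : I).
  have dl := bmdeg (enum_val l : I).
  have := ce f (leq_trans sf dl); rewrite (bigD1 l) //= big1 ?addr0.
    by move/eqP; rewrite mulf_eq0 (negbTE vf) orbF => /eqP.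
  move=> k kl; have dk := bmdeg (enum_val k : I).
  have [lk|kl'] := ltnP (mdeg (enum_val l : I)) (mdeg (enum_val k : I)).
    by rewrite IH ?mul0r //; move: lk dk dl le; lia.
  rewrite zf ?mulr0 //; apply: contraNneq kl => h; apply/eqP; apply: enum_val_inj.
  exact/val_inj.
have r0 : rowof p = 0.
  rewrite -[rowof p](mulmxK uA) (_ : _ *m A = 0) ?mul0mx //.
  by apply/rowP => l; rewrite rowA // mxE zp // -ltnS bmdeg.
rewrite (mpolywE sp) big1 // => k _.
have := congr1 (fun M : 'rV_ _ => M ord0 (enum_rank k)) r0.
by rewrite !mxE enum_rankK => ->; rewrite scale0r.
Qed.

End Interpolation.

(** * Knop's operators on the interpolation polynomials *)

Section KnopOperator.
Variable m : nat.
Local Notation P := {mpoly Kqt[m.+1]}.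
Local Notation Top := (@Top m.+1).
Local Notation spoly := (@spoly m.+1).
Local Notation adjL := (@adjL m.+1).
Local Notation adjR := (@adjR m.+1).
Local Notation sadj := (@sadj m.+1).
Local Notation swp := (@swp m.+1).
Implicit Types (mu nu u : 'X_{1..m.+1}) (i j : 'I_m) (f g p : P) (w : seq nat).

(** Indices in [nat] allow words such as [iota]; an index out of range gives the identity. *)
Definition Tn (k : nat) f : P := oapp (fun i : 'I_m => Top i f) f (insub k).
Definition Tw w f : P := foldr Tn f w.

Lemma TnE i f : Tn i f = Top i f.
Proof. by rewrite /Tn valK. Qed.

Lemma Tw_rcons w k f : Tw (rcons w k) f = Tw w (Tn k f).
Proof. exact: foldr_rcons. Qed.

Lemma TnD k f g : Tn k (f + g) = Tn k f + Tn k g.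
Proof. by rewrite /Tn; case: insub => [i|] //=; apply: TopD. Qed.

Lemma TnZ k c f : Tn k (c *: f) = c *: Tn k f.
Proof. by rewrite /Tn; case: insub => [i|] //=; apply: TopZ. Qed.

Lemma TwD w f g : Tw w (f + g) = Tw w f + Tw w g.
Proof. by elim: w => //= k w ->; rewrite TnD. Qed.

Lemma TwZ w c f : Tw w (c *: f) = c *: Tw w f.
Proof. by elim: w => //= k w ->; rewrite TnZ. Qed.

Lemma Tw_sum w (I : Type) (r : seq I) (Q : pred I) (F : I -> P) :
  Tw w (\sum_(k <- r | Q k) F k) = \sum_(k <- r | Q k) Tw w (F k).
Proof.
apply: (big_morph _ (@TwD w)); rewrite -[X in Tw w X](scale0r (0 : P)) TwZ; exact: scale0r.
Qed.

Lemma msize_Tw w f d : (msize f <= d -> msize (Tw w f) <= d)%N.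
Proof.
move=> hf; elim: w => //= k w IH; rewrite /Tn; case: insub => [i|] //=.
exact: msize_Top.
Qed.

Lemma msize_Tinj i f d : (msize (Top i f) <= d -> msize f <= d)%N.
Proof. by move=> h; rewrite -(@TopK m.+1 i f); apply: msize_Tinv. Qed.

Lemma msize_Tw_inj w f d : (msize (Tw w f) <= d -> msize f <= d)%N.
Proof.
elim: w => //= k w IH; rewrite {1}/Tn; case: insub => [i|] //= h.
by apply: IH; apply: msize_Tinj h.
Qed.

(** This space contains E*_mu and f*_mu for |mu| = d and is stable under the T_i, and its members
    are determined by their top homogeneous parts. *)
Definition Van d p : Prop :=
  (msize p <= d.+1)%N /\ forall nu, (mdeg nu < d)%N -> p.@[spec nu] = 0.

Lemma Van_Top i d p : Van d p -> Van d (Top i p).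
Proof.
move=> [sp zp]; split=> [|nu dn]; first exact: msize_Top.
have [e|ne] := eqVneq (nu (adjL i)) (nu (adjR i)); first by rewrite Top_spec_eq // zp // mulr0.
by rewrite (Top_spec p ne) zp // zp ?mdeg_swp // !mulr0 addr0.
Qed.

Lemma VanD d p p' : Van d p -> Van d p' -> Van d (p + p').
Proof.
move=> [sp zp] [sp' zp']; split=> [|nu dn]; first exact: msizeD_leq.
by rewrite mevalD zp // zp' // addr0.
Qed.

Lemma VanZ d c p : Van d p -> Van d (c *: p).
Proof.
move=> [sp zp]; split=> [|nu dn]; first exact: msizeZ_leq.
by rewrite mevalZ zp // mulr0.
Qed.

Lemma VanB d p p' : Van d p -> Van d p' -> Van d (p - p').
Proof. by move=> h h'; apply: VanD => //; rewrite -scaleN1r; apply: VanZ. Qed.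

Lemma Van0 d : Van d (0 : P).
Proof. by split=> [|nu _]; rewrite ?msize0 ?meval0. Qed.

Lemma Van_sum d (I : Type) (r : seq I) (Q : pred I) (F : I -> P) :
  (forall k, Q k -> Van d (F k)) -> Van d (\sum_(k <- r | Q k) F k).
Proof. by move=> h; apply: (big_ind (Van d)) => //; [exact: Van0 | exact: VanD]. Qed.

Lemma Van_Tw w d p : Van d p -> Van d (Tw w p).
Proof.
move=> h; elim: w => //= k w IH; rewrite /Tn; case: insub => [i|] //=.
exact: Van_Top.
Qed.

Lemma Van_isP mu p : isP mu p -> Van (mdeg mu) p.
Proof.
move=> [sp _ zp]; split=> // nu dn; apply: zp; first exact: ltnW.
by apply: contraTneq dn => ->; rewrite ltnn.
Qed.

(** A degree below d together with zeros at all spectral vectors of degree below d leaves only 0, by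
    [vanish_eq0]. *)
Lemma Van_eq0 d p : Van d p -> (msize p <= d)%N -> p = 0.
Proof.
case: d => [|d] [sp zp] sd; first by apply/eqP; rewrite -msize_poly_eq0 -leqn0.
exact: vanish_eq0 sd _.
Qed.

Lemma Van_eq d p p' : Van d p -> Van d p' -> (msize (p - p') <= d)%N -> p = p'.
Proof. by move=> h h' s; apply/eqP; rewrite -subr_eq0; apply/eqP/(Van_eq0 _ s)/VanB. Qed.

Definition sn (k : nat) f : P := oapp (fun i : 'I_m => spoly i f) f (insub k).
Definition sw w f : P := foldr sn f w.

Lemma snE i f : sn i f = spoly i f.
Proof. by rewrite /sn valK. Qed.

(** The difference is (1 - t) x_(i+1) (f - s_i f)/(x_i - x_(i+1)), which gives the witness. *)
Lemma Top_mod i f :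
  exists h, Top i f - tpar *: spoly i f = 'X_(adjR i) * h.
Proof.
have [e he] := @dvd_sub_spoly m.+1 i f; exists ((1 - tpar) *: e).
apply: (mulfI (subX_neq0 (@adj_neq m.+1 i))).
move: (@TopP m.+1 i f) he; rewrite -!mul_mpolyC rmorphB rmorph1 /=.
move: 'X_(adjL i) 'X_(adjR i) (Top i f) (spoly i f) (tpar%:MP) => x y a b t e1 e2.
rewrite mulrBr e1.
transitivity (y * ((1 - t) * (f - b))); first by ring.
by rewrite -e2; ring.
Qed.

Lemma rev_iotaS l : rev (iota 0 l.+1) = l :: rev (iota 0 l).
Proof. by rewrite -(addn1 l) iotaD rev_cat. Qed.

(** In the induction step s_l turns an error divisible by x_l into one divisible by x_(l+1), and
    [Top_mod] adds another error divisible by x_(l+1). *)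
Lemma Tw_mod l f : (l <= m)%N -> exists h,
  Tw (rev (iota 0 l)) f - tpar ^+ l *: sw (rev (iota 0 l)) f = 'X_(inord l) * h.
Proof.
elim: l => [|l IH] lm; first by exists 0; rewrite mulr0 expr0 scale1r subrr.
have [h e] := IH (ltnW lm).
rewrite rev_iotaS /=.
pose i : 'I_m := Ordinal lm.
have -> k : Tn l k = Top i k by rewrite -TnE.
have -> k : sn l k = spoly i k by rewrite -snE.
have eL : inord l = adjL i :> 'I_m.+1 by apply: val_inj; rewrite /= inordK // ltnW.
have eR : inord l.+1 = adjR i :> 'I_m.+1 by apply: val_inj; rewrite /= inordK.
rewrite -/(Tw _ f) -/(sw _ f) in e *.
move: (Tw _ f) (sw _ f) e => g k e.
have [h' e'] := Top_mod i g; exists (h' + tpar *: spoly i h).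
have := congr1 (spoly i) e; rewrite eL eR spolyM spolyX sadjL spolyB spolyZ exprS -scalerA.
move: e' => /esym e' /esym e2; rewrite mulrDr -scalerAr.
move: e' e2; move: (Top i g) (spoly i g) (_ *: spoly i k) (spoly i h) 'X_(adjR i).
move=> a b c d x -> ->.
by rewrite scalerBr addrA subrK.
Qed.

Lemma sn_X l k : (l < m)%N -> (k <= m)%N ->
  sn l 'X_(inord k) = 'X_(inord (if k == l then l.+1 else if k == l.+1 then l else k)) :> P.
Proof.
move=> lm km; rewrite (snE (Ordinal lm)) spolyX; congr ('X_ _).
apply: val_inj; rewrite /sadj.
have eL : inord l = adjL (Ordinal lm) :> 'I_m.+1 by apply: val_inj; rewrite /= inordK // ltnW.
have eR : inord l.+1 = adjR (Ordinal lm) :> 'I_m.+1 by apply: val_inj; rewrite /= inordK.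
have [->|kl] := eqVneq k l; first by rewrite eL eR tpermL.
have [->|kl'] := eqVneq k l.+1; first by rewrite eL eR tpermR.
by rewrite tpermD // -?eL -?eR -val_eqE /= !inordK // 1?eq_sym // ltnW.
Qed.

Lemma sw_X l (k : nat) : (l <= m)%N -> (k <= m)%N ->
  sw (rev (iota 0 l)) 'X_(inord k) =
    'X_(inord (if k == 0%N then l else if (k <= l)%N then k.-1 else k)) :> P.
Proof.
move=> + km; elim: l => [|l IH] lm; first by rewrite leqn0; case: eqP => // ->.
rewrite rev_iotaS /= -/(sw _ _) IH ?(ltnW lm) // sn_X //; last by case: ifP => _; [|case: ifP => _]; lia.
set a := (if k == 0%N then _ else _); set b := (if k == 0%N then _ else _).
suff -> : (if a == l then l.+1 else if a == l.+1 then l else a) = b by [].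
rewrite /a /b; case: (posnP k) => [_|k0]; first by rewrite eqxx.
case: (leqP k l) => h.
  have -> : (k.-1 == l) = false by lia.
  have -> : (k.-1 == l.+1) = false by lia.
  by rewrite (leqW h).
rewrite (gtn_eqF h); case: (k =P l.+1) => [->|kl]; rewrite ?leqnn //.
by case: leqP => //; lia.
Qed.

(** The cyclic shift of the variables undoes that of [Omega]: the composite fixes every x_j with j >
    0 and sends x_0 to x_0 / q. *)
Lemma Omega_sw_mod f : exists h, Omega (sw (rev (iota 0 m)) f) - f = 'X_ord0 * h.
Proof.
have swM w g1 g2 : sw w (g1 * g2) = sw w g1 * sw w g2.
  elim: w => //= k w ->; rewrite /sn; case: insub => [i|] //=; exact: spolyM.
have swD w g1 g2 : sw w (g1 + g2) = sw w g1 + sw w g2.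
  elim: w => //= k w ->; rewrite /sn; case: insub => [i|] //=; exact: spolyD.
have swZ w c g : sw w (c *: g) = c *: sw w g.
  elim: w => //= k w ->; rewrite /sn; case: insub => [i|] //=; exact: spolyZ.
have sw1 w : sw w 1 = 1.
  elim: w => //= k w ->; rewrite /sn; case: insub => [i|] //=; exact: spoly1.
elim/mpoly_alg_ind: f => [|j|f g [h1 e1] [h2 e2]|f g [h1 e1] [h2 e2]|c f [h e]].
- by exists 0; rewrite mulr0 sw1 Omega1 subrr.
- rewrite -(inord_val j) sw_X ?leq_ord // OmegaX.
  have eX k : (k <= m)%N -> (inord k == ord_max :> 'I_m.+1) = (k == m).
    by move=> km; rewrite -val_eqE /= inordK.
  case: posnP => [->|j0].
    rewrite eX // eqxx; exists (qpar^-1%:MP - 1).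
    have -> : ordS (inord m) = ord0 :> 'I_m.+1.
      by apply: val_inj; rewrite ordS_val eX // eqxx.
    have -> : inord 0 = ord0 :> 'I_m.+1 by apply: val_inj; rewrite /= inordK.
    by rewrite -mul_mpolyC; move: 'X_ord0 (_%:MP) => x c; ring.
  have jm := leq_ord j; have jm' : (j.-1 < m)%N by lia.
  rewrite eX ?(ltnW jm') // (ltn_eqF jm') scale1r.
  have -> : ordS (inord j.-1) = inord j :> 'I_m.+1.
    apply: val_inj; rewrite ordS_val eX ?(ltnW jm') // (ltn_eqF jm') /= !inordK ?prednK // ltnW //.
  by exists 0; rewrite subrr mulr0.
- rewrite swM OmegaM; move: e1 e2; move: (Omega (sw _ f)) (Omega (sw _ g)) => a b e1 e2.
  exists (h1 * b + f * h2).
  transitivity ((a - f) * b + f * (b - g)); first by ring.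
  by rewrite e1 e2; ring.
- exists (h1 + h2); rewrite swD OmegaD mulrDr.
  move: e1 e2; move: (Omega (sw _ f)) (Omega (sw _ g)) => a b <- <-.
  by rewrite opprD addrACA.
- by exists (c *: h); rewrite swZ OmegaZ -scalerAr -e scalerBr.
Qed.

(* hi k f = T_(m-1) .. T_k f and lo k f = T_0 .. T_(k-1) f. *)
Definition hi k f : P := Tw (rev (iota k (m - k))) f.
Definition lo k f : P := Tw (iota 0 k) f.

Lemma hi_S k f : (k < m)%N -> hi k f = hi k.+1 (Tn k f).
Proof.
move=> km; rewrite /hi; have -> : (m - k = (m - k.+1).+1)%N by lia.
by rewrite /= rev_cons Tw_rcons.
Qed.

Lemma lo_S k f : lo k.+1 f = lo k (Tn k f).
Proof. by rewrite /lo -(addn1 k) iotaD cats1 Tw_rcons. Qed.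

(* At x_0 = 0 each T_i acts as t s_i, the two variable shifts cancel, and the constant
   -t^(-m) of the first factor turns t^m f into -f. *)
Lemma Xi_dvd f : exists g, 'X_ord0 * g = f + linf m * Omega (hi 0 f).
Proof.
have [h1] := @Tw_mod m f (leqnn m); have [h2] := Omega_sw_mod f.
rewrite /hi subn0; move: (Tw _ f) (sw _ f) => a b e2 e1.
have := congr1 (@Omega m) e1; rewrite OmegaB OmegaZ OmegaM OmegaX -val_eqE /= inordK // eqxx.
have -> : ordS (inord m) = ord0 :> 'I_m.+1.
  by apply: val_inj; rewrite ordS_val -val_eqE /= inordK // eqxx.
have t1 : (tpar ^- m)%:MP * (tpar ^+ m)%:MP = 1 :> P.
  by rewrite -mpolyCM mulVf ?expf_neq0 ?tpar_neq0 // mpolyC1.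
move=> {}e1; exists (Omega a - (tpar ^- m)%:MP * (qpar^-1%:MP * Omega h1 + (tpar ^+ m)%:MP * h2)).
move: e1 e2 t1; rewrite /linf -!mul_mpolyC.
move: (Omega a) (Omega b) (Omega h1) 'X_ord0 (qpar^-1%:MP) ((tpar ^- m)%:MP) ((tpar ^+ m)%:MP).
move=> A B H x c s r e1 e2 e3.
transitivity (x * A - s * (c * x * H) - s * r * (x * h2)); first by ring.
by rewrite -e1 -e2 mulrBr mulrA e3; ring.
Qed.

End KnopOperator.

(** Both sides equal (1 - t)/(x - y). The numerators are the coefficients of p in t T_i^-1 p and in
    T_i p, so this matches the two eigenvalues in [Knop_eigen]. *)
Lemma value_solve2 (F : fieldType) (t x y a : F) : x != 0 -> y != 0 -> x - y != 0 ->
  a = ((1 - t) * y) / (x - y) -> (a + 1 - t) / x = a / y.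
Proof. by move=> x0 y0 xy ->; field; rewrite x0 y0 xy. Qed.

Lemma Knop_step_eq (F : fieldType) (V : lmodType F) (t s s' : F) (H L : V) :
  t != 0 -> t^-1 * s = s' * t ->
  H - s' *: (t *: L) = t^-1 *: (t *: H - s *: L).
Proof.
by move=> t0 e; rewrite scalerBr !scalerA mulVf // scale1r e.
Qed.

Lemma Knop_scalar_eq (F : fieldType) (t x u : F) : t != 0 ->
  t^-1 * (u^-1 / x) = (t * u)^-1 / (t * x) * t.
Proof.
move=> t0; rewrite !invfM; move: (u^-1) (x^-1) => v y; field.
by rewrite t0.
Qed.

Lemma Knop_scalar_neq (F : fieldType) (t x y u c al : F) : c / x = al / y ->
  t^-1 * c * (u^-1 / x) = (t * u)^-1 / y * al.
Proof.
move=> e; transitivity (t^-1 * u^-1 * (c / x)); first by ring.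
by rewrite e invfM; ring.
Qed.

Lemma Knop_scalar_neq' (F : fieldType) (t y u : F) : t^-1 * (u^-1 / y) = (t * u)^-1 / y.
Proof. by rewrite invfM mulrA. Qed.

Lemma Knop_step_neq (F : fieldType) (V : lmodType F) (t c b s s1 s' al : F) (G G' L L' : V) :
  t^-1 * c * s = s' * al -> t^-1 * s1 = s' ->
  t^-1 *: (c *: G + b *: G') - s' *: (al *: L + b *: L') =
  (t^-1 * c) *: (G - s *: L) + (t^-1 * b) *: (G' - s1 *: L').
Proof.
move=> e1 e2; rewrite !scalerDr !scalerN !scalerA e1 -e2 opprD addrACA.
by rewrite [t^-1 * b * s1]mulrAC.
Qed.

(** * Eigenvector equations for the interpolation polynomials *)

Section Eigen.
Variable m : nat.
Local Notation P := {mpoly Kqt[m.+1]}.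
Local Notation Top := (@Top m.+1).
Local Notation adjL := (@adjL m.+1).
Local Notation adjR := (@adjR m.+1).
Local Notation swp := (@swp m.+1).
Local Notation linf := (linf m).
Implicit Types (mu nu u : 'X_{1..m.+1}) (i j : 'I_m) (f g p : P) (w : seq nat).

Lemma hiD k f g : hi k (f + g) = hi k f + hi k g. Proof. exact: TwD. Qed.
Lemma hiZ k c f : hi k (c *: f) = c *: hi k f. Proof. exact: TwZ. Qed.
Lemma loD k f g : lo k (f + g) = lo k f + lo k g. Proof. exact: TwD. Qed.
Lemma loZ k c f : lo k (c *: f) = c *: lo k f. Proof. exact: TwZ. Qed.

Lemma msize_X0 : msize ('X_ord0 : P) = 2.
Proof. by rewrite msizeX mdeg1. Qed.

(** The quotient g of [Xi_dvd] has degree at most |mu|. At every spectral vector in that range the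
    term with [linf] vanishes, either through [linf] or through [hi 0 p] at a vector of smaller
    degree; so g has the values of p divided by the first coordinate, and only the value at mu is
    nonzero. *)
Lemma Xi_eigen mu p : isP mu p ->
  linf * Omega (hi 0 p) = ((spec mu ord0)^-1 *: 'X_ord0 - 1) * p.
Proof.
move=> hp; have [sp vp zp] := hp.
have [g eg] := Xi_dvd p.
have sg : (msize g <= (mdeg mu).+1)%N.
  apply: (@msize_cancel m.+1 'X_ord0); first by rewrite msize_X0.
  rewrite eg; apply: msizeD_leq; first exact: leqW.
  by apply: (@msizeM_leq _ _ _ 1); rewrite ?msize_linf // msize_Omega // msize_Tw.
have vg nu : (mdeg nu <= mdeg mu)%N -> spec nu ord0 * g.@[spec nu] = p.@[spec nu].
  move=> d; have := congr1 (meval (spec nu)) eg.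
  rewrite mevalM mevalXU mevalD mevalM meval_linf => ->.
  have [e|n0] := eqVneq (nu ord0) 0%N; first by rewrite spec0_eq // subrr mul0r addr0.
  have [nu' e] := up_surj n0.
  have [_ h] := Van_Tw (rev (iota 0 (m - 0))) (Van_isP hp).
  have z : (Omega (hi 0 p)).@[spec nu] = 0.
    by rewrite e meval_Omega_up h // -(mdeg_up nu') -e.
  by rewrite z mulr0 addr0.
have g1 : g = (spec mu ord0)^-1 *: p.
  apply/eqP; rewrite -subr_eq0; apply/eqP; apply: (@vanish_eq0 _ (mdeg mu)).
    by apply: msizeB_leq => //; apply: msizeZ_leq.
  move=> nu d; rewrite mevalB mevalZ -vg //.
  have [->|ne] := eqVneq nu mu; first by rewrite mulKf ?spec_neq0 // subrr.
  have := vg nu d; rewrite zp // => h.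
  by rewrite h mulr0 subr0; apply: (@mulfI Kqt _ (spec_neq0 nu ord0)); rewrite h mulr0.
have e2 : 'X_ord0 * g = ((spec mu ord0)^-1 *: 'X_ord0) * p by rewrite g1 -scalerAr -scalerAl.
move: eg; rewrite e2; move: (Omega _) (_ *: 'X_ord0) linf => H x y.
by rewrite mulrBl mul1r => ->; rewrite addrAC subrr add0r.
Qed.

(** Here the factor on the right of [Xi_eigen] is t^m (x_0 - t^-m), which cancels against [linf], so
    the equation is exact and not only modulo lower degree. *)
Lemma spec0_shift mu p : mu ord0 = 0%N -> isP mu p -> Omega (hi 0 p) = tpar ^+ m *: p.
Proof.
move=> mu0 /Xi_eigen; rewrite spec0_eq // invrK => e.
have l0 : linf != 0.
  apply/eqP => /(congr1 (fun f : P => f@_U_(ord0)%MM)).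
  rewrite /linf mcoeffB mcoeffX eqxx mcoeffC mnm1_eq0 mulr0 subr0 mcoeff0 => /eqP.
  by rewrite oner_eq0.
have E : tpar ^+ m *: linf = tpar ^+ m *: 'X_ord0 - 1.
  rewrite scalerBr -[X in _ - X = _]mul_mpolyC -mpolyCM mulfV ?expf_neq0 ?tpar_neq0 //.
have E2 : (tpar ^+ m *: 'X_ord0 - 1) * p = linf * (tpar ^+ m *: p).
  by rewrite -E -scalerAl -scalerAr.
exact: (mulfI l0 (etrans e E2)).
Qed.

(** By [Xi_eigen], x_0 times the difference is t^-m [Omega (hi 0 p)] - p, of degree at most |mu|;
    dividing by x_0 lowers the degree. *)
Lemma Omega_hi0_mod mu p : isP mu p ->
  (msize (Omega (hi 0 p) - (spec mu ord0)^-1 *: p) <= mdeg mu)%N.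
Proof.
move=> hp; have := Xi_eigen hp; have [sp _ _] := hp.
have sH : (msize (Omega (hi 0 p)) <= (mdeg mu).+1)%N by rewrite msize_Omega // msize_Tw.
move: (Omega _) sH => H sH e.
apply: (@msize_cancel m.+1 'X_ord0); first by rewrite msize_X0.
have -> : 'X_ord0 * (H - (spec mu ord0)^-1 *: p) = (tpar ^- m) *: H - p.
  move: e; rewrite /linf -!mul_mpolyC; move: 'X_ord0 (_%:MP) (_%:MP) => x s c e.
  transitivity ((x - c) * H + c * H - s * x * p); first by ring.
  by rewrite e; ring.
by apply: msizeB_leq => //; apply: msizeZ_leq.
Qed.

(** If nu has distinct parts in the two columns, neither nu nor s_i nu is mu, so p and T_i p both
    vanish there; at equal parts T_i multiplies the value by t. *)
Lemma Top_isP_eq mu p i : isP mu p -> mu (adjL i) = mu (adjR i) -> Top i p = tpar *: p.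
Proof.
move=> [sp vp zp] e; apply/eqP; rewrite -subr_eq0; apply/eqP.
apply: (@vanish_eq0 _ (mdeg mu)).
  by apply: msizeB_leq; [apply: msize_Top | apply: msizeZ_leq].
move=> nu d; rewrite mevalB mevalZ.
have [e'|ne] := eqVneq (nu (adjL i)) (nu (adjR i)); first by rewrite Top_spec_eq // subrr.
rewrite (Top_spec p ne) (zp nu) // ?zp ?mdeg_swp ?mulr0 ?addr0 ?subr0 //.
  by apply: contraNneq ne => e1; rewrite -(@swpL m.+1 i) -(@swpR m.+1 i) e1 e.
by apply: contraNneq ne => ->; rewrite e.
Qed.

Lemma Top_isP_span mu p p' i : mu (adjL i) != mu (adjR i) -> isP mu p -> isP (swp i mu) p' ->
  let x := spec mu (adjL i) in let y := spec mu (adjR i) in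
  exists b, Top i p = ((1 - tpar) * y / (x - y)) *: p + b *: p'.
Proof.
move=> ne [sp vp zp] [sp' vp' zp'] x y.
set al := (_ / _).
have sne : swp i mu != mu by apply: contraNneq ne => e; rewrite -(@swpL m.+1 i) e.
rewrite mdeg_swp in sp' zp'.
have z1 : p.@[spec (swp i mu)] = 0 by apply: zp => //; rewrite mdeg_swp.
have z2 : p'.@[spec mu] = 0 by apply: zp' => //; rewrite eq_sym.
pose b := (Top i p).@[spec (swp i mu)] / p'.@[spec (swp i mu)].
exists b; apply/eqP; rewrite -subr_eq0; apply/eqP.
apply: (@vanish_eq0 _ (mdeg mu)).
  apply: msizeB_leq; first exact: msize_Top.
  by apply: msizeD_leq; apply: msizeZ_leq.
move=> nu d; have E v : (Top i p - (al *: p + b *: p')).@[v] =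
    (Top i p).@[v] - (al * p.@[v] + b * p'.@[v]).
  by rewrite mevalB mevalD !mevalZ.
rewrite E.
have [->|n1] := eqVneq nu mu.
  by rewrite (Top_spec p ne) z1 z2 !mulr0 !addr0 subrr.
have [->|n2] := eqVneq nu (swp i mu).
  by rewrite z1 mulr0 add0r divfK // subrr.
rewrite (zp nu) // (zp' nu) // !mulr0 addr0 subr0.
have [e'|ne'] := eqVneq (nu (adjL i)) (nu (adjR i)); first by rewrite Top_spec_eq // zp // mulr0.
rewrite (Top_spec p ne') (zp nu) // zp ?mdeg_swp ?mulr0 ?addr0 //.
by apply: contraNneq n2 => <-; rewrite swpK.
Qed.

(** The eigenvector equation of the Cherednik operator [lo]^-1 [Omega] [hi], written without
    inverses. Passing from k to k + 1 moves T_k from [hi] to [lo]; for unequal parts this also needs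
    the equation for s_k mu at k, whose eigenvalue involves coordinate k + 1 of mu. *)
Lemma Knop_eigen mu p k : (k <= m)%N -> isP mu p ->
  (msize (Omega (hi k p) - (tpar ^- k / spec mu (inord k)) *: lo k p) <= mdeg mu)%N.
Proof.
elim: k mu p => [|k IH] mu p km hp.
  have -> : inord 0 = ord0 :> 'I_m.+1 by apply: val_inj; rewrite /= inordK.
  by rewrite expr0 invr1 mul1r; apply: Omega_hi0_mod.
pose i : 'I_m := Ordinal km.
have eL : inord k = adjL i :> 'I_m.+1 by apply: val_inj; rewrite /= inordK // ltnW.
have eR : inord k.+1 = adjR i :> 'I_m.+1 by apply: val_inj; rewrite /= inordK.
have Ti f : Tn k f = Top i f by rewrite -TnE.
have hiT f : hi k f = hi k.+1 (Top i f) by rewrite hi_S // Ti.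
have t0 := tpar_neq0; have s0 := spec_neq0 mu (adjL i); have s1 := spec_neq0 mu (adjR i).
have := IH mu p (ltnW km) hp; rewrite lo_S Ti eL eR exprS.
have [e|ne] := eqVneq (mu (adjL i)) (mu (adjR i)).
  have -> : lo k (Top i p) = tpar *: lo k p by rewrite (Top_isP_eq hp e) loZ.
  have -> : Omega (hi k p) = tpar *: Omega (hi k.+1 p).
    by rewrite hiT (Top_isP_eq hp e) hiZ OmegaZ.
  rewrite (spec_adj_eq e); move: (Omega _) (lo _ _) => H L h.
  rewrite (@Knop_step_eq Kqt _ tpar (tpar ^- k / spec mu (adjL i)) _ H L t0); first exact: msizeZ_leq.
  exact: Knop_scalar_eq.
have [p' hp'] := isP_exists (swp i mu).
have [b eb] := Top_isP_span ne hp hp'.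
have := IH _ _ (ltnW km) hp'; rewrite eL mdeg_swp (@spec_swp m.+1 i mu _ ne) sadjL.
set x := spec mu (adjL i) in eb s0 *; set y := spec mu (adjR i) in eb s1 *.
set al := (_ / _) in eb.
have ev : (al + 1 - tpar) / x = al / y.
  by apply: (value_solve2 s0 s1 _ (erefl al)); rewrite subr_eq0; exact: spec_neq.
(* Writing p = T_k (T_k^-1 p) turns [hi k.+1 p] into [hi k (T_k^-1 p)], and t T_k^-1 = T_k + 1 - t
   is expanded in p and p'. *)
have E : Omega (hi k.+1 p) =
    tpar^-1 *: ((al + 1 - tpar) *: Omega (hi k p) + b *: Omega (hi k p')).
  rewrite -{1}(@TinvK m.+1 i p) -hiT /Tinv eb addrAC -scalerDl addrA.
  by rewrite hiZ hiD !hiZ OmegaZ OmegaD !OmegaZ.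
rewrite {}E.
have -> : lo k (Top i p) = al *: lo k p + b *: lo k p' by rewrite eb loD !loZ.
move: (Omega _) (Omega _) (lo _ _) (lo _ _) => G G' L L' h h'.
rewrite (@Knop_step_neq Kqt _ tpar (al + 1 - tpar) b (tpar ^- k / x) (tpar ^- k / y)).
- by apply: msizeD_leq; apply: msizeZ_leq.
- exact: Knop_scalar_neq.
- exact: Knop_scalar_neq'.
Qed.

End Eigen.

(** * Two-line queue weights *)

Section OneLabel.
Variables (n : nat) (K : fieldType) (t u : K).
Implicit Types (F S : {set 'I_n}) (j b c x y : 'I_n) (L : seq 'I_n).

Definition skip F j b : nat :=
  #|[set c in F | (0 < cdist j c)%N && (cdist j c < cdist j b)%N]|.

Definition wgt F j b : K :=
  (1 - t) * t ^+ skip F j b / (1 - u * t ^+ #|F|) * (if (b < j)%N then u else 1).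

(* Total weight of the ways to match the top balls of one label in the columns L, in this order,
   when F holds the free bottom balls and S those of the same label; u is q^(a-1). *)
Fixpoint wlist L F S : K :=
  if L is j :: L' then \sum_(b in S) wgt F j b * wlist L' (F :\ b) (S :\ b)
  else (S == set0)%:R.

Lemma cdistE j c : cdist j c = (if (j <= c)%N then c - j else c + n - j)%N.
Proof.
have jn := ltn_ord j; have cn := ltn_ord c; rewrite /cdist.
case: leqP => h; last by rewrite modn_small; lia.
by rewrite addnC -addnBA // modnDl modn_small //; lia.
Qed.

Lemma ord_neqE x y : x <> y -> nat_of_ord x <> nat_of_ord y.
Proof. by move=> h /val_inj. Qed.

Lemma cdistP j c :
  ((cdist j c + j = c /\ j <= c) \/ (cdist j c + j = c + n /\ c < j))%N.
Proof.
have jn := ltn_ord j; have cn := ltn_ord c; rewrite cdistE.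
by case: leqP => h; lia.
Qed.

(** On the way from p to y lie the balls before x, then x itself, then those between x and y;
    wrap-arounds add up in the same way. *)
Lemma skip_chain F p x y : p \notin F -> x \in F -> y \in F ->
  (cdist p x < cdist p y)%N ->
  skip F p y = (skip F p x + (skip F x y).+1)%N /\
  ((y < p) = (x < p) + (y < x) :> nat)%N.
Proof.
move=> pF xF yF d.
have px : p <> x by move=> e; rewrite e xF in pF.
have py : p <> y by move=> e; rewrite e yF in pF.
have py' := ord_neqE py; have px' := ord_neqE px.
have yn := ltn_ord y; have xn := ltn_ord x; have pn := ltn_ord p.
have Dx := cdistP p x; have Dy := cdistP p y; have Dxy := cdistP x y.
split; last by lia.
rewrite /skip (cardsD1 x) !inE xF d andbT.
have -> : (0 < cdist p x)%N by lia.
have -> : [set c in F | (0 < cdist p c)%N && (cdist p c < cdist p y)%N] :\ x =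
   [set c in F | (0 < cdist p c)%N && (cdist p c < cdist p x)%N] :|:
   [set c in F | (0 < cdist x c)%N && (cdist x c < cdist x y)%N].
  apply/setP => c; rewrite !inE; case cF: (c \in F); rewrite ?andbF //=.
  have pc : p <> c by move=> e; rewrite e cF in pF.
  have pc' := ord_neqE pc; have cn := ltn_ord c.
  have Dc := cdistP p c; have Dxc := cdistP x c.
  have [->|/eqP/ord_neqE cx] := eqVneq c x; first by rewrite ltnn andbF /=; have := cdistP x x; lia.
  by lia.
rewrite cardsU [X in (_ - X)%N](_ : _ = 0%N) ?subn0; first by rewrite /= add1n addnS.
apply: eq_card0 => c; rewrite !inE; apply/negP => /andP[/andP[cF h]].
rewrite cF /=.
have pc : p <> c by move=> e; rewrite e cF in pF.
have := ord_neqE pc; have := ltn_ord c; have := cdistP p c; have := cdistP x c; lia.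
Qed.

Lemma skip_rem F j x y : x \in F -> j \notin F ->
  skip F j y = (skip (F :\ x) j y + (cdist j x < cdist j y))%N.
Proof.
move=> xF jF; rewrite /skip (cardsD1 x) addnC !inE xF /=.
have -> : (0 < cdist j x)%N.
  have jx : j <> x by move=> e; rewrite e xF in jF.
  by have := cdistP j x; have := ord_neqE jx; have := ltn_ord j; lia.
congr (_ + _)%N; apply: eq_card => c; rewrite !inE.
by case: (c == x) => //=.
Qed.

(** The denominators depend only on |F|, so only exponents matter. If p and s meet x and y in the
    same cyclic order, exchanging the targets keeps the total exponents by [skip_chain]; otherwise
    the same pairing has the same exponents in both processing orders. *)
Lemma wgt_exchange F p s x y (R : K) : p \notin F -> s \notin F -> x \in F -> y \in F -> x != y ->
  wgt F p x * (wgt (F :\ x) s y * R) + wgt F p y * (wgt (F :\ y) s x * R) =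
  wgt F s x * (wgt (F :\ x) p y * R) + wgt F s y * (wgt (F :\ y) p x * R).
Proof.
move=> pF sF xF yF xy.
have [cx cy] : #|F :\ x| = #|F|.-1 /\ #|F :\ y| = #|F|.-1.
  by move: (cardsD1 x F) (cardsD1 y F); rewrite xF yF !add1n => e1 e2; split; [rewrite e1 | rewrite e2].
have E j b : (if (b < j)%N then u else 1) = u ^+ (b < j)%N by case: ltnP.
rewrite /wgt !E cx cy.
set d1 := _^-1; set d2 := (1 - u * t ^+ #|F|.-1)^-1.
have M (a b c d : nat) : (1 - t) * t ^+ a * d1 * u ^+ b * ((1 - t) * t ^+ c * d2 * u ^+ d * R) =
    (1 - t) ^+ 2 * d1 * d2 * R * t ^+ (a + c) * u ^+ (b + d).
  by rewrite !exprD; ring.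
rewrite !M; clear M.
have px := skip_rem y xF pF; have py := skip_rem x yF pF.
have sx := skip_rem y xF sF; have sy := skip_rem x yF sF.
have nxy : cdist p x <> cdist p y.
  have xy' : nat_of_ord x <> y by move/val_inj => e; rewrite e eqxx in xy.
  have := cdistP p x; have := cdistP p y.
  have := ltn_ord y; have := ltn_ord x; lia.
have nxy' : cdist s x <> cdist s y.
  have xy' : nat_of_ord x <> y by move/val_inj => e; rewrite e eqxx in xy.
  have := cdistP s x; have := cdistP s y.
  have := ltn_ord y; have := ltn_ord x; lia.
have P : ((cdist p x < cdist p y) \/ (cdist p y < cdist p x))%N by lia.
have Q : ((cdist s x < cdist s y) \/ (cdist s y < cdist s x))%N by lia.
case: P => hp; case: Q => hs.
- have [e1 e2] := skip_chain pF xF yF hp; have [e3 e4] := skip_chain sF xF yF hs.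
  congr (_ * t ^+ _ * u ^+ _ + _ * t ^+ _ * u ^+ _); lia.
- rewrite addrC; congr (_ * t ^+ _ * u ^+ _ + _ * t ^+ _ * u ^+ _); lia.
- rewrite addrC; congr (_ * t ^+ _ * u ^+ _ + _ * t ^+ _ * u ^+ _); lia.
- have [e1 e2] := skip_chain pF yF xF hp; have [e3 e4] := skip_chain sF yF xF hs.
  congr (_ * t ^+ _ * u ^+ _ + _ * t ^+ _ * u ^+ _); lia.
Qed.

Lemma sum_pairs (S : {set 'I_n}) (G : 'I_n -> 'I_n -> K) :
  \sum_(x in S) \sum_(y in S :\ x) G x y =
  \sum_(x in S) \sum_(y in S | (x < y)%N) (G x y + G y x).
Proof.
transitivity (\sum_(x in S) (\sum_(y in S | (x < y)%N) G x y + \sum_(y in S | (y < x)%N) G x y)).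
  apply: eq_bigr => x xS; rewrite (bigID (fun y : 'I_n => (x < y)%N)) /=; congr (_ + _);
    apply: eq_bigl => y; rewrite !inE -val_eqE /=; case: (y \in S) => //=;
    by case: ltngtP.
rewrite big_split [RHS](eq_bigr (fun x => \sum_(y in S | (x < y)%N) G x y +
  \sum_(y in S | (x < y)%N) G y x)); last by move=> x _; rewrite big_split.
rewrite [RHS]big_split; congr (_ + _); rewrite /=.
rewrite (exchange_big_dep (fun y : 'I_n => y \in S)) /=; last by move=> x y _ /andP[].
by apply: eq_bigr => x xS; apply: eq_bigl => y; rewrite xS.
Qed.

Lemma wlist_swap p s L F S : p \notin F -> s \notin F -> S \subset F ->
  wlist (p :: s :: L) F S = wlist (s :: p :: L) F S.
Proof.
move=> pF sF SF /=.
(* Ordered pairs of targets are grouped into unordered ones, where the exchange of two balls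
   applies. *)
rewrite !(eq_bigr _ (fun b _ => big_distrr _ _ _)) /= !sum_pairs.
apply: eq_bigr => x xS; apply: eq_bigr => y /andP[yS xy].
have xy' : x != y by rewrite -val_eqE /= neq_ltn xy.
have := wgt_exchange (wlist L (F :\ x :\ y) (S :\ x :\ y)) pF sF (subsetP SF _ xS) (subsetP SF _ yS) xy'.
have -> : F :\ y :\ x = F :\ x :\ y by rewrite !setDDl setUC.
by have -> : S :\ y :\ x = S :\ x :\ y by rewrite !setDDl setUC.
Qed.

Lemma wlist_move p L1 L2 F S : all [predC F] (p :: L1) -> S \subset F ->
  wlist (L1 ++ p :: L2) F S = wlist (p :: L1 ++ L2) F S.
Proof.
elim: L1 F S => // s L1 IH F S /= /and3P[pF sF L1F] SF.
rewrite -[RHS]/(wlist (p :: s :: L1 ++ L2) F S) wlist_swap //.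
apply: eq_bigr => b bS; rewrite IH ?setSD //= !inE negb_and pF orbT /=.
by apply: sub_all L1F => x /=; rewrite !inE negb_and orbC => ->.
Qed.

(** This frees the weight of a label from the right-to-left order, so that column permutations may
    act on the set of its top balls. *)
Lemma wlist_perm L1 L2 F S : perm_eq L1 L2 -> all [predC F] L1 -> S \subset F ->
  wlist L1 F S = wlist L2 F S.
Proof.
elim: L1 L2 F S => [|p L1 IH] L2 F S; first by rewrite perm_sym => /perm_nilP ->.
move=> pe /= /andP[pF L1F] SF.
have pL2 : p \in L2 by rewrite -(perm_mem pe) mem_head.
case/splitPr: pL2 pe => A B; rewrite perm_sym -cat1s perm_catCA /= perm_cons perm_sym => pe.
have AF : all [predC F] (A ++ B) by rewrite -(perm_all _ pe).
rewrite wlist_move //=; last by rewrite pF; move: AF; rewrite all_cat => /andP[].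
apply: eq_bigr => b bS; rewrite (IH (A ++ B)) ?setSD //.
by apply: sub_all L1F => x /=; rewrite !inE negb_and orbC => ->.
Qed.

End OneLabel.

(** * Effect on strands of exchanging two adjacent columns *)

Section AdjacentColumns.
Variables (n : nat) (K : fieldType) (t u : K) (i : 'I_n.-1).
Implicit Types (F S : {set 'I_n}) (j c x y : 'I_n) (L : seq 'I_n).

Local Notation a := (adjL i).
Local Notation b := (adjR i).
Local Notation s := (sadj i).
Local Notation wgt := (wgt t u).
Local Notation wlist := (wlist t u).

Lemma sadjP y : (y = i :> nat /\ s y = i.+1 :> nat)%N \/ (y = i.+1 :> nat /\ s y = i :> nat)%N
  \/ (y <> i :> nat /\ y <> i.+1 :> nat /\ s y = y :> nat)%N.
Proof.
rewrite /sadj; case: tpermP => [->|->|h1 h2] /=; [by left | by right; left | right; right].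
by have := ord_neqE h1; have := ord_neqE h2.
Qed.

Lemma mem_sadj F x : (s x \in s @: F) = (x \in F).
Proof. by rewrite mem_imset //; apply: perm_inj. Qed.

Lemma sadj_imset F : s @: F = [set x | s x \in F].
Proof.
by apply/setP => x; rewrite inE -{1}(sadjK i x) mem_sadj.
Qed.

Lemma sadj_set1D F x : s @: (F :\ x) = (s @: F) :\ s x.
Proof.
by apply/setP => y; rewrite !sadj_imset !inE (canF_eq (sadjK i)).
Qed.

(** If at most one of the two columns is occupied, exchanging them preserves the cyclic order of the
    occupied columns, hence all weights. *)
Definition not_both F := ~~ ((a \in F) && (b \in F)).

Lemma not_both_sub F1 F2 : F1 \subset F2 -> not_both F2 -> not_both F1.
Proof.
move=> /subsetP h; apply: contra => /andP[h1 h2]; by rewrite !h.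
Qed.

Lemma cdist_swap F j x y : not_both F -> j \in F -> x \in F -> y \in F ->
  (cdist (s j) (s x) < cdist (s j) (s y))%N = (cdist j x < cdist j y)%N.
Proof.
move=> nb jF xF yF.
have i1 := adjR_proof i.
have D (k l : 'I_n) := conj (cdistP k l) (conj (ltn_ord k) (ltn_ord l)).
have := D j x; have := D j y; have := D (s j) (s x); have := D (s j) (s y).
move: nb; rewrite /not_both negb_and => /orP[aF|bF].
  have H k : k \in F -> ((k = i.+1 :> nat /\ s k = i :> nat) \/ (k <> i.+1 :> nat /\ s k = k :> nat))%N
      /\ k <> i :> nat.
    move=> kF; have : k <> i :> nat.
      by move=> e; move: aF; rewrite (_ : a = k) ?kF //; apply: val_inj.
    by have := sadjP k; lia.
  by move: (H _ jF) (H _ xF) (H _ yF); lia.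
have H k : k \in F -> ((k = i :> nat /\ s k = i.+1 :> nat) \/ (k <> i :> nat /\ s k = k :> nat))%N
    /\ k <> i.+1 :> nat.
  move=> kF; have : k <> i.+1 :> nat.
    by move=> e; move: bF; rewrite (_ : b = k) ?kF //; apply: val_inj.
  by have := sadjP k; lia.
by move: (H _ jF) (H _ xF) (H _ yF); lia.
Qed.

Lemma wgt_adj F j x : not_both (j |: F) -> j \notin F -> x \in F ->
  wgt (s @: F) (s j) (s x) = wgt F j x.
Proof.
move=> nb jF xF; rewrite /wgt card_imset; last exact: perm_inj.
have -> : skip (s @: F) (s j) (s x) = skip F j x.
  rewrite /skip -[RHS](card_imset _ (@perm_inj _ s)); apply: eq_card => c.
  rewrite -(sadjK i c) mem_sadj !inE mem_sadj; move: (s c) => {}c.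
  case cF: (c \in F) => //=.
  rewrite -(cdist_swap (y := x) nb) ?inE ?eqxx ?cF ?xF ?orbT //; congr (_ && _).
  have d0 (k : 'I_n) : cdist k k = 0%N by have := cdistP k k; have := ltn_ord k; lia.
  by rewrite -{1}(d0 (s j)) -(d0 j) -(cdist_swap (x := j) (y := c) nb) ?inE ?eqxx ?cF ?orbT.
suff -> : (s x < s j)%N = (x < j)%N by [].
have jx : j <> x by move=> e; rewrite e xF in jF.
apply: sadj_lt; apply: contraNN nb => /orP[] /andP[/eqP <- /eqP <-].
  by rewrite !inE eqxx xF orbT.
by rewrite !inE eqxx xF orbT.
Qed.

Lemma wlist_adj L F S : uniq L -> not_both ([set x in L] :|: F) -> all [predC F] L -> S \subset F ->
  wlist (map s L) (s @: F) (s @: S) = wlist L F S.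
Proof.
elim: L F S => [|j L IH] F S /=.
  by move=> _ _ _ _; rewrite imset_eq0.
move=> /andP[jL uL] nb /andP[jF LF] SF.
rewrite big_imset /=; last by move=> x y _ _; apply: perm_inj.
apply: eq_bigr => x xS; rewrite -!sadj_set1D IH ?setSD //.
- congr (_ * _); apply: wgt_adj => //; last exact: (subsetP SF).
  by apply: not_both_sub nb; apply/subsetP => y; rewrite !inE => /orP[->|->] //; rewrite orbT.
- by apply: not_both_sub nb; apply/subsetP => y; rewrite !inE => /orP[->|/andP[_ ->]]; rewrite ?orbT.
- by apply: sub_all LF => y /=; rewrite !inE negb_and orbC => ->.
Qed.

Lemma aNb : a != b. Proof. exact: adj_neq. Qed.

(** A strand from elsewhere reaches column i just before column i + 1, so going one further skips
    exactly the ball in column i. *)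
Lemma wgt_next F j : j != a -> j != b -> a \in F -> wgt F j b = t * wgt F j a.
Proof.
move=> ja jb aF; rewrite /wgt.
have ja' := ord_neqE (elimN eqP ja); have jb' := ord_neqE (elimN eqP jb).
have -> : skip F j b = (skip F j a).+1.
  rewrite /skip (cardsD1 a) !inE aF /= -[RHS]add1n; congr (_ + _)%N.
    by have := cdistP j a; have := cdistP j b; have := ltn_ord j; have := ltn_ord b; rewrite /= in ja' jb' *; lia.
  apply: eq_card => c; rewrite !inE; case: (c \in F) => //=; rewrite ?andbF //.
  have := cdistP j a; have := cdistP j b; have := cdistP j c; have := ltn_ord j; have := ltn_ord b.
  have := ltn_ord c; rewrite -val_eqE /= in ja' jb' *; lia.
have -> : (b < j)%N = (a < j)%N by rewrite /= in ja' jb' *; lia.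
by rewrite exprS !mulrA; congr (_ * _ * _); rewrite [t * _]mulrC.
Qed.

(** Before the exchange the strand passes over the ball in column i + 1; afterwards it starts beyond
    that ball. *)
Lemma wgt_over F x : a \notin F -> b \in F -> x != a -> x != b ->
  wgt F a x = t * wgt (s @: F) b x.
Proof.
move=> aF bF xa xb; rewrite /wgt card_imset; last exact: perm_inj.
have xa' := ord_neqE (elimN eqP xa); have xb' := ord_neqE (elimN eqP xb).
have -> : skip F a x = (skip (s @: F) b x).+1.
  rewrite /skip (cardsD1 b) !inE bF /= -[RHS]add1n; congr (_ + _)%N.
    by have := cdistP a b; have := cdistP a x; have := ltn_ord x; have := ltn_ord b; rewrite /= in xa' xb' *; lia.
  apply: eq_card => c; rewrite !inE sadj_imset inE.
  have [->|cb] := eqVneq c b; first by rewrite sadjR (negbTE aF).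
  have [->|ca] := eqVneq c a; last rewrite /sadj tpermD 1?eq_sym //.
    rewrite (negbTE aF) sadjL bF /=; apply/esym/negbTE/negP.
    have := cdistP b a; have := cdistP b x; have := ltn_ord x; have := ltn_ord b; rewrite /= in xa' xb' *; lia.
  case: (c \in F) => //=.
  have ca' := ord_neqE (elimN eqP ca); have cb' := ord_neqE (elimN eqP cb).
  have := cdistP a c; have := cdistP a x; have := cdistP b c; have := cdistP b x.
  have := ltn_ord x; have := ltn_ord b; have := ltn_ord c.
  rewrite /= in ca' cb' xa' xb' *; lia.
have -> : (x < a)%N = (x < b)%N by rewrite /= in xa' xb' *; lia.
by rewrite exprS !mulrA; congr (_ * _ * _); rewrite [t * _]mulrC.
Qed.

Lemma wgt_near F : wgt F a b = (1 - t) / (1 - u * t ^+ #|F|).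
Proof.
rewrite /wgt; have -> : skip F a b = 0%N.
  apply: eq_card0 => c; rewrite !inE; apply/negP => /and3P[_].
  have := cdistP a b; have := cdistP a c; have := ltn_ord c; have := ltn_ord b; rewrite /=; lia.
by rewrite expr0 mulr1 /= ltnNge leqnSn mulr1.
Qed.

(** The strand goes around the whole circle, so it wraps and skips all the other free balls.
    Subtracting this from [wgt_near] leaves exactly 1 - t. *)
Lemma wgt_far F : b \notin F -> a \in F ->
  t * wgt F b a = (1 - t) * (u * t ^+ #|F|) / (1 - u * t ^+ #|F|).
Proof.
move=> bF aF; rewrite /wgt; have -> : #|F| = (skip F b a).+1.
  rewrite (cardsD1 a) aF add1n; congr _.+1; apply: eq_card => c; rewrite !inE.
  have [->|ca] := eqVneq c a; first by rewrite ltnn !andbF.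
  case cF: (c \in F) => //=; have cb : c <> b by move=> e; rewrite -e cF in bF.
  have ca' := ord_neqE (elimN eqP ca); have cb' := ord_neqE cb.
  have := cdistP b a; have := cdistP b c; have := ltn_ord c; have := ltn_ord b; rewrite /= in ca' cb' *; lia.
rewrite /= ltnS leqnn exprS; by set v := (_)^-1; ring.
Qed.

End AdjacentColumns.

Section LabelWeights.
Variables (n : nat) (K : fieldType) (t u : K).
Implicit Types (F S J X Y : {set 'I_n}) (j c x y : 'I_n) (L : seq 'I_n).
Local Notation wgt := (wgt t u).
Local Notation wlist := (wlist t u).

(* J and S are the columns of the label in the top and bottom row, F the bottom balls of at most
   that label.  The balls in J :&: F lie above a ball of their own label, are paired trivially
   and leave the game. *)
Definition Wset J F S : K :=
  if J :&: F \subset S then wlist (enum (J :\: F)) (F :\: J) (S :\: J) else 0.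

Lemma wlist_enum L X F S : perm_eq L (enum X) -> [disjoint X & F] -> S \subset F ->
  wlist (enum X) F S = wlist L F S.
Proof.
move=> pe dXF SF; apply: wlist_perm => //; first by rewrite perm_sym.
by apply/allP => x; rewrite mem_enum => xX /=; rewrite (disjointFr dXF xX).
Qed.

Lemma enum_cons x X : x \in X -> perm_eq (x :: enum (X :\ x)) (enum X).
Proof.
move=> xX; apply: uniq_perm; rewrite ?enum_uniq //=.
  by rewrite mem_enum !inE eqxx /= enum_uniq.
by move=> y; rewrite inE !mem_enum !inE; case: eqP => // ->.
Qed.

Section Swap.
Variable i : 'I_n.-1.
Local Notation a := (adjL i).
Local Notation b := (adjR i).
Local Notation s := (sadj i).

Lemma imset_sadj_fix X : (a \in X) = (b \in X) -> s @: X = X.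
Proof.
move=> e; apply/setP => x; rewrite sadj_imset inE /sadj.
by case: tpermP => [->|->|].
Qed.

Lemma all_notin L X F : L =i X -> [disjoint X & F] -> all [predC F] L.
Proof.
by move=> e d; apply/allP => x; rewrite e => xX /=; rewrite (disjointFr d xX).
Qed.

Lemma imset_sadjD X Y : s @: (X :\: Y) = (s @: X) :\: (s @: Y).
Proof. by apply/setP => x; rewrite inE !sadj_imset !inE. Qed.

Lemma imset_sadjI X Y : s @: (X :&: Y) = (s @: X) :&: (s @: Y).
Proof. by apply/setP => x; rewrite inE !sadj_imset !inE. Qed.

Lemma sub_sadj X Y : ((s @: X) \subset (s @: Y)) = (X \subset Y).
Proof.
apply/subsetP/subsetP => h x; first by rewrite -(mem_sadj i X) -(mem_sadj i Y); apply: h.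
by rewrite (sadj_imset i X) (sadj_imset i Y) !inE; apply: h.
Qed.

Lemma disjointDD X Y : [disjoint X :\: Y & Y :\: X].
Proof. by apply/pred0P => x; rewrite !inE; case: (x \in X); case: (x \in Y). Qed.

Lemma enum_sadj X : perm_eq (map s (enum X)) (enum (s @: X)).
Proof.
apply: uniq_perm; rewrite ?enum_uniq ?map_inj_uniq ?enum_uniq //; first exact: perm_inj.
move=> x; rewrite mem_enum; apply/mapP/imsetP => -[y yX ->]; exists y => //.
  by rewrite -mem_enum.
by rewrite mem_enum.
Qed.

Lemma Wset_adj J F S : S \subset F -> not_both i ((J :\: F) :|: (F :\: J)) ->
  Wset (s @: J) (s @: F) (s @: S) = Wset J F S.
Proof.
move=> SF nb; rewrite /Wset -imset_sadjI sub_sadj; case: ifP => // _.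
rewrite -!imset_sadjD (wlist_enum (enum_sadj _)) ?sub_sadj ?setSD //.
  apply: wlist_adj; rewrite ?enum_uniq ?setSD //.
  - by apply: not_both_sub nb; apply/subsetP => x; rewrite !inE mem_enum !inE.
  - by apply: (all_notin _ (disjointDD J F)) => x; rewrite mem_enum.
by rewrite !imset_sadjD disjointDD.
Qed.

Lemma wlist_fix L F S : uniq L -> a \notin L -> b \notin L -> not_both i F ->
  all [predC F] L -> S \subset F -> wlist L (s @: F) (s @: S) = wlist L F S.
Proof.
move=> uL aL bL nb LF SF.
have eL : map s L = L.
  rewrite -[RHS]map_id; apply/eq_in_map => x xL; rewrite /sadj tpermD //.
    by apply: contraNneq aL => ->.
  by apply: contraNneq bL => ->.
rewrite -{1}eL; apply: wlist_adj => //.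
by apply: contra nb => /andP[]; rewrite !inE (negbTE aL) (negbTE bL) /= => -> ->.
Qed.

Lemma all_rem1 L F x : all [predC F] L -> all [predC F :\ x] L.
Proof. by apply: sub_all => y /=; rewrite !inE negb_and orbC => ->. Qed.

(** The label owns exactly one of the balls in columns i and i + 1. The strand that takes it gains a
    factor t when it is in column i + 1; earlier strands see both balls, and later ones see a single
    ball in either column, so their weights agree. *)
Lemma wlist_unpicked L F S : uniq L -> a \notin L -> b \notin L -> a \in F -> b \in F ->
  all [predC F] L -> S \subset F -> a \notin S -> b \notin S ->
  wlist L F (b |: S) = t * wlist L F (a |: S).
Proof.
have ab := aNb i; elim: L F S => [|j L IH] F S /=.
  have e c : (c |: S == set0) = false by apply/negbTE/set0Pn; exists c; rewrite setU11.
  by rewrite !e mulr0.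
move=> /andP[jL uL]; rewrite !inE !negb_or => /andP[aj aL] /andP[bj bL] aF bF /andP[jF LF] SF aS bS.
rewrite !big_setU1 //= mulrDr !setU1K //; congr (_ + _).
  rewrite mulrA -wgt_next 1?eq_sym //; congr (_ * _).
  have eF : F :\ b = s @: (F :\ a).
    by rewrite sadj_set1D sadjL imset_sadj_fix // aF bF.
  have eS : S = s @: S by rewrite imset_sadj_fix // (negbTE aS) (negbTE bS).
  rewrite eF {1}eS wlist_fix ?all_rem1 //.
    by rewrite /not_both !inE eqxx.
  apply/subsetP => x xS; rewrite !inE (subsetP SF) // andbT.
  by apply: contraNneq aS => <-.
rewrite big_distrr; apply: eq_bigr => x xS; rewrite /= mulrCA; congr (_ * _).
have xa : x != a by apply: contraNneq aS => <-.
have xb : x != b by apply: contraNneq bS => <-.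
have e c : c != x -> (c |: S) :\ x = c |: (S :\ x).
  by move=> cx; apply/setP => y; rewrite !inE; case: eqP => // ->; rewrite (eq_sym x) (negbTE cx).
rewrite !e 1?eq_sym // IH ?all_rem1 ?setSD // !inE ?aF ?bF ?(negbTE aS) ?(negbTE bS) ?andbF ?andbT // eq_sym //.
Qed.

Lemma wlist_over L F S : uniq L -> a \notin L -> b \notin L -> a \notin F -> b \in F ->
  all [predC F] L -> S \subset F -> b \notin S ->
  \sum_(x in S) wgt F a x * wlist L (F :\ x) (S :\ x) =
  t * \sum_(x in S) wgt (s @: F) b x * wlist L ((s @: F) :\ x) (S :\ x).
Proof.
move=> uL aL bL aF bF LF SF bS; rewrite big_distrr; apply: eq_bigr => x xS /=.
have aS : a \notin S by apply: contraNN aF => /(subsetP SF).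
have xa : x != a by apply: contraNneq aS => <-.
have xb : x != b by apply: contraNneq bS => <-.
rewrite mulrA -wgt_over //; congr (_ * _).
have sx : s x = x by rewrite /sadj tpermD // eq_sym.
have eF : (s @: F) :\ x = s @: (F :\ x) by rewrite sadj_set1D sx.
have eS : S :\ x = s @: (S :\ x).
  by rewrite imset_sadj_fix // !inE (negbTE aS) (negbTE bS) !andbF.
rewrite eF {2}eS wlist_fix ?all_rem1 ?setSD //.
by rewrite /not_both !inE (negbTE aF) andbF.
Qed.

(** If the strand from column i ends elsewhere, it merely passes the ball in column i + 1 and yields
    a factor t. If it ends in column i + 1, the near strand is t times the far strand plus 1 - t. *)
Lemma wlist_special L F S : (forall k, (0 < k)%N -> 1 - u * t ^+ k != 0) ->
  uniq L -> a \notin L -> b \notin L -> a \notin F -> b \in F ->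
  all [predC F] L -> S \subset F -> b \in S ->
  wlist (a :: L) F S =
  t * wlist (b :: L) (s @: F) (s @: S) + (1 - t) * wlist L (F :\ b) (S :\ b).
Proof.
move=> hu uL aL bL aF bF LF SF bS.
have aS : a \notin S by apply: contraNN aF => /(subsetP SF).
have sb : b \notin s @: F by rewrite sadj_imset inE sadjR.
have sa : a \in s @: F by rewrite sadj_imset inE sadjL.
have sSa : a \in s @: S by rewrite sadj_imset inE sadjL.
rewrite /= (big_setD1 b) //= (big_setD1 a sSa) /= mulrDr mulrA wgt_far // wgt_near.
rewrite card_imset; last exact: perm_inj.
have eF : (s @: F) :\ a = F :\ b.
  rewrite -(sadjR i) -sadj_set1D imset_sadj_fix // !inE eqxx /= (negbTE aF) andbF //.
have eS : (s @: S) :\ a = S :\ b.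
  rewrite -(sadjR i) -sadj_set1D imset_sadj_fix // !inE eqxx /= (negbTE aS) andbF //.
rewrite eF eS.
have -> : \sum_(x in S :\ b) wgt F a x * wlist L (F :\ x) (S :\ x) =
  t * \sum_(x in S :\ b) wgt (s @: F) b x * wlist L ((s @: F) :\ x) ((s @: S) :\ x).
  rewrite big_distrr; apply: eq_bigr => x; rewrite !inE => /andP[xb xS] /=.
  have xa : x != a by apply: contraNneq aS => <-.
  rewrite mulrA -wgt_over //; congr (_ * _).
  have sx : s x = x by rewrite /sadj tpermD // eq_sym.
  have -> : (s @: F) :\ x = s @: (F :\ x) by rewrite sadj_set1D sx.
  have -> : (s @: S) :\ x = s @: (S :\ x) by rewrite sadj_set1D sx.
  rewrite wlist_fix ?all_rem1 ?setSD //.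
  by rewrite /not_both !inE (negbTE aF) andbF.
have : 1 - u * t ^+ #|F| != 0 by apply: hu; rewrite (cardsD1 b) bF.
move: (wlist L _ _) (t ^+ _) (\sum_(x in _) _) => w v z h.
rewrite [RHS]addrAC; congr (_ + _); field; exact: h.
Qed.

Lemma Wset_unpicked J F S : S \subset F -> a \in S -> b \in F -> b \notin S ->
  a \notin J -> b \notin J -> Wset J F (s @: S) = t * Wset J F S.
Proof.
move=> SF aS bF bS aJ bJ; have aF := subsetP SF _ aS; rewrite /Wset.
have -> : (J :&: F \subset s @: S) = (J :&: F \subset S).
  rewrite -(sub_sadj (J :&: F) S) [s @: (_ :&: _)]imset_sadj_fix //.
  by rewrite !inE (negbTE aJ) (negbTE bJ).
case: ifP => _; last by rewrite mulr0.
pose S0 := (S :\: J) :\ a.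
have eS : S :\: J = a |: S0 by rewrite setD1K // inE aS aJ.
have eS' : (s @: S) :\: J = b |: S0.
  apply/setP => x; rewrite !inE sadj_imset inE /sadj.
  case: tpermP => [->|->|/eqP xa /eqP xb].
  - by rewrite (negbTE bS) !eqxx andbF orbF (negbTE (aNb i)).
  - by rewrite aS bJ eqxx.
  - by rewrite (negbTE xb) xa.
rewrite eS eS' wlist_unpicked ?enum_uniq ?mem_enum ?inE ?(negbTE aJ) ?(negbTE bJ) ?aF ?bF ?eqxx ?andbF //=.
- by apply: (all_notin _ (disjointDD J F)) => x; rewrite mem_enum.
- by apply: subset_trans (subD1set _ _) _; apply: setSD.
- by rewrite (negbTE bS) andbF.
Qed.

Lemma imset_sadj_rem X : a \in X -> b \notin X -> (s @: X) :\ b = X :\ a.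
Proof.
move=> aX bX; apply/setP => x; rewrite !inE sadj_imset inE /sadj.
case: tpermP => [->|->|/eqP xa /eqP xb]; rewrite ?eqxx ?(negbTE bX) ?andbF //.
by rewrite xa xb.
Qed.

Lemma Wset_over J F S : S \subset F -> a \in J -> b \notin J -> a \notin F -> b \in F ->
  b \notin S -> Wset J F S = t * Wset (s @: J) (s @: F) S.
Proof.
move=> SF aJ bJ aF bF bS; rewrite /Wset.
have aS : a \notin S by apply: contraNN aF => /(subsetP SF).
have sS : s @: S = S by rewrite imset_sadj_fix // (negbTE aS) (negbTE bS).
rewrite -imset_sadjI -{3}sS sub_sadj; case: ifP => _; last by rewrite mulr0.
have aD : a \in J :\: F by rewrite inE aJ aF.
have bD : b \notin J :\: F by rewrite inE (negbTE bJ) andbF.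
have dJF : [disjoint J :\: F & F :\: J] := disjointDD J F.
rewrite (wlist_enum (enum_cons aD)) ?setSD //.
rewrite -!imset_sadjD -{2}sS -imset_sadjD.
have bD' : b \in s @: (J :\: F) by rewrite sadj_imset inE sadjR.
rewrite (wlist_enum (enum_cons bD')); last 2 first.
- by rewrite !imset_sadjD disjointDD.
- by rewrite sub_sadj setSD.
rewrite imset_sadj_rem //=.
have -> : s @: (S :\: J) = S :\: J.
  by rewrite imset_sadj_fix // !inE (negbTE aS) (negbTE bS) !andbF.
apply: wlist_over; rewrite ?enum_uniq ?mem_enum ?inE ?eqxx ?aJ ?(negbTE aF) ?bF ?(negbTE bJ)
   ?(negbTE bS) ?andbF ?setSD //=.
by apply/allP => x; rewrite mem_enum !inE => /and3P[_ xF xJ]; rewrite negb_and xF orbT.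
Qed.

(** The last term has the top ball moved above the bottom ball of its own label, where the pairing
    is trivial and both leave the game. *)
Lemma Wset_special J F S : (forall k, (0 < k)%N -> 1 - u * t ^+ k != 0) ->
  S \subset F -> a \in J -> b \notin J -> a \notin F -> b \in S ->
  Wset J F S = t * Wset (s @: J) (s @: F) (s @: S) + (1 - t) * Wset (s @: J) F S.
Proof.
move=> hu SF aJ bJ aF bS; have bF := subsetP SF _ bS; rewrite /Wset.
have aS : a \notin S by apply: contraNN aF => /(subsetP SF).
rewrite -imset_sadjI sub_sadj.
have -> : ((s @: J) :&: F \subset S) = (J :&: F \subset S).
  apply/subsetP/subsetP => h x; rewrite !inE ?sadj_imset ?inE => /andP[xJ xF].
    apply: h; rewrite !inE sadj_imset inE xF andbT /sadj.
    case: tpermP => [ex|ex|//]; first by rewrite ex (negbTE aF) in xF.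
    by rewrite ex (negbTE bJ) in xJ.
  move: xJ; rewrite /sadj; case: tpermP => [ex|->|_ _ xJ] //.
    by rewrite ex (negbTE aF) in xF.
  by apply: h; rewrite inE xJ.
case: ifP => _; last by rewrite !mulr0 addr0.
have aD : a \in J :\: F by rewrite inE aJ aF.
have bD : b \notin J :\: F by rewrite inE (negbTE bJ) andbF.
rewrite (wlist_enum (enum_cons aD)) ?setSD ?disjointDD //.
rewrite -!imset_sadjD.
have bD' : b \in s @: (J :\: F) by rewrite sadj_imset inE sadjR.
rewrite (wlist_enum (enum_cons bD')); last 2 first.
- by rewrite !imset_sadjD disjointDD.
- by rewrite sub_sadj setSD.
rewrite imset_sadj_rem //.
have -> : (s @: J) :\: F = (J :\: F) :\ a.
  apply/setP => x; rewrite !inE sadj_imset inE /sadj.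
  case: tpermP => [->|->|/eqP xa _]; rewrite ?eqxx ?(negbTE bJ) ?bF ?andbF //.
  by rewrite xa.
have eX X : a \notin X -> b \in X -> X :\: (s @: J) = (X :\: J) :\ b.
  move=> aX bX; apply/setP => x; rewrite !inE sadj_imset inE /sadj.
  case: tpermP => [->|->|/eqP xa /eqP xb].
  - by rewrite (negbTE aX) !andbF.
  - by rewrite aJ eqxx.
  - by rewrite xb.
rewrite !eX //; apply: wlist_special; rewrite ?enum_uniq ?mem_enum ?inE ?eqxx ?aJ ?(negbTE aF) ?bF ?(negbTE bJ)
   ?bS ?andbF ?setSD //=.
by apply/allP => x; rewrite mem_enum !inE => /and3P[_ xF xJ]; rewrite negb_and xF orbT.
Qed.

End Swap.
End LabelWeights.

(** * Effect on strands of rotating the columns *)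

Section RotateColumns.
Variables (m : nat) (K : fieldType) (t u : K).
Implicit Types (F S J X Y : {set 'I_m.+1}) (j c x y : 'I_m.+1) (L : seq 'I_m.+1).
Local Notation r := (@ordS m.+1).

Lemma mem_ordS X x : (r x \in r @: X) = (x \in X).
Proof. by rewrite mem_imset //; apply: ordS_inj. Qed.

Lemma cdist_ordS j c : cdist (r j) (r c) = cdist j c.
Proof.
have Sv (x : 'I_m.+1) : (x = m :> nat /\ r x = 0%N :> nat) \/ (x <> m :> nat /\ r x = x.+1 :> nat).
  rewrite /=; have xm := ltn_ord x; case: (nat_of_ord x =P m) => h; [left|right]; split => //.
    by rewrite h modnn.
  by rewrite modn_small //; lia.
have := cdistP j c; have := cdistP (r j) (r c); have := Sv j; have := Sv c.
have := ltn_ord j; have := ltn_ord c; lia.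
Qed.

Lemma imset_ordS1D X x : r @: (X :\ x) = (r @: X) :\ r x.
Proof.
apply/setP => y; rewrite -(ord_predK y) !inE !mem_ordS !inE (inj_eq (@ordS_inj _)) //.
Qed.

(** Cyclic distances are kept, only wrapping changes: a strand that starts in the last column wraps
    before the rotation and not after it, and one that ends there does the opposite. *)
Lemma wgt_ordS F j x : j != x ->
  u ^+ (j == ord_max) * wgt t u (r @: F) (r j) (r x) = u ^+ (x == ord_max) * wgt t u F j x.
Proof.
move=> jx; rewrite /wgt card_imset; last exact: ordS_inj.
have -> : skip (r @: F) (r j) (r x) = skip F j x.
  rewrite /skip -[RHS](card_imset _ (@ordS_inj m.+1)); apply: eq_card => c.
  by rewrite -(ord_predK c) mem_ordS !inE mem_ordS !cdist_ordS.
set A := (_ / _).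
have E (p : bool) : (if p then u else 1) = u ^+ p by case: p.
have rv (y : 'I_m.+1) : (r y : nat) = if y == ord_max then 0%N else y.+1.
  exact: (ordS_val y).
rewrite !E mulrCA [RHS]mulrCA -!exprD; congr (A * u ^+ _); rewrite !rv.
have := ltn_ord j; have := ltn_ord x; move: jx; rewrite -!val_eqE /=.
by case: (nat_of_ord j =P m) => h1; case: (nat_of_ord x =P m) => h2; lia.
Qed.

Lemma wlist_ordS L F S : uniq L -> all [predC F] L -> S \subset F ->
  u ^+ (ord_max \in L) * wlist t u (map r L) (r @: F) (r @: S) =
  u ^+ (ord_max \in S) * wlist t u L F S.
Proof.
elim: L F S => [|j L IH] F S /=.
  move=> _ _ _; rewrite imset_eq0 expr0 mul1r; case: eqP => [->|_]; last by rewrite mulr0.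
  by rewrite inE expr0 mul1r.
move=> /andP[jL uL] /andP[jF LF] SF.
rewrite big_imset /=; last by move=> x y _ _; apply: ordS_inj.
rewrite !big_distrr; apply: eq_bigr => x xS; rewrite /= -!imset_ordS1D.
have xF := subsetP SF _ xS; have jx : j != x by apply: contraNneq jF => ->.
have LF' : all [predC F :\ x] L.
  by apply: sub_all LF => y /=; rewrite !inE negb_and orbC => ->.
have := IH (F :\ x) (S :\ x) uL LF' (setSD _ SF).
have := wgt_ordS F jx.
have -> : ((ord_max \in j :: L) = (j == ord_max) + (ord_max \in L) :> nat)%N.
  by rewrite inE eq_sym; case: eqP => // e; rewrite -e (negbTE jL).
have -> : ((ord_max \in S) = (x == ord_max) + (ord_max \in S :\ x) :> nat)%N.
  by rewrite !inE [ord_max == x]eq_sym; case: eqP => // <-; rewrite xS.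
rewrite !exprD; move: (u ^+ (j == _)) (u ^+ (x == _)) (u ^+ (_ \in L)) (u ^+ (_ \in _ :\ _)) => p1 p2 p3 p4.
move: (wgt _ _ _ _ _) (wgt _ _ _ _ _) (wlist _ _ _ _ _) (wlist _ _ _ _ _) => a b c d e1 e2.
rewrite (_ : p1 * p3 * (b * d) = (p1 * b) * (p3 * d)); last by ring.
by rewrite e1 e2; ring.
Qed.

Lemma Wset_ordS J F S : S \subset F ->
  u ^+ (ord_max \in J) * Wset t u (r @: J) (r @: F) (r @: S) =
  u ^+ (ord_max \in S) * Wset t u J F S.
Proof.
move=> SF; rewrite /Wset.
have rI (X Y : {set 'I_m.+1}) : (r @: X) :&: (r @: Y) = r @: (X :&: Y).
  by apply/setP => x; rewrite -(ord_predK x) !inE !mem_ordS inE.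
have rD (X Y : {set 'I_m.+1}) : (r @: X) :\: (r @: Y) = r @: (X :\: Y).
  by apply/setP => x; rewrite -(ord_predK x) !inE !mem_ordS inE.
have rS (X Y : {set 'I_m.+1}) : ((r @: X) \subset (r @: Y)) = (X \subset Y).
  apply/subsetP/subsetP => h x; first by rewrite -(mem_ordS X) -(mem_ordS Y); apply: h.
  by rewrite -(ord_predK x) !mem_ordS; apply: h.
rewrite rI rS !rD; case: ifP => [JFS|_]; last by rewrite !mulr0.
have pe : perm_eq (map r (enum (J :\: F))) (enum (r @: (J :\: F))).
  apply: uniq_perm; rewrite ?enum_uniq ?map_inj_uniq ?enum_uniq //; first exact: ordS_inj.
  move=> x; rewrite mem_enum; apply/mapP/imsetP => -[y yX ->]; exists y => //.
    by rewrite -mem_enum.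
  by rewrite mem_enum.
have dJF : [disjoint r @: (J :\: F) & r @: (F :\: J)] by rewrite -!rD disjointDD.
rewrite (wlist_enum _ _ pe dJF) ?rS ?setSD //.
have := @wlist_ordS (enum (J :\: F)) (F :\: J) (S :\: J) (enum_uniq _) _ (setSD _ SF).
rewrite mem_enum !inE => H.
have {}H := H _.
case mJ: (ord_max \in J) in H *; rewrite /= ?andbF ?andbT in H *; last first.
  by rewrite H // (all_notin _ (disjointDD J F)) // => x; rewrite mem_enum.
case mF: (ord_max \in F) in H *; rewrite /= in H *.
  (* A trivially paired ball in the last column contributes the factor u to both sides. *)
  have -> : ord_max \in S by apply: (subsetP JFS); rewrite inE mJ.
  congr (_ * _); rewrite -[LHS]mul1r -[RHS]mul1r H //.
  by apply: (all_notin _ (disjointDD J F)) => x; rewrite mem_enum.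
have -> : (ord_max \in S) = false by apply: contraFF mF => /(subsetP SF).
by rewrite H // (all_notin _ (disjointDD J F)) // => x; rewrite mem_enum.
Qed.

End RotateColumns.

(** * Factorization of the queue coefficients over the labels *)

Section Factorization.
Variables (n : nat) (nu mu : 'X_{1..n}).
Local Notation t := tpar.
Implicit Types (X : {set 'I_n}) (j b : 'I_n) (L : seq 'I_n) (pi : {ffun 'I_n -> 'I_n}).

Definition Jset (la : 'X_{1..n}) (a : nat) : {set 'I_n} := [set j | la j == a].
Definition Fset (la : 'X_{1..n}) (a : nat) : {set 'I_n} := [set j | (0 < la j <= a)%N].
Definition Wlab (a : nat) : Kqt :=
  Wset t (qpar ^+ a.-1) (Jset nu a) (Fset mu a) (Jset mu a).

(* X is the set of bottom balls used by earlier nontrivial pairings.  Balls of larger label are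
   matched first, so only the bottom labels up to nu j can be free when j is processed. *)
Definition okp j X b := [&& mu b == nu j, b \notin X & nu b != nu j].
Definition Fr j X : {set 'I_n} :=
  [set b | (0 < mu b <= nu j)%N && ~~ ((mu b == nu j) && ((nu b == nu j) || (b \in X)))].
Definition stepw j X b : Kqt := (okp j X b)%:R * wgt t (qpar ^+ (nu j).-1) (Fr j X) j b.

Fixpoint Rsum L X : Kqt :=
  if L is j :: L' then \sum_b stepw j X b * Rsum L' (b |: X) else 1.

Fixpoint Rval pi L X : Kqt :=
  if L is j :: L' then stepw j X (pi j) * Rval pi L' (pi j |: X) else 1.

Lemma Rval_ext pi pi' L X : {in L, pi =1 pi'} -> Rval pi L X = Rval pi' L X.
Proof.
elim: L X => //= j L IH X h; rewrite h ?mem_head // IH // => k kL.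
by apply: h; rewrite inE kL orbT.
Qed.

Definition off L pi := [forall j, (j \notin L) ==> (pi j == j)].

Lemma Rsum_val L X : uniq L -> \sum_(pi | off L pi) Rval pi L X = Rsum L X.
Proof.
elim: L X => [|j L IH] X /=.
  move=> _; rewrite (big_pred1 [ffun k => k]) // => pi; apply/forallP/eqP => [h|-> k].
    by apply/ffunP => k; rewrite ffunE; apply/eqP; move: (h k).
  by rewrite ffunE eqxx implybT.
move=> /andP[jL uL]; rewrite (partition_big (fun pi => pi j) predT) //=.
apply: eq_bigr => b _; rewrite -IH // big_distrr /=.
pose up pi := [ffun k => if k == j then b else pi k] : {ffun 'I_n -> 'I_n}.
pose dn pi := [ffun k => if k == j then j else pi k] : {ffun 'I_n -> 'I_n}.
rewrite (reindex_onto up dn) /=; last first.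
  move=> pi /andP[_ /eqP e]; apply/ffunP => k; rewrite !ffunE.
  by case: eqP => // ->.
apply: eq_big => [pi|pi /andP[/andP[h1 /eqP h2] _]].
  rewrite ffunE eqxx eqxx andbT; apply/andP/forallP => [[/forallP h /eqP e] k|h].
    apply/implyP => kL; have := h k; rewrite inE negb_or !ffunE kL andbT.
    have [->|kj] := eqVneq k j; last by [].
    by move=> _; have := congr1 (fun f : {ffun _} => f j) e; rewrite !ffunE eqxx => <-.
  split.
    apply/forallP => k; apply/implyP; rewrite inE negb_or ffunE => /andP[/negbTE -> kL].
    by have := h k; rewrite kL.
  apply/eqP/ffunP => k; rewrite !ffunE; case: eqP => // ->.
  by have := h j; rewrite jL => /eqP.
rewrite h2; congr (_ * _); apply: Rval_ext => k kL; rewrite ffunE.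
by case: eqP => // e; rewrite -e kL in jL.
Qed.

Definition nontriv : {set 'I_n} := [set j | (0 < nu j)%N && (mu j != nu j)].

Definition ldesc (j k : 'I_n) := (nu k < nu j)%N || ((nu j == nu k) && (k <= j)%N).

Lemma ldesc_trans : transitive ldesc.
Proof. by move=> y x z; rewrite /ldesc; lia. Qed.

Lemma ldesc_total : total ldesc.
Proof. by move=> x y; rewrite /ldesc; lia. Qed.

Lemma ldesc_before j k : j != k -> (0 < nu j)%N -> before nu j k = ldesc j k.
Proof.
move=> jk j0; have : nat_of_ord j <> k by move/val_inj => e; rewrite e eqxx in jk.
by rewrite /before /ldesc; lia.
Qed.

Lemma ldesc_anti j k : j != k -> ldesc j k -> ldesc k j = false.
Proof.
move=> jk; have : nat_of_ord j <> k by move/val_inj => e; rewrite e eqxx in jk.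
by rewrite /ldesc; lia.
Qed.

Definition Lnt : seq 'I_n := sort ldesc (enum nontriv).

Lemma mem_Lnt j : (j \in Lnt) = (j \in nontriv).
Proof. by rewrite mem_sort mem_enum. Qed.

Lemma uniq_Lnt : uniq Lnt.
Proof. by rewrite sort_uniq enum_uniq. Qed.

Lemma Lnt_cut P j Q : Lnt = P ++ j :: Q -> P =i [pred k in nontriv | before nu k j].
Proof.
move=> e; have u := uniq_Lnt; rewrite e cat_uniq /= in u.
have := sort_sorted ldesc_total (enum nontriv).
rewrite (sorted_pairwise ldesc_trans) -/Lnt e pairwise_cat /= => /and4P[/allrelP aPQ _ /allP aQ _].
case/and3P: u => _ nPQ /andP[jQ _].
move=> k; rewrite -[RHS]/((k \in nontriv) && before nu k j) -mem_Lnt e mem_cat inE.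
have [->|kj] := eqVneq k j.
  rewrite /before !ltnn !andbF /= ?andbF; apply/negbTE; apply: contra nPQ => jP.
  by rewrite jP.
have kL : (k \in P) || (k \in Q) -> (0 < nu k)%N.
  move=> h; have : k \in Lnt by rewrite e mem_cat inE orbA (orbC (k \in P)) -orbA h orbT.
  by rewrite mem_Lnt inE => /andP[].
case kP: (k \in P) => /=.
  by rewrite ldesc_before ?kL ?kP // aPQ ?mem_head.
case kQ: (k \in Q) => //=.
by rewrite ldesc_before ?kL ?kQ ?orbT // ldesc_anti 1?eq_sym // aQ.
Qed.

Definition prevs pi j : {set 'I_n} := [set pi k | k in [set k in nontriv | before nu k j]].

Lemma Rval_prod pi : Rval pi Lnt set0 = \prod_(j in nontriv) stepw j (prevs pi j) (pi j).
Proof.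
have H P Q : Lnt = P ++ Q ->
    Rval pi Q [set pi k | k in P] = \prod_(j <- Q) stepw j (prevs pi j) (pi j).
  elim: Q P => [|j Q IH] P e /=; first by rewrite big_nil.
  rewrite big_cons; congr (_ * _).
    congr (stepw _ _ _); apply/setP => x; apply/imsetP/imsetP => -[k kP ->]; exists k => //.
      by move: kP; rewrite (Lnt_cut e) !inE.
    by move: kP; rewrite (Lnt_cut e) !inE.
  rewrite -(IH (rcons P j)) ?cat_rcons //; congr (Rval _ _ _); apply/setP => x.
  rewrite !inE; apply/orP/imsetP => [[/eqP ->|/imsetP[k kP ->]]|[k]].
  - by exists j; rewrite // mem_rcons mem_head.
  - by exists k; rewrite // mem_rcons inE kP orbT.
  - rewrite mem_rcons inE => /orP[/eqP -> ->|kP ->]; [by left | right].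
    by apply/imsetP; exists k.
rewrite (eq_bigl (fun j => j \in Lnt)); last by move=> j; rewrite mem_Lnt.
rewrite -(big_uniq _ uniq_Lnt) /=.
rewrite -(H [::]) //; congr (Rval _ _ _); apply/esym/setP => x; rewrite inE.
by apply/imsetP => -[].
Qed.

Lemma count_label (la : 'X_{1..n}) (a : nat) :
  count_mem a [seq la i | i <- enum 'I_n & (1 < la i)%N] = if (1 < a)%N then #|Jset la a| else 0%N.
Proof.
rewrite count_map count_filter -sum1_count big_enum_cond /= sum1dep_card.
case: ifP => h; first by apply: eq_card => i; rewrite !inE; case: eqP => // ->; rewrite h.
by apply: eq_card0 => i; rewrite !inE; case: eqP => // ->; rewrite h.
Qed.

Lemma adm_cardP :
  reflect (forall a, (1 < a)%N -> #|Jset nu a| = #|Jset mu a|)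
    (perm_eq [seq nu i | i <- enum 'I_n & (1 < nu i)%N]
             [seq mu i | i <- enum 'I_n & (1 < mu i)%N]).
Proof.
apply: (iffP idP) => [pe a a1|h].
  by have := seq.permP pe (pred1 a); rewrite !count_label a1.
apply/allP => a _ /=; rewrite !count_label; case: ifP => // a1; rewrite h //.
Qed.

Hypothesis adm : tlq_adm nu mu.

Lemma adm_no1 i : nu i != 1%N.
Proof. by case/and3P: adm => /forallP. Qed.

Lemma adm_card a : (1 < a)%N -> #|Jset nu a| = #|Jset mu a|.
Proof. by case/and3P: adm => _ /adm_cardP h _; apply: h. Qed.

Lemma adm_le i : mu i = 0%N \/ (nu i <= mu i)%N.
Proof.
by case/and3P: adm => _ _ /forallP /(_ i) /orP[/eqP ->|]; [left|right].
Qed.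

Definition okpi pi := off Lnt pi && [forall j in nontriv, okp j (prevs pi j) (pi j)].

Lemma inQ_okpi pi : inQ nu mu pi = okpi pi.
Proof.
rewrite /inQ adm /=; apply/and3P/andP => [[/forallP h1 /forallP h2 /forallP h3]|[/forallP h1 /forall_inP h2]].
  have inj j1 j2 : (0 < nu j1)%N -> (0 < nu j2)%N -> pi j1 = pi j2 -> j1 = j2.
    by move=> p1 p2 e; have /forallP/(_ j2) := h2 j1; rewrite p1 p2 e eqxx => /eqP.
  have lab j : (0 < nu j)%N -> mu (pi j) = nu j by move=> p; have := h1 j; rewrite p => /eqP.
  have tr j : (0 < nu j)%N -> nu j = mu j -> pi j = j.
    by move=> p e; have := h3 j; rewrite p e eqxx => /eqP.
  split.
    apply/forallP => j; apply/implyP; rewrite mem_Lnt inE negb_and => h.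
    have := h1 j; case: posnP => [//|p] _; rewrite p /= negbK in h.
    by apply/eqP/tr => //; apply/esym/eqP.
  apply/forall_inP => j; rewrite inE => /andP[p ne].
  rewrite /okp lab // eqxx /=; apply/andP; split.
    apply/negP => /imsetP[k]; rewrite !inE => /andP[/andP[kp _] bk] e.
    by rewrite (inj _ _ p kp e) /before !ltnn !andbF in bk.
  apply: contraNneq ne => e.
  have e2 : nu (pi j) = mu (pi j) by rewrite e lab.
  have p2 : (0 < nu (pi j))%N by rewrite e.
  by have /(inj _ _ p2 p) ej := tr _ p2 e2; rewrite -{1}ej lab.
have offj j : j \notin nontriv -> pi j = j.
  by move=> nj; apply/eqP; have := h1 j; rewrite mem_Lnt nj.
have ok j : j \in nontriv -> [/\ mu (pi j) = nu j, pi j \notin prevs pi j & nu (pi j) <> nu j].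
  by move=> /h2 /and3P[/eqP ? ? /eqP ?].
split.
- apply/forallP => j; have [jn|jn] := boolP (j \in nontriv).
    by have [e _ _] := ok j jn; move: jn; rewrite inE => /andP[-> _]; apply/eqP.
  rewrite (offj j) //; case: ifP => // p; move: jn; rewrite inE p /= negbK //.
- apply/forallP => j1; apply/forallP => j2; apply/implyP => /and3P[p1 p2 /eqP e].
  have [n1|n1] := boolP (j1 \in nontriv); have [n2|n2] := boolP (j2 \in nontriv).
  + case: eqP => // /eqP ne; have [_ h _] := ok _ n1; have [_ h' _] := ok _ n2.
    have : before nu j1 j2 || before nu j2 j1.
      rewrite (ldesc_before ne p1) (ldesc_before _ p2) 1?eq_sym //; exact: ldesc_total.
    case/orP => b; [case/negP: h' | case/negP: h]; apply/imsetP; [exists j1 | exists j2] => //.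
      by move: n1; rewrite !inE b => ->.
    by move: n2; rewrite !inE b => ->.
  + have [a1 _ a3] := ok _ n1; case: a3; rewrite -a1 e (offj _ n2).
    by move: n2; rewrite inE p2 /= negbK => /eqP.
  + have [a1 _ a3] := ok _ n2; case: a3; rewrite -a1 -e (offj _ n1).
    by move: n1; rewrite inE p1 /= negbK => /eqP.
  + by rewrite -(offj _ n1) -(offj _ n2) e.
apply/forallP => j; apply/implyP => /andP[p /eqP e]; rewrite offj // inE p /= e eqxx //.
Qed.

(** Injectivity becomes surjectivity because both rows have equally many balls of each label above
    1. *)
Lemma inQ_surj pi b a : inQ nu mu pi -> (1 < a)%N -> mu b = a ->
  exists2 j, nu j = a & pi j = b.
Proof.
move=> /and4P[_ /forallP h1 /forallP h2 _] a1 eb.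
have : [set pi j | j in Jset nu a] = Jset mu a.
  apply/eqP; rewrite eqEcard card_in_imset; last first.
    move=> j1 j2; rewrite !inE => /eqP e1 /eqP e2 e.
    have /forallP/(_ j2) := h2 j1; rewrite e1 e2 e eqxx (ltnW a1) /=.
    by move/eqP.
  rewrite adm_card // leqnn andbT; apply/subsetP => x /imsetP[j]; rewrite !inE => /eqP ej ->.
  by have := h1 j; rewrite ej (ltnW a1).
move/setP/(_ b); rewrite !inE eb eqxx => /imsetP[j]; rewrite inE => /eqP ej e.
by exists j.
Qed.

(** By [inQ_surj] every bottom ball of larger label is matched before j, and no smaller one is.
    Among those of the label of j, exactly the used and the trivially paired ones are missing. *)
Lemma freeset_Fr pi j : inQ nu mu pi -> j \in nontriv ->
  freeset nu mu pi j = Fr j (prevs pi j).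
Proof.
move=> hQ jn; have := hQ; rewrite inQ_okpi => /andP[/forallP h1 _].
have offj k : k \notin nontriv -> pi k = k.
  by move=> nk; apply/eqP; have := h1 k; rewrite mem_Lnt nk.
have jp : (0 < nu j)%N by move: jn; rewrite inE => /andP[].
have lab k : (0 < nu k)%N -> mu (pi k) = nu k.
  by move=> p; case/and4P: hQ => _ /forallP/(_ k); rewrite p => /eqP.
have trv b : (0 < mu b)%N -> nu b = mu b -> pi b = b.
  by move=> p e; apply: offj; rewrite inE e eqxx andbF.
apply/setP => b; rewrite !inE; case p: (0 < mu b)%N => //=.
apply/andP/andP => [[nb tb]|[le tb]].
  have le : (mu b <= nu j)%N.
    rewrite leqNgt; apply: contra nb => lt.
    have [|k ek e] := inQ_surj hQ _ (erefl (mu b)); first exact: leq_ltn_trans lt.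
    by apply/imsetP; exists k => //; rewrite inE /before ek p lt.
  split=> //; apply/negP => /andP[/eqP e /orP[/eqP e2|]].
    by move: tb; rewrite e e2 eqxx trv ?eqxx // e2 e.
  case/imsetP => k; rewrite inE => /andP[_ bk] eb; case/negP: nb.
  by apply/imsetP; exists k => //; rewrite inE.
split.
  apply/negP => /imsetP[k]; rewrite inE => bk eb; have kp : (0 < nu k)%N by case/andP: bk.
  have mk := lab k kp; rewrite -eb in mk.
  have ek : nu k = nu j by move: bk le; rewrite /before mk; lia.
  case/negP: tb; rewrite mk ek eqxx /=.
  have [kn|kn] := boolP (k \in nontriv).
    by apply/orP; right; apply/imsetP; exists k => //; rewrite inE bk kn.
  by rewrite eb offj // ek eqxx.
apply: contra tb => /and3P[/eqP e /eqP e2 _]; by rewrite e2 e eqxx.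
Qed.

Lemma acoef_Rsum : acoef nu mu = Rsum Lnt set0.
Proof.
rewrite -(Rsum_val _ uniq_Lnt) [RHS](bigID (fun pi => okpi pi)) /= [X in _ + X]big1 ?addr0; last first.
  move=> pi /andP[o]; rewrite /okpi o /= negb_forall => /existsP[j].
  rewrite negb_imply => /andP[jn /negbTE nk]; rewrite Rval_prod (bigD1 j) //= /stepw nk.
  by rewrite !mul0r.
apply: eq_big => [pi|pi hQ].
  by rewrite inQ_okpi /okpi; case: (off _ _).
rewrite Rval_prod; apply: eq_big => [j|j].
  rewrite inE; case p: (0 < nu j)%N => //=.
  case/and4P: hQ => _ /forallP/(_ j); rewrite p => /eqP e _ /forallP/(_ j); rewrite p /=.
  have [_ /= ->|ne] := eqVneq (mu j) (nu j); first by [].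
  by move=> _; apply/eqP => ej; rewrite -{1}ej e eqxx in ne.
move=> /andP[p ne].
have jn : j \in nontriv.
  rewrite inE p /=; apply: contra ne => /eqP e.
  by case/and4P: hQ => _ _ _ /forallP/(_ j); rewrite p e eqxx.
have := hQ; rewrite inQ_okpi => /andP[_ /forall_inP/(_ j jn)] ok.
by rewrite /stepw ok mul1r /wt /nskipped (freeset_Fr hQ jn) /wgt /skip.
Qed.

Lemma Rsum_indep L X X' :
  (forall j b, j \in L -> mu b = nu j -> (b \in X) = (b \in X')) -> Rsum L X = Rsum L X'.
Proof.
elim: L X X' => //= j L IH X X' h; apply: eq_bigr => b _.
have hF : Fr j X = Fr j X'.
  apply/setP => c; rewrite !inE; case: eqP => //= e.
  by rewrite (h j c) ?mem_head.
rewrite /stepw hF; have -> : okp j X b = okp j X' b.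
  by rewrite /okp; case: eqP => //= e; rewrite (h j b) ?mem_head.
congr (_ * _); apply: IH => k c kL e; rewrite !inE (h k c) // inE kL orbT //.
Qed.

(** The set of used balls enters the steps of a label only through balls of that very label
    ([Rsum_indep]), so the labels do not interact. *)
Lemma Rsum_split D L X : (forall j, j \in L -> (nu j < D)%N) ->
  Rsum L X = \prod_(a < D) Rsum [seq j <- L | nu j == a :> nat] X.
Proof.
elim: L X => [|j L IH] X h /=; first by rewrite big1.
have jD := h j (mem_head _ _).
rewrite (bigD1 (Ordinal jD)) //= eqxx /= big_distrl /=; apply: eq_bigr => b _.
rewrite IH; last by move=> k kL; apply: h; rewrite inE kL orbT.
have [ok|/negbTE nok] := boolP (okp j X b); last by rewrite /stepw nok !mul0r.
rewrite (bigD1 (Ordinal jD)) /= ?eqxx // mulrA; congr (_ * _).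
apply: eq_bigr => a; rewrite -val_eqE /= => /negbTE ne.
rewrite eq_sym ne; apply: Rsum_indep => k c; rewrite mem_filter !inE => /andP[/eqP ek _] ec.
case: eqP => // ecb; case/and3P: ok => /eqP e _ _.
by rewrite -ek -ec ecb e eqxx in ne.
Qed.

Definition FX a X : {set 'I_n} :=
  [set b | (0 < mu b <= a)%N && ~~ ((mu b == a) && ((nu b == a) || (b \in X)))].
Definition SX a X : {set 'I_n} := [set b | [&& mu b == a, b \notin X & nu b != a]].

Lemma Rsum_wlist a L X : (0 < a)%N -> (forall j, j \in L -> nu j = a) -> size L = #|SX a X| ->
  Rsum L X = wlist t (qpar ^+ a.-1) L (FX a X) (SX a X).
Proof.
move=> a0; elim: L X => [|j L IH] X h /=.
  by move/esym/eqP; rewrite cards_eq0 => ->.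
have ej := h j (mem_head _ _).
move=> sz; rewrite [RHS]big_mkcond /=; apply: eq_bigr => b _.
rewrite /stepw /okp ej inE; case: ifP => [ok|_]; last by rewrite !mul0r.
have -> : Fr j X = FX a X by rewrite /Fr ej.
rewrite mul1r; congr (_ * _).
have eS : SX a (b |: X) = SX a X :\ b.
  by apply/setP => c; rewrite !inE negb_or; case: (c == b); case: (mu c == a); rewrite ?andbF.
have eF : FX a (b |: X) = FX a X :\ b.
  apply/setP => c; rewrite !inE; have [->|] := eqVneq c b; last by [].
  by case/and3P: ok => /eqP -> _ _; rewrite eqxx orbT /= andbF.
rewrite -eS -eF; apply: IH; first by move=> k kL; apply: h; rewrite inE kL orbT.
by move: sz; rewrite eS (cardsD1 b) inE ok add1n => -[].
Qed.

Lemma JF_SJ a : (0 < a)%N -> Jset nu a :&: Fset mu a = Jset mu a :&: Jset nu a.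
Proof.
move=> a0; apply/setP => j; rewrite !inE andbC; case: eqP => [e|]; rewrite ?andbF //= !andbT.
have := adm_le j; rewrite e; case=> [->|h]; first by rewrite eq_sym (gtn_eqF a0).
by rewrite eqn_leq h andbT; case: (leqP (mu j) a) => _; rewrite ?andbF // andbT; lia.
Qed.

Lemma Rsum_Wlab a : (1 < a)%N -> Rsum [seq j <- Lnt | nu j == a] set0 = Wlab a.
Proof.
move=> a1; have a0 := ltnW a1.
have eF : Fset mu a :\: Jset nu a = FX a set0.
  apply/setP => b; rewrite !inE orbF; have := adm_le b.
  case: (ltnP 0 (mu b)) => //= p; rewrite ?andbF //.
  lia.
have eS : Jset mu a :\: Jset nu a = SX a set0.
  by apply/setP => b; rewrite !inE andbC.
have pe : perm_eq [seq j <- Lnt | nu j == a] (enum (Jset nu a :\: Fset mu a)).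
  apply: uniq_perm; [exact: filter_uniq uniq_Lnt | exact: enum_uniq | move=> j].
  rewrite mem_filter mem_Lnt mem_enum !inE; have := adm_le j.
  by have [e|ne] := eqVneq (nu j) a; rewrite ?andbF //=; lia.
rewrite /Wlab /Wset JF_SJ // subsetIl (wlist_enum _ _ pe); last first.
- by rewrite setSD //; apply/subsetP => b; rewrite !inE => /eqP ->; rewrite a0 leqnn.
- exact: disjointDD.
rewrite eF eS; apply: Rsum_wlist => // [j|]; first by rewrite mem_filter => /andP[/eqP].
rewrite (perm_size pe) -cardE -eS !cardsD JF_SJ // adm_card //.
Qed.

Lemma acoef_adm D : (forall j, nu j < D)%N ->
  acoef nu mu = \prod_(a < D | (1 < a)%N) Wlab a.
Proof.
move=> h; rewrite acoef_Rsum (@Rsum_split D) //.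
rewrite (bigID (fun a : 'I_D => (1 < a)%N)) /= [X in _ * X]big1 ?mulr1.
  by apply: eq_bigr => a a1; rewrite Rsum_Wlab.
move=> a na; rewrite (_ : [seq j <- Lnt | _] = [::]) //; apply/eqP; rewrite -[_ == _]negbK -has_filter.
apply/hasPn => j; rewrite mem_Lnt inE => /andP[p _]; apply/eqP => e.
by have := adm_no1 j; move: p na; rewrite e; case: (nat_of_ord a) => [|[|]].
Qed.

End Factorization.

Section ProductFormula.
Variables (n : nat) (nu mu : 'X_{1..n}).

Definition no1 := [forall i, nu i != 1%N].

Lemma wlist_size (K : fieldType) (t u : K) L (F S : {set 'I_n}) :
  size L != #|S| -> wlist t u L F S = 0.
Proof.
elim: L F S => [|j L IH] F S /= sz.
  by case: eqP => // e; rewrite e cards0 in sz.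
apply: big1 => b bS; rewrite IH ?mulr0 //.
by move: sz; rewrite (cardsD1 b S) bS add1n eqSS.
Qed.

(** Inadmissible pairs are included: a top ball above a smaller ball fails the test in [Wset], and
    unequal numbers of balls make [wlist] vanish. Only the ban on parts equal to 1, invisible to
    labels above 1, remains as a factor. The exchange relations can thus be checked label by
    label. *)
Lemma acoef_prod D : (forall j, nu j < D)%N -> (forall j, mu j < D)%N ->
  acoef nu mu = no1%:R * \prod_(a < D | (1 < a)%N) Wlab nu mu a.
Proof.
move=> hn hm; have [adm|nadm] := boolP (tlq_adm nu mu).
  by rewrite (acoef_adm adm hn); case/and3P: adm; rewrite -/no1 => -> _ _; rewrite mul1r.
have -> : acoef nu mu = 0.
  by rewrite /acoef big_pred0 // => pi; rewrite /inQ (negbTE nadm).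
case n1: no1; last by rewrite mul0r.
rewrite mul1r; suff [a aD [a1 z]] : exists2 a : nat, (a < D)%N & (1 < a)%N /\ Wlab nu mu a = 0.
  by rewrite (bigD1 (Ordinal aD)) //= z mul0r.
have zle i : mu i != 0%N -> (mu i < nu i)%N -> exists2 a, (a < D)%N & (1 < a)%N /\ Wlab nu mu a = 0.
  move=> m0 lt; exists (nu i); first exact: hn.
  split; first by apply: leq_trans lt; rewrite ltnS lt0n.
  rewrite /Wlab /Wset; case: ifP => // /subsetP/(_ i).
  by rewrite !inE eqxx lt0n m0 (ltnW lt) (ltn_eqF lt) => /(_ isT).
case b3: [forall i : 'I_n, (mu i == 0%N) || (nu i <= mu i)%N]; last first.
  move/negbT: b3; rewrite negb_forall => /existsP[i]; rewrite negb_or -ltnNge => /andP[h1 h2].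
  exact: zle h1 h2.
move: nadm; rewrite /tlq_adm -/no1 n1 b3 andbT /= => /adm_cardP npe.
have [a /andP[a1 ne]] : exists a : 'I_D, (1 < a)%N && (#|Jset nu a| != #|Jset mu a|).
  apply/existsP; apply: contraT; rewrite negb_exists => /forallP h; case: npe => a a1.
  have [aD|aD] := ltnP a D; first by have := h (Ordinal aD); rewrite /= a1 /= negbK => /eqP.
  rewrite !(eq_card0 (A := Jset _ _)) // => j; rewrite inE; apply/negbTE.
    by rewrite neq_ltn (leq_trans (hm j) aD).
  by rewrite neq_ltn (leq_trans (hn j) aD).
exists a => //; split => //; rewrite /Wlab /Wset; case: ifP => // JFS; apply: wlist_size.
rewrite -cardE; apply: contra ne => /eqP e.
have SF : Jset mu a \subset Fset mu a.
  by apply/subsetP => b; rewrite !inE => /eqP ->; rewrite (ltnW a1) leqnn.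
have eI : Jset nu a :&: Fset mu a = Jset mu a :&: Jset nu a.
  apply/eqP; rewrite eqEsubset !subsetI JFS subsetIl subsetIr /=.
  exact: subset_trans (subsetIl _ _) SF.
by rewrite -(cardsID (Fset mu a)) -[X in _ == X](cardsID (Jset nu a)) eI e.
Qed.

End ProductFormula.

Definition prodl (K : fieldType) (D : nat) (W : nat -> K) := \prod_(k < D | (1 < k)%N) W k.

Lemma eq_prodl (K : fieldType) D (W W' : nat -> K) :
  (forall k, (1 < k)%N -> W k = W' k) -> prodl D W = prodl D W'.
Proof. by move=> h; apply: eq_bigr => k; apply: h. Qed.

Lemma prodl_D1 (K : fieldType) D B (W : nat -> K) : (1 < B < D)%N ->
  prodl D W = W B * \prod_(k < D | (1 < k)%N && (k != B :> nat)) W k.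
Proof. by move=> /andP[B1 BD]; rewrite /prodl (bigD1 (Ordinal BD)). Qed.

Lemma prodl_scale (K : fieldType) D B c (W W' : nat -> K) : (1 < B < D)%N ->
  (forall k, (1 < k)%N -> k != B -> W' k = W k) -> W' B = c * W B -> prodl D W' = c * prodl D W.
Proof.
move=> hB h e; rewrite !(prodl_D1 _ hB) e -mulrA; congr (_ * (_ * _)).
by apply: eq_bigr => k /andP[]; apply: h.
Qed.

(** * Exchange and rotation relations *)

Section Exchange.
Variables (n : nat) (i : 'I_n.-1).
Implicit Types (nu mu : 'X_{1..n}) (k : nat).
Local Notation a := (adjL i).
Local Notation b := (adjR i).
Local Notation s := (swp i).
Local Notation t := tpar.

Lemma Jset_swp nu k : Jset (s nu) k = sadj i @: Jset nu k.
Proof. by apply/setP => j; rewrite sadj_imset !inE swpE. Qed.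

Lemma Fset_swp nu k : Fset (s nu) k = sadj i @: Fset nu k.
Proof. by apply/setP => j; rewrite sadj_imset !inE swpE. Qed.

Lemma no1_swp nu : no1 (s nu) = no1 nu.
Proof.
apply/forallP/forallP => h j; first by have := h (sadj i j); rewrite swpE sadjK.
by rewrite swpE.
Qed.

Lemma sub_JF mu k : (0 < k)%N -> Jset mu k \subset Fset mu k.
Proof. by move=> k0; apply/subsetP => j; rewrite !inE => /eqP ->; rewrite k0 leqnn. Qed.

Lemma Wlab_nu nu mu k : (nu a == k) = (nu b == k) -> Wlab (s nu) mu k = Wlab nu mu k.
Proof. by move=> e; rewrite /Wlab Jset_swp imset_sadj_fix // !inE. Qed.

Lemma Wlab_mu nu mu k : (0 < mu a <= k)%N = (0 < mu b <= k)%N -> (mu a == k) = (mu b == k) ->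
  Wlab nu (s mu) k = Wlab nu mu k.
Proof. by move=> e e'; rewrite /Wlab Jset_swp Fset_swp !imset_sadj_fix // !inE. Qed.

(** For label k a column is in play when exactly one of the two conditions, top label k and bottom
    label between 1 and k, holds. Either at most one of the two columns is in play, and [Wset_adj]
    applies, or the columns look alike. *)
Lemma Wlab_swp nu mu k : (0 < k)%N ->
  ~~ (((nu a == k) (+) (0 < mu a <= k)%N) && ((nu b == k) (+) (0 < mu b <= k)%N)) ||
  [&& (nu a == k) == (nu b == k), (0 < mu a <= k)%N == (0 < mu b <= k)%N &
      (mu a == k) == (mu b == k)] ->
  Wlab (s nu) (s mu) k = Wlab nu mu k.
Proof.
move=> k0 /orP[nb|/and3P[/eqP e1 /eqP e2 /eqP e3]]; last by rewrite Wlab_mu // Wlab_nu.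
rewrite /Wlab !Jset_swp Fset_swp; apply: Wset_adj; first exact: sub_JF.
apply: contra nb; rewrite !inE => /andP[h1 h2]; apply/andP; split.
  by case: (nu a == k) h1; case: (0 < mu a <= k)%N.
by case: (nu b == k) h2; case: (0 < mu b <= k)%N.
Qed.

Lemma Wlab_unpicked nu mu : (0 < mu b < mu a)%N -> (nu a != mu a) -> (nu b != mu a) ->
  Wlab nu (s mu) (mu a) = t * Wlab nu mu (mu a).
Proof.
move=> /andP[h1 h2] na nb; rewrite /Wlab Jset_swp Fset_swp.
have m0 : (0 < mu a)%N := leq_ltn_trans (leq0n _) h2.
rewrite [X in Wset _ _ _ X _]imset_sadj_fix; last by rewrite !inE h1 (ltnW h2) m0 leqnn.
apply: Wset_unpicked; rewrite ?inE ?eqxx ?h1 ?(ltnW h2) ?na ?nb ?(ltn_eqF h2) //.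
exact: sub_JF.
Qed.

Lemma Wlab_over nu mu k : nu a = k -> nu b != k -> ~~ (0 < mu a <= k)%N -> (0 < mu b < k)%N ->
  Wlab nu mu k = t * Wlab (s nu) (s mu) k.
Proof.
move=> ek nb ma /andP[h1 h2]; rewrite /Wlab !Jset_swp Fset_swp.
have k0 : (0 < k)%N := leq_ltn_trans (leq0n _) h2.
rewrite [X in _ = _ * Wset _ _ _ _ X]imset_sadj_fix; last first.
  by rewrite !inE (ltn_eqF h2); apply: contraNF ma => /eqP ->; rewrite k0 leqnn.
apply: Wset_over; rewrite ?inE ?ek ?eqxx ?h1 ?(ltnW h2) ?(ltn_eqF h2) //.
exact: sub_JF.
Qed.

Lemma Wlab_special nu mu k : (0 < k)%N -> nu a = k -> nu b != k -> ~~ (0 < mu a <= k)%N -> mu b = k ->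
  Wlab nu mu k = t * Wlab (s nu) (s mu) k + (1 - t) * Wlab (s nu) mu k.
Proof.
move=> k0 ek nb ma eb; rewrite /Wlab !Jset_swp Fset_swp.
apply: Wset_special; rewrite ?inE ?ek ?eb ?eqxx //; last exact: sub_JF.
by move=> l l0; apply: one_sub_qt_neq0; rewrite addn_gt0 l0 orbT.
Qed.

Lemma acoef_eq0 nu mu (j : 'I_n) : (0 < mu j < nu j)%N -> acoef nu mu = 0.
Proof.
move=> /andP[h1 h2]; rewrite /acoef big_pred0 // => pi; rewrite /inQ /tlq_adm.
suff /negbTE -> : ~~ [forall j : 'I_n, (mu j == 0%N) || (nu j <= mu j)%N] by rewrite !andbF.
by rewrite negb_forall; apply/existsP; exists j; rewrite negb_or -ltnNge h2 -lt0n h1.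
Qed.

Lemma acoef_no1 nu mu : ~~ no1 nu -> acoef nu mu = 0.
Proof.
move=> h; rewrite /acoef big_pred0 // => pi; rewrite /inQ /tlq_adm.
by rewrite -/(no1 nu) (negbTE h).
Qed.

Lemma mnm_le_mdeg nu (j : 'I_n) : (nu j <= mdeg nu)%N.
Proof. by rewrite mdegE (bigD1 j) //= leq_addr. Qed.

(** It depends only on the degrees, so both sides of an exchange or rotation relation become
    products over the same range of labels. *)
Definition bnd nu mu := (mdeg nu + mdeg mu).+1.

Lemma acoefE nu mu D : D = bnd nu mu -> no1 nu -> acoef nu mu = prodl D (Wlab nu mu).
Proof.
move=> -> h; rewrite (@acoef_prod n nu mu (bnd nu mu)) ?h ?mul1r // => j.
  by rewrite ltnS (leq_trans (mnm_le_mdeg nu j)) ?leq_addr.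
by rewrite ltnS (leq_trans (mnm_le_mdeg mu j)) ?leq_addl.
Qed.

Lemma lt_bnd nu mu j : (nu j < bnd nu mu)%N /\ (mu j < bnd nu mu)%N.
Proof.
by rewrite !ltnS (leq_trans (mnm_le_mdeg nu j)) ?leq_addr // (leq_trans (mnm_le_mdeg mu j)) ?leq_addl.
Qed.

Lemma acoef_swp_eq nu mu : mu a = mu b -> acoef (s nu) mu = acoef nu mu.
Proof.
move=> e; have es : s mu = mu by apply: swp_id.
have [n1|n1] := boolP (no1 nu); last by rewrite !acoef_no1 ?no1_swp.
have [h|h] := boolP (0 < mu a < nu a)%N.
  by rewrite (acoef_eq0 h) (@acoef_eq0 _ _ b) // swpR -e.
have [h'|h'] := boolP (0 < mu b < nu b)%N.
  by rewrite (acoef_eq0 h') (@acoef_eq0 _ _ a) // swpL e.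
rewrite (@acoefE _ _ (bnd nu mu)) ?no1_swp // ?(@acoefE nu mu (bnd nu mu)) //; last first.
  by rewrite /bnd mdeg_swp.
apply: eq_prodl => k k1; rewrite -{1}es; apply: Wlab_swp; lia.
Qed.

Lemma acoef_swp_zero nu mu : (0 < mu a)%N -> mu b = 0%N -> (nu b <= nu a)%N ->
  acoef nu mu = acoef (s nu) (s mu).
Proof.
move=> ma mb le.
have [n1|n1] := boolP (no1 nu); last by rewrite !acoef_no1 ?no1_swp.
have [h|h] := boolP (mu a < nu a)%N.
  by rewrite (@acoef_eq0 _ _ a) ?ma ?h // (@acoef_eq0 _ _ b) // !swpR ma h.
rewrite (@acoefE nu mu (bnd nu mu)) // (@acoefE _ _ (bnd nu mu)) ?no1_swp //; last first.
  by rewrite /bnd !mdeg_swp.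
apply: eq_prodl => k k1; apply/esym/Wlab_swp; lia.
Qed.

Lemma acoef_swp_ge nu mu : (0 < mu b < mu a)%N -> (nu b <= nu a)%N ->
  acoef nu (s mu) = t * acoef (s nu) mu.
Proof.
move=> /andP[mb ba] le.
have [n1|n1] := boolP (no1 nu); last by rewrite !acoef_no1 ?no1_swp ?mulr0.
have [h|h] := boolP (mu b < nu a)%N.
  by rewrite (@acoef_eq0 _ _ a) ?(@acoef_eq0 _ _ b) ?swpL ?swpR ?mb ?h // mulr0.
have [_ bD] := lt_bnd nu mu a.
rewrite (@acoefE _ _ (bnd nu mu)) // ?(@acoefE (s nu) mu (bnd nu mu)) ?no1_swp //; last 2 first.
- by rewrite /bnd mdeg_swp.
- by rewrite /bnd mdeg_swp.
apply: (prodl_scale (B := mu a)); first by rewrite bD (leq_ltn_trans mb).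
  by move=> k k1 kB; rewrite -{1}(swpK i nu); apply: Wlab_swp; rewrite ?swpL ?swpR; lia.
rewrite -{1}(swpK i nu) Wlab_nu ?swpL ?swpR; last by lia.
by rewrite Wlab_unpicked ?swpL ?swpR ?mb ?ba //; lia.
Qed.

Lemma prodl_linear (K : fieldType) D B c c' (W W1 W2 : nat -> K) : (1 < B < D)%N ->
  (forall k, (1 < k)%N -> k != B -> W1 k = W k) -> (forall k, (1 < k)%N -> k != B -> W2 k = W k) ->
  W B = c * W1 B + c' * W2 B -> prodl D W = c * prodl D W1 + c' * prodl D W2.
Proof.
move=> hB h1 h2 e; rewrite !(prodl_D1 _ hB) e.
set R := \prod_(k < D | _) W k.
have -> : \prod_(k < D | (1 < k)%N && (k != B :> nat)) W1 k = R.
  by apply: eq_bigr => k /andP[]; apply: h1.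
have -> : \prod_(k < D | (1 < k)%N && (k != B :> nat)) W2 k = R.
  by apply: eq_bigr => k /andP[]; apply: h2.
by rewrite mulrDl !mulrA.
Qed.

(** With [acoef_swp_ge] this provides the two coefficient conditions required by [exchange_sum] on
    the orbit of nu. *)
Lemma acoef_swp_gt nu mu : (0 < mu b < mu a)%N -> (nu b < nu a)%N ->
  acoef (s nu) (s mu) = acoef nu mu + (t - 1) * acoef (s nu) mu.
Proof.
move=> /andP[mb ba] lt.
have [n1|n1] := boolP (no1 nu); last by rewrite !acoef_no1 ?no1_swp // mulr0 addr0.
have [h|h] := boolP (mu a < nu a)%N.
  have h1 : (mu b < nu a)%N by lia.
  rewrite (@acoef_eq0 _ _ b) ?swpR ?h ?(leq_ltn_trans _ ba) //.
  rewrite (@acoef_eq0 nu mu a) ?h ?(leq_ltn_trans _ ba) //.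
  by rewrite (@acoef_eq0 (s nu) mu b) ?swpR ?mb // mulr0 addr0.
have [h2|h2] := boolP (mu b < nu b)%N.
  have h1 : (mu b < nu a)%N by lia.
  rewrite (@acoef_eq0 _ _ a) ?swpL ?mb //.
  rewrite (@acoef_eq0 nu mu b) ?mb //.
  by rewrite (@acoef_eq0 (s nu) mu b) ?swpR ?mb // mulr0 addr0.
have [_ bD] := lt_bnd nu mu a.
have B1 : (1 < mu a < bnd nu mu)%N by rewrite bD (leq_ltn_trans mb).
have E1 := @acoefE nu mu (bnd nu mu) erefl n1.
have E2 : acoef (s nu) mu = prodl (bnd nu mu) (Wlab (s nu) mu).
  by apply: acoefE; rewrite ?no1_swp // /bnd mdeg_swp.
have E3 : acoef (s nu) (s mu) = prodl (bnd nu mu) (Wlab (s nu) (s mu)).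
  by apply: acoefE; rewrite ?no1_swp // /bnd !mdeg_swp.
have [hc|hc] := ltnP (mu b) (nu a).
  rewrite (@acoef_eq0 (s nu) mu b) ?swpR ?mb ?hc // mulr0 addr0 E1 E3.
  have [eB|neB] := eqVneq (nu a) (mu a).
    by apply: eq_prodl => k k1; apply: Wlab_swp; lia.
  (* [V] lies between the two products. At label mu_i an unpicked ball produces one factor t, at
     label nu_i a strand passing over a smaller ball produces another, and the two cancel. *)
  pose V k := if k == mu a then t * Wlab nu mu k else Wlab nu mu k.
  have V1 : prodl (bnd nu mu) V = t * prodl (bnd nu mu) (Wlab nu mu).
    by apply: (prodl_scale B1) => [k _ /negbTE kB|]; rewrite /V ?kB ?eqxx.
  have X1 : (1 < nu a < bnd nu mu)%N by rewrite (leq_ltn_trans mb hc) (lt_bnd nu mu a).1.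
  have V2 : prodl (bnd nu mu) V = t * prodl (bnd nu mu) (Wlab (s nu) (s mu)).
    apply: (prodl_scale X1) => [k k1 kx|]; rewrite /V.
      case: eqP => [->|/eqP kB]; last by apply/esym/Wlab_swp; lia.
      rewrite Wlab_nu; last by lia.
      by rewrite Wlab_unpicked ?mb ?ba //; lia.
    rewrite (negbTE neB); apply: Wlab_over => //; lia.
  apply: (mulfI tpar_neq0); rewrite -V2; exact: V1.
have SB : Wlab (s nu) (s mu) (mu a) = t * Wlab nu mu (mu a).
  rewrite Wlab_nu; last by lia.
  by rewrite Wlab_unpicked ?mb ?ba //; lia.
have S2B : Wlab (s nu) mu (mu a) = Wlab nu mu (mu a) by apply: Wlab_nu; lia.
(* If nu_i < mu_(i+1), the relation reduces to t A = A + (t - 1) A. Equality is the case that needs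
   the three-term relation, at label mu_(i+1). *)
have [ec|nec] := eqVneq (nu a) (mu b); last first.
  have P2 : acoef (s nu) mu = acoef nu mu.
    rewrite E1 E2; apply: eq_prodl => k k1.
    have [kb|kb] := leqP (mu b) k; first by apply: Wlab_nu; lia.
    rewrite -(@Wlab_mu (s nu) mu); [apply: Wlab_swp|..]; lia.
  have P3 : acoef (s nu) (s mu) = t * acoef nu mu.
    by rewrite E1 E3; apply: (prodl_scale B1) => // k k1 kB; apply: Wlab_swp; lia.
  by rewrite P2 P3; move: (acoef nu mu) => A; ring.
pose V k := if k == mu a then Wlab nu mu k else Wlab (s nu) (s mu) k.
have V1 : prodl (bnd nu mu) (Wlab (s nu) (s mu)) = t * prodl (bnd nu mu) V.
  apply: (prodl_scale B1) => [k _ /negbTE kB|]; rewrite /V ?kB ?eqxx //.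
case: (ltngtP (mu b) 1) => [|c1|c1]; first by lia.
  have C1 : (1 < mu b < bnd nu mu)%N by rewrite c1 (lt_bnd nu mu b).2.
  have L : prodl (bnd nu mu) (Wlab nu mu) =
      t * prodl (bnd nu mu) V + (1 - t) * prodl (bnd nu mu) (Wlab (s nu) mu).
    apply: (prodl_linear C1) => [k k1 kc|k k1 kc|]; rewrite /V.
    - by case: eqP => // /eqP kB; apply: Wlab_swp; lia.
    - have [kb|kb] := leqP (mu b) k; first by apply: Wlab_nu; lia.
      rewrite -(@Wlab_mu (s nu) mu); [apply: Wlab_swp|..]; lia.
    - rewrite (ltn_eqF ba); apply: Wlab_special => //; lia.
  by rewrite E1 E2 E3 V1 L; move: (prodl _ _) (prodl _ _) => A B; ring.
(* Here mu_(i+1) = 1 would give nu_i = 1, which is forbidden in the top row. *)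
have := forallP n1 a; rewrite ec c1 //.
Qed.

(** A bottom ball moves into an empty column; the extra term matches the summand (1 - t) f of
    [Top_mulXL]. *)
Lemma acoef_swp_zero_gt nu mu : (0 < mu a)%N -> mu b = 0%N -> (nu b < nu a)%N ->
  acoef nu (s mu) = t * acoef (s nu) mu + (1 - t) * acoef nu mu.
Proof.
move=> ma mb lt.
have [n1|n1] := boolP (no1 nu); last by rewrite !acoef_no1 ?no1_swp // !mulr0 addr0.
have [h|h] := boolP (mu a < nu b)%N.
  have h1 : (mu a < nu a)%N by lia.
  rewrite (@acoef_eq0 _ _ b) ?swpR ?ma //.
  rewrite (@acoef_eq0 nu mu a) ?ma //.
  by rewrite (@acoef_eq0 (s nu) mu a) ?swpL ?ma // !mulr0 addr0.
have E1 := @acoefE nu mu (bnd nu mu) erefl n1.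
have E2 : acoef (s nu) mu = prodl (bnd nu mu) (Wlab (s nu) mu).
  by apply: acoefE; rewrite ?no1_swp // /bnd mdeg_swp.
have E3 : acoef nu (s mu) = prodl (bnd nu mu) (Wlab nu (s mu)).
  by apply: acoefE; rewrite // /bnd mdeg_swp.
have [hx|hx] := ltnP (mu a) (nu a).
  rewrite (@acoef_eq0 nu mu a) ?ma ?hx // mulr0 addr0 E2 E3.
  apply: (prodl_scale (B := nu a)) => [|k k1 kx|].
  - by rewrite (leq_ltn_trans ma hx) (lt_bnd nu mu a).1.
  - by rewrite -{1}(swpK i nu); apply: Wlab_swp; rewrite ?swpL ?swpR; lia.
  - by rewrite (@Wlab_over nu (s mu) (nu a)) ?swpK ?swpL ?swpR //; lia.
have NW k : (1 < k)%N -> k != mu a \/ (nu a < mu a)%N -> Wlab nu mu k = Wlab nu (s mu) k.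
  move=> k1 hk; have [kb|kb] := ltnP k (mu a); first by apply/esym/Wlab_mu; lia.
  by rewrite -(@Wlab_swp nu mu k) ?(@Wlab_nu nu (s mu) k) //; lia.
have [eB|neB] := eqVneq (nu a) (mu a); last first.
  have -> : acoef (s nu) mu = acoef nu (s mu).
    by rewrite E2 E3; apply: eq_prodl => k k1; rewrite -{2}(swpK i nu); apply/esym/Wlab_swp; rewrite ?swpL ?swpR; lia.
  have -> : acoef nu mu = acoef nu (s mu).
    by rewrite E1 E3; apply: eq_prodl => k k1; apply: NW => //; lia.
  by move: (acoef _ _) => A; ring.
have B1 : (1 < mu a < bnd nu mu)%N.
  have := forallP n1 a; rewrite eB (lt_bnd nu mu a).2 andbT; lia.
rewrite E1 E2 E3; apply: (prodl_linear B1) => [k k1 kB|k k1 kB|].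
- by rewrite -{2}(swpK i nu); apply/esym/Wlab_swp; rewrite ?swpL ?swpR; lia.
- by apply: NW => //; left.
rewrite (@Wlab_special nu (s mu) (mu a)) ?swpL ?swpR //; try lia.
by rewrite swpK (@Wlab_swp nu mu) //; lia.
Qed.

End Exchange.

(** On an orbit of two elements T acts by the matrix of a Hecke generator, and comparing the
    coefficients of F x and F (s x) gives precisely the two conditions on b. *)
Lemma exchange_sum (I : finType) (K : fieldType) (V : lmodType K) (t : K) (s : I -> I)
    (P gt : pred I) (F : I -> V) (T : V -> V) (a b : I -> K) :
  involutive s -> (forall x, P (s x) = P x) ->
  (forall x, gt x -> ~~ gt (s x)) -> (forall x, ~~ gt x -> ~~ gt (s x) -> s x = x) ->
  (forall x, P x -> gt x -> T (F x) = F (s x)) ->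
  (forall x, P x -> gt x -> T (F (s x)) = (t - 1) *: F (s x) + t *: F x) ->
  (forall x, P x -> s x = x -> T (F x) = t *: F x) ->
  (forall x, P x -> gt x -> b x = t * a (s x) /\ b (s x) = a x + (t - 1) * a (s x)) ->
  (forall x, P x -> s x = x -> b x = t * a x) ->
  \sum_(x | P x) a x *: T (F x) = \sum_(x | P x) b x *: F x.
Proof.
move=> sK Ps g1 g2 T1 T2 T3 H1 H2.
have split3 (G : I -> V) : \sum_(x | P x) G x =
    \sum_(x | P x && gt x) (G x + G (s x)) + \sum_(x | P x && (~~ gt x && ~~ gt (s x))) G x.
  rewrite (bigID gt) (bigID (fun x => gt (s x)) (fun x => P x && ~~ gt x)) /= addrA; congr (_ + _); last first.
    by apply: eq_bigl => x; rewrite andbA.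
  rewrite big_split; congr (_ + _); rewrite (reindex_inj (inv_inj sK)) /=.
  apply: eq_bigl => x; rewrite Ps sK; case: (P x) => //=.
  by case gx: (gt x); rewrite ?andbT ?andbF // g1.
rewrite !split3; congr (_ + _).
  apply: eq_bigr => x /andP[Px gx]; rewrite T1 // T2 // !(H1 x Px gx).1 !(H1 x Px gx).2.
  rewrite scalerDr !scalerA addrA -scalerDl addrC [t * _]mulrC [(t - 1) * _]mulrC.
  by [].
apply: eq_bigr => x /andP[Px /andP[h1 h2]]; have e := g2 x h1 h2.
by rewrite T3 // H2 // scalerA mulrC.
Qed.

Section RotateQueues.
Variable m : nat.
Implicit Types (nu mu : 'X_{1..m.+1}) (k : nat).

Lemma Jset_rotm nu k : Jset (rotm nu) k = @ordS m.+1 @: Jset nu k.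
Proof. by apply/setP => j; rewrite -(ord_predK j) mem_ordS !inE rotmE. Qed.

Lemma Fset_rotm nu k : Fset (rotm nu) k = @ordS m.+1 @: Fset nu k.
Proof. by apply/setP => j; rewrite -(ord_predK j) mem_ordS !inE rotmE. Qed.

Lemma no1_rotm nu : no1 (rotm nu) = no1 nu.
Proof.
apply/forallP/forallP => h j; first by have := h (ordS j); rewrite rotmE.
by rewrite -(ord_predK j) rotmE.
Qed.

Lemma prod_label_power (q : Kqt) (x D : nat) : (x < D)%N ->
  \prod_(k < D | (1 < k)%N) (q ^+ k.-1) ^+ (x == k :> nat) = q ^+ x.-1.
Proof.
move=> xD; have [x1|x1] := leqP x 1.
  rewrite big1 => [|k k1]; first by case: x x1 {xD} => [|[|]].
  by rewrite (ltn_eqF (leq_ltn_trans x1 k1)).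
rewrite (bigD1 (Ordinal xD)) //= eqxx expr1 big1 ?mulr1 // => k /andP[_ ne].
by rewrite eq_sym (negbTE ne : (k == x :> nat) = false).
Qed.

(** Only the labels in the last column matter: a strand from the top ball there stops wrapping and a
    strand to the bottom ball there starts to. The predecessor gives exponent 0 for the parts 0 and
    1, which carry no strand. *)
Lemma acoef_rotm nu mu :
  qpar ^+ (nu ord_max).-1 * acoef (rotm nu) (rotm mu) = qpar ^+ (mu ord_max).-1 * acoef nu mu.
Proof.
have [n1|n1] := boolP (no1 nu); last by rewrite !acoef_no1 ?no1_rotm ?mulr0.
rewrite (@acoefE _ nu mu (bnd nu mu)) // (@acoefE _ _ _ (bnd nu mu)) ?no1_rotm //; last first.
  by rewrite /bnd !mdeg_rotm.
rewrite -(@prod_label_power _ _ _ (lt_bnd nu mu ord_max).1).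
rewrite -(@prod_label_power _ _ _ (lt_bnd nu mu ord_max).2) -!big_split /=.
apply: eq_bigr => k k1; rewrite /Wlab !Jset_rotm Fset_rotm.
have := @Wset_ordS m Kqt tpar (qpar ^+ k.-1) (Jset nu k) (Fset mu k) (Jset mu k) (sub_JF mu (ltnW k1)).
by rewrite !inE.
Qed.

End RotateQueues.

(** * The homogeneous queue polynomials *)

Section QueueFamily.
Variable n : nat.
Local Notation P := {mpoly Kqt[n]}.
Implicit Types (mu nu : 'X_{1..n}) (i : 'I_n.-1) (f g : P).

Definition suppm mu : 'X_{1..n} := [multinom (mu i != 0%N : nat) | i < n].

Definition Asum (F : 'X_{1..n} -> P) (D : nat) mu : P :=
  \sum_(nu : 'X_{1..n < D}) acoef nu mu *: F (mminus nu).

(* d is fuel: all d at least as large as the parts of mu give the same polynomial. *)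
Fixpoint Ffam (d : nat) mu : P :=
  if d is d'.+1 then 'X_[suppm mu] * Asum (Ffam d') (mdeg mu).+1 mu
  else if mu == 0%MM then 1 else 0.

Lemma Asum_no1 (F : 'X_{1..n} -> P) (D : nat) mu :
  Asum F D mu = \sum_(nu : 'X_{1..n < D} | no1 nu) acoef nu mu *: F (mminus nu).
Proof.
rewrite /Asum (bigID (fun nu : 'X_{1..n < D} => no1 nu)) /= [X in _ + X]big1 ?addr0 // => nu h.
by rewrite acoef_no1 // scale0r.
Qed.

Lemma mminus_swp i nu : mminus (swp i nu) = swp i (mminus nu).
Proof. by apply/mnmP => j; rewrite !(mnmE, swpE). Qed.

Lemma suppm_swp i nu : suppm (swp i nu) = swp i (suppm nu).
Proof. by apply/mnmP => j; rewrite !(mnmE, swpE). Qed.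

Lemma bswp_subproof i D (nu : 'X_{1..n < D}) : (mdeg (swp i nu) < D)%N.
Proof. by rewrite mdeg_swp bmdeg. Qed.
Definition bswp i D (nu : 'X_{1..n < D}) : 'X_{1..n < D} := BMultinom (bswp_subproof i nu).

Lemma bswpK i D : involutive (@bswp i D).
Proof. by move=> nu; apply: val_inj; exact: swpK. Qed.

Section Exchange.
Variable F : 'X_{1..n} -> P.
Variable i : 'I_n.-1.
Hypothesis F_desc : forall ka : 'X_{1..n}, (ka (adjR i) < ka (adjL i))%N -> Top i (F ka) = F (swp i ka).
Hypothesis F_eq : forall ka : 'X_{1..n}, ka (adjL i) = ka (adjR i) -> Top i (F ka) = tpar *: F ka.

Lemma Top_Asum D mu (B : 'X_{1..n} -> Kqt) :
  (forall nu, (nu (adjR i) < nu (adjL i))%N ->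
     B nu = tpar * acoef (swp i nu) mu /\
     B (swp i nu) = acoef nu mu + (tpar - 1) * acoef (swp i nu) mu) ->
  (forall nu, swp i nu = nu -> B nu = tpar * acoef nu mu) ->
  Top i (Asum F D mu) = \sum_(nu : 'X_{1..n < D} | no1 nu) B nu *: F (mminus nu).
Proof.
move=> B1 B2; rewrite Asum_no1 Top_sum.
rewrite -(@exchange_sum _ _ _ tpar (@bswp i D) (fun nu : 'X_{1..n < D} => no1 nu)
  (fun nu : 'X_{1..n < D} => (nu (adjR i) < nu (adjL i))%N)
  (fun nu : 'X_{1..n < D} => F (mminus nu)) (Top i) (fun nu : 'X_{1..n < D} => acoef nu mu)).
- by apply: eq_bigr => nu _; exact: TopZ.
- exact: bswpK.
- by move=> nu; exact: no1_swp.
- by move=> nu h; rewrite /= swpL swpR -leqNgt ltnW.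
- move=> nu; rewrite /= swpL swpR -!leqNgt => h1 h2; apply: val_inj; apply: swp_id.
  by apply/eqP; rewrite eqn_leq h1 h2.
- move=> nu /forallP n1 h; rewrite F_desc ?mminus_swp // !mnmE; have := n1 (adjL i).
  move: h; move: (nu _) (nu _) => x y; lia.
- move=> nu /forallP n1 h; rewrite /= mminus_swp -F_desc ?Top_quadratic //.
  rewrite !mnmE; have := n1 (adjL i); move: h; move: (nu _) (nu _) => x y; lia.
- move=> nu _ /(congr1 val) /= h; apply: F_eq; rewrite !mnmE.
  by rewrite -[in LHS]h swpL.
- by move=> nu _ h; exact: (B1 nu h).
- by move=> nu _ /(congr1 val) h; apply: (B2 nu h).
Qed.

Lemma Top_Asum_eq D mu : mu (adjL i) = mu (adjR i) -> Top i (Asum F D mu) = tpar *: Asum F D mu.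
Proof.
move=> e; rewrite (@Top_Asum D mu (fun nu => tpar * acoef nu mu)) => [|nu _|//].
  by rewrite Asum_no1 scaler_sumr; apply: eq_bigr => nu _; rewrite scalerA.
rewrite acoef_swp_eq //; split=> //; ring.
Qed.

Lemma Top_Asum_pos D mu : (0 < mu (adjR i) < mu (adjL i))%N ->
  Top i (Asum F D mu) = Asum F D (swp i mu).
Proof.
move=> h; rewrite (@Top_Asum D mu (fun nu => acoef nu (swp i mu))) ?Asum_no1 // => nu g.
  by split; [apply: acoef_swp_ge (ltnW g) | apply: acoef_swp_gt g].
by rewrite acoef_swp_ge // -1?[in LHS]g ?swpR ?g // -[in X in (_ <= X)%N]g swpL.
Qed.

Lemma Top_Asum_zero D mu : (0 < mu (adjL i))%N -> mu (adjR i) = 0%N ->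
  Top i (Asum F D mu) + (1 - tpar) *: Asum F D mu = Asum F D (swp i mu).
Proof.
move=> h h0; rewrite (@Top_Asum D mu (fun nu => acoef nu (swp i mu) - (1 - tpar) * acoef nu mu)).
- rewrite !Asum_no1 scaler_sumr -big_split; apply: eq_bigr => nu _ /=.
  by rewrite scalerBl scalerA addrNK.
- move=> nu g; rewrite acoef_swp_zero_gt // -acoef_swp_zero ?(ltnW g) //.
  by split; ring.
- move=> nu g; have -> : acoef nu (swp i mu) = acoef nu mu.
    rewrite -[in LHS]g -acoef_swp_zero //; by rewrite -[in X in (_ <= X)%N]g swpL.
  ring.
Qed.

End Exchange.

Lemma spolyXm i nu : spoly i 'X_[nu] = 'X_[swp i nu] :> P.
Proof.
exact: (msymX _ nu (sadj i)).
Qed.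

(** The monomial x^(supp mu) passes through T_i unless exactly one of the two parts is 0. In that
    case x_i becomes x_(i+1) by [Top_mulXL], and T_i + 1 - t acts on the queue sum. *)
Lemma Ffam_Top d i mu :
  ((mu (adjR i) < mu (adjL i))%N -> Top i (Ffam d mu) = Ffam d (swp i mu)) /\
  (mu (adjL i) = mu (adjR i) -> Top i (Ffam d mu) = tpar *: Ffam d mu).
Proof.
elim: d mu => [|d IH] mu.
  split=> [h|e] /=.
    have -> : (mu == 0%MM) = false by apply/eqP => e; rewrite e !mnmE in h.
    have -> : (swp i mu == 0%MM) = false; last exact: Top0.
    by apply/eqP => /(congr1 (fun u : 'X_{1..n} => u (adjR i))); rewrite swpR !mnmE => e; rewrite e in h.
  case: ifP => _; last by rewrite Top0 scaler0.
  exact: (Top_sym (spoly1 i)).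
have Fd ka := (IH ka).1; have Fe ka := (IH ka).2.
have Xs nu : (suppm nu (adjL i) = suppm nu (adjR i)) -> spoly i 'X_[suppm nu] = 'X_[suppm nu] :> P.
  by move=> h; rewrite spolyXm swp_id.
split=> h; rewrite /Ffam -/Ffam; last first.
  rewrite Top_mul_sym; last by apply: Xs; rewrite !mnmE h.
  by rewrite (Top_Asum_eq Fd Fe _ h) -scalerAr.
rewrite mdeg_swp; have [z|nz] := posnP (mu (adjR i)); last first.
  rewrite Top_mul_sym; last by apply: Xs; rewrite !mnmE; move: h nz; move: (mu _) (mu _) => x y; lia.
  rewrite (Top_Asum_pos Fd Fe); last by rewrite nz.
  by rewrite suppm_swp (@swp_id _ i (suppm mu)) // !mnmE; move: h nz; move: (mu _) (mu _) => x y; lia.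
have hp : (0 < mu (adjL i))%N by rewrite (leq_ltn_trans _ h).
rewrite -(Top_Asum_zero Fd Fe) //.
(* The common part of the supports of mu and s_i mu; it is zero in both exchanged columns, hence
   symmetric. *)
pose g := [multinom (if (j == adjL i) then 0 else suppm mu j)%N | j < n].
have e1 : suppm mu = (U_(adjL i) + g)%MM.
  apply/mnmP => j; rewrite !mnmE [adjL i == j]eq_sym.
  by case: (j =P adjL i) => [->|//]; rewrite -lt0n hp.
have e2 : suppm (swp i mu) = (U_(adjR i) + g)%MM.
  apply/mnmP => j; rewrite suppm_swp swpE !mnmE [adjR i == j]eq_sym.
  have [->|n1] := j =P adjL i; first by rewrite sadjL z (negbTE (adj_neq i)).
  have [->|n2] := j =P adjR i; first by rewrite sadjR z -lt0n hp.
  by rewrite tpermD // eq_sym; apply/eqP.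
have gs : spoly i 'X_[g] = 'X_[g] :> P.
  rewrite spolyXm swp_id // !mnmE eqxx; case: eqP => // _; by rewrite z.
rewrite e1 e2 !mpolyXD -!mulrA Top_mulXL; apply: f_equal2 => //.
rewrite Top_mul_sym //; move: ('X_[g]) (Asum _ _ _) => G A.
by rewrite mulrDr scalerAr.
Qed.

End QueueFamily.

Lemma cross_div (K : fieldType) (a b x y : K) : a != 0 -> b != 0 -> a * y = b * x ->
  x * a^-1 = b^-1 * y.
Proof. by move=> a0 b0 e; rewrite mulrC; apply: (mulfI a0); rewrite mulVKf // mulrCA e mulKf. Qed.

Section RotateFamily.
Variable m : nat.
Implicit Types (nu mu : 'X_{1..m.+1}).

Lemma mminus_rotm nu : mminus (rotm nu) = rotm (mminus nu).
Proof. by apply/mnmP => j; rewrite !mnmE. Qed.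

Lemma suppm_rotm nu : suppm (rotm nu) = rotm (suppm nu).
Proof. by apply/mnmP => j; rewrite !mnmE. Qed.

Lemma brotm_subproof D (nu : 'X_{1..m.+1 < D}) : (mdeg (rotm nu) < D)%N.
Proof. by rewrite mdeg_rotm bmdeg. Qed.
Definition brotm D (nu : 'X_{1..m.+1 < D}) : 'X_{1..m.+1 < D} := BMultinom (brotm_subproof nu).

Lemma brotm_inj D : injective (@brotm D).
Proof. by move=> x y /(congr1 val) /= /rotm_inj /val_inj. Qed.

(** If the last part is nonzero, one factor 1/q comes from the support monomial and the others from
    [acoef_rotm]. *)
Lemma Omega_Ffam d mu : Omega (Ffam d mu) = qpar ^- (mu ord_max) *: Ffam d (rotm mu).
Proof.
elim: d mu => [|d IH] mu.
  rewrite /=; have -> : (rotm mu == 0%MM) = (mu == 0%MM).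
    by rewrite -!mdeg_eq0 mdeg_rotm.
  case: eqP => [->|_]; last by rewrite Omega0 scaler0.
  by rewrite mnm0E expr0 invr1 scale1r; exact: Omega1.
rewrite /Ffam -/Ffam mdeg_rotm OmegaM OmegaXm -suppm_rotm.
have -> : Omega (Asum (Ffam d) (mdeg mu).+1 mu) =
    qpar ^- (mu ord_max).-1 *: Asum (Ffam d) (mdeg mu).+1 (rotm mu).
  rewrite /Asum Omega_sum [in RHS](reindex_inj (@brotm_inj _)) scaler_sumr; apply: eq_bigr => nu _ /=.
  rewrite OmegaZ IH !scalerA mminus_rotm; congr (_ *: _).
  apply: cross_div; [exact: expf_neq0 qpar_neq0 | exact: expf_neq0 qpar_neq0 |].
  by have := acoef_rotm nu mu; rewrite mnmE.
rewrite -scalerAl -scalerAr scalerA; congr (_ *: _); rewrite mnmE.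
case: (mu ord_max) => [|k]; first by rewrite expr0 invr1 mulr1.
by rewrite expr1 -invfM exprS.
Qed.

End RotateFamily.

(** * Homogeneity and leading coefficients of the queue polynomials *)

Section QueueFamilyCoefficients.
Variable n : nat.
Local Notation P := {mpoly Kqt[n]}.
Implicit Types (mu nu u v : 'X_{1..n}) (f g : P).

Lemma acoef_neq0_adm nu mu : acoef nu mu != 0 -> tlq_adm nu mu.
Proof.
by apply: contraR => h; apply/eqP; apply: big1 => pi; rewrite /inQ (negbTE h).
Qed.

(** Both rows carry the same multiset of labels above 1, and h ignores the others. It is used for
    the predecessor, its square and the indicator of large parts. *)
Lemma tlq_adm_sum nu mu (h : nat -> nat) : h 0%N = 0%N -> h 1%N = 0%N -> tlq_adm nu mu ->
  \sum_i h (nu i) = \sum_i h (mu i).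
Proof.
move=> h0 h1 /and3P[_ /(perm_big _) /= e _].
have S (ka : 'X_{1..n}) : (\sum_i h (ka i) =
    \sum_(x <- [seq ka i | i <- enum 'I_n & (1 < ka i)%N]) h x)%N.
  rewrite big_map big_filter big_enum_cond [LHS](bigID (fun i => 1 < ka i)%N) /= [X in (_ + X)%N]big1 ?addn0 //.
  by move=> i; case: (ka i) => [|[|]].
by rewrite !S e.
Qed.

Lemma mdeg_mminus nu mu : tlq_adm nu mu -> mdeg (mminus nu) = mdeg (mminus mu).
Proof.
move=> /(@tlq_adm_sum _ _ predn erefl erefl) e; rewrite !mdegE.
by under eq_bigr do rewrite mnmE; rewrite e; apply: eq_bigr => i _; rewrite mnmE.
Qed.

Lemma mdeg_suppm mu : (mdeg (suppm mu) + mdeg (mminus mu))%N = mdeg mu.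
Proof.
rewrite -mdegD; congr mdeg; apply/mnmP => i; rewrite !mnmE.
by case: (mu i).
Qed.

Lemma Ffam_homog d mu : Ffam d mu \is (mdeg mu).-homog.
Proof.
elim: d mu => [|d IH] mu /=.
  case: eqP => [->|_]; last exact: dhomog0.
  by rewrite mdeg0; exact: dhomog1.
rewrite -{2}(mdeg_suppm mu) dhomogM ?dhomogX ?eqxx //.
apply: rpred_sum => nu _; have [->|/acoef_neq0_adm h] := eqVneq (acoef nu mu) 0.
  by rewrite scale0r; exact: dhomog0.
by apply: dhomogZ; rewrite -(mdeg_mminus h).
Qed.

Lemma msize_homog d f : f \is d.-homog -> (msize f <= d.+1)%N.
Proof.
move=> /dhomogP h; rewrite msizeE; apply/bigmax_leqP_seq => u uf _.
by rewrite (h u uf).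
Qed.

Lemma substqX u : substq 'X_[u] = qpar ^- mdeg u *: 'X_[u] :> P.
Proof.
rewrite /substq comp_mpolyX; under eq_bigr do rewrite tnth_mktuple exprZn.
rewrite scaler_prod -mpolyXE_id; congr (_ *: _).
by rewrite mdegE -prodrXr; under eq_bigr do rewrite exprVn; rewrite prodfV.
Qed.

Lemma substq_homog d f : f \is d.-homog -> substq f = qpar ^- d *: f.
Proof.
move=> /dhomogP h; rewrite [in LHS](mpolyE f) /substq linear_sum {3}(mpolyE f) scaler_sumr /=.
rewrite [LHS]big_seq [RHS]big_seq; apply: eq_bigr => u uf.
rewrite comp_mpolyZ -[_ \mPo _]/(substq _) substqX !scalerA (h u uf).
by rewrite mulrC.
Qed.

Lemma mcoeffXM_add u v f : ('X_[u] * f)@_(u + v)%MM = f@_v.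
Proof. by rewrite mulrC mcoeffMX. Qed.

Lemma mcoeffXM_nle u v f : ~~ (u <= v)%MM -> ('X_[u] * f)@_v = 0.
Proof.
move=> h; rewrite [f]mpolyE mulr_sumr raddf_sum big1 // => w _ /=.
rewrite -scalerAr -mpolyXD mcoeffZ mcoeffX; case: eqP => [e|_]; last by rewrite mulr0.
by case/negP: h; rewrite -e lem_addr.
Qed.

(** The only composition without parts 1 whose [mminus] is that of mu; its only queue over mu has
    all pairings trivial. *)
Definition trunc1 mu : 'X_{1..n} := [multinom (if mu i == 1%N then 0%N else mu i) | i < n].

Lemma acoef_trunc1 mu : acoef (trunc1 mu) mu = 1.
Proof.
have adm : tlq_adm (trunc1 mu) mu.
  apply/and3P; split; first by apply/forallP => i; rewrite mnmE; case: ifP => [//|->].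
    have -> : [seq i <- enum 'I_n | (1 < trunc1 mu i)%N] = [seq i <- enum 'I_n | (1 < mu i)%N].
      by apply: eq_filter => i; rewrite mnmE; case: eqP => [->|].
    apply/seq.permP => p; congr (count p _); apply/eq_in_map => i; rewrite mem_filter mnmE => /andP[h _].
    by case: eqP h => [->|].
  by apply/forallP => i; rewrite mnmE; case: ifP; rewrite ?leqnn orbT.
rewrite /acoef (big_pred1 [ffun j => j]) => [|pi].
  by rewrite big1 // => j; rewrite ffunE eqxx andbF.
apply/idP/eqP => [/and4P[_ /forallP h1 _ /forallP h2]|->].
  apply/ffunP => j; rewrite ffunE; have := h1 j; have := h2 j; rewrite mnmE.
  by case: (mu j == 1%N) => /=; [move=> _ /eqP | case: (0 < mu j)%N; rewrite ?eqxx //= => /eqP // _ /eqP].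
apply/and4P; split=> //.
- by apply/forallP => j; rewrite ffunE mnmE eqxx; case: (mu j == 1%N); rewrite ?eqxx ?if_same.
- by apply/forallP => j; apply/forallP => k; rewrite !ffunE; apply/implyP => /and3P[].
- by apply/forallP => j; rewrite ffunE eqxx implybT.
Qed.

Definition sqm mu := (\sum_i mu i ^ 2)%N.

Lemma eq_of_leq_sum (f g : 'I_n -> nat) :
  (forall i, f i <= g i)%N -> (\sum_i g i <= \sum_i f i)%N -> forall i, f i = g i.
Proof.
move=> h e i; have := leqif_sum (fun i (_ : predT i) => leqif_geq (h i)) => /eq_leqif E.
have : \sum_i f i == \sum_i g i by rewrite eqn_leq e andbT; apply: leq_sum.
by rewrite E => /forallP /(_ i) /= hi; apply/eqP; rewrite eqn_leq h.
Qed.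

Lemma sqmD mu u : sqm (mu + u)%MM = (sqm mu + sqm u + 2 * \sum_i mu i * u i)%N.
Proof.
rewrite /sqm big_distrr -!big_split; apply: eq_bigr => i _ /=.
by rewrite mnmE sqrnD.
Qed.

Lemma suppm_mminus mu : (suppm mu + mminus mu)%MM = mu.
Proof. by apply/mnmP => i; rewrite !mnmE; case: (mu i). Qed.

Lemma suppm_mul_mminus mu : (\sum_i suppm mu i * mminus mu i)%N = mdeg (mminus mu).
Proof. by rewrite mdegE; apply: eq_bigr => i _; rewrite !mnmE; case: (mu i) => // k; rewrite mul1n. Qed.

Lemma suppm_mul_le mu u : (\sum_i suppm mu i * u i <= mdeg u)%N.
Proof. by rewrite mdegE; apply: leq_sum => i _; rewrite mnmE; case: (_ != _); rewrite ?mul1n ?mul0n. Qed.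

(* The sum of the squares of the exponents orders the monomials: prepending supp mu raises it
   most when nu^- is supported on supp mu, and then nu^- = mu^-. *)
Lemma Ffam_coef d mu u : (forall i, mu i <= d)%N -> (sqm mu <= sqm u)%N ->
  (Ffam d mu)@_u = (u == mu)%:R.
Proof.
elim: d mu u => [|d IH] mu u hd hN.
  have -> : mu = 0%MM by apply/mnmP => i; apply/eqP; rewrite mnm0E -leqn0.
  by rewrite /= eqxx mcoeff1.
have [hu|hu] := eqVneq (mdeg u) (mdeg mu); last first.
  have /negbTE -> : u != mu by apply: contraNneq hu => ->.
  exact: (dhomog_nemf_coeff (Ffam_homog d.+1 mu) hu).
rewrite /Ffam -/Ffam; have [su|su] := boolP (suppm mu <= u)%MM; last first.
  have /negbTE -> : u != mu.
    by apply: contraNneq su => ->; rewrite -[X in (_ <= X)%MM](suppm_mminus mu) lem_addr.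
  exact: (mcoeffXM_nle _ su).
have [v eu] : exists v, u = (suppm mu + v)%MM by exists (u - suppm mu)%MM; rewrite addmC submK.
rewrite {su}eu in hN hu *; rewrite mcoeffXM_add.
have uv : ((suppm mu + v)%MM == mu) = (v == mminus mu).
  by rewrite -{2}(suppm_mminus mu) (inj_eq (@addmI _ _)).
have dv : mdeg v = mdeg (mminus mu).
  by move: hu; rewrite mdegD -{2}(suppm_mminus mu) mdegD; apply: addnI.
(* The cross term, the sum of v over supp mu, is at most |v| = |mu^-|, and mu^- attains this bound.
   Hence mu^- has the smaller square sum, and equality forces v to be supported on supp mu. *)
have [hN1 hN2] : (sqm (mminus mu) <= sqm v)%N /\ (sqm v = sqm (mminus mu) ->
    forall i, suppm mu i * v i = v i)%N.
  have := suppm_mul_le mu v; move: hN.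
  rewrite -{1}(suppm_mminus mu) !sqmD suppm_mul_mminus dv => hN hl; split; first by lia.
  move=> e; apply: eq_of_leq_sum => [i|].
    by rewrite mnmE; case: (_ != _); rewrite ?mul1n ?mul0n.
  by rewrite -mdegE dv; lia.
have term (nu : 'X_{1..n}) : acoef nu mu * (Ffam d (mminus nu))@_v =
    ((nu == trunc1 mu) && (v == mminus mu))%:R.
  have [a0|an0] := eqVneq (acoef nu mu) 0.
    rewrite a0 mul0r; case: eqP a0 => // ->; rewrite acoef_trunc1 => /eqP.
    by rewrite (negbTE (oner_neq0 _)).
  have adm := acoef_neq0_adm an0.
  have hd' i : (mminus nu i <= d)%N.
    have := @tlq_adm_sum nu mu (fun x => (d.+1 < x)%N : nat) erefl erefl adm.
    rewrite [X in _ = X]big1 => [/eqP|j _]; last by rewrite ltnNge hd.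
    rewrite sum_nat_eq0 => /forallP /(_ i); rewrite /= eqb0 -leqNgt mnmE.
    by case: (nu i).
  have sqn : sqm (mminus nu) = sqm (mminus mu).
    have := @tlq_adm_sum nu mu (fun x => x.-1 ^ 2)%N erefl erefl adm.
    by rewrite /sqm => e; under eq_bigr do rewrite mnmE; rewrite e; under [RHS]eq_bigr do rewrite mnmE.
  rewrite IH ?sqn //; have [ev|nv] := eqVneq v (mminus nu); last first.
    rewrite mulr0; case: (nu =P trunc1 mu) nv => // -> /= nv.
    suff e : mminus (trunc1 mu) = mminus mu by rewrite -e (negbTE nv).
    by apply/mnmP => i; rewrite !mnmE; case: eqP => [->|].
  have sv i : (suppm mu i * v i = v i)%N by apply: hN2; rewrite ev sqn.
  have [/forallP n1 _ /forallP le] := and3P adm.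
  (* Off supp mu the exponents nu^- = v vanish, and on it nu is at most mu; equal degrees then leave
     only equality. *)
  have em i : mminus nu i = mminus mu i.
    apply: eq_of_leq_sum i => [i|]; last by rewrite -!mdegE (mdeg_mminus adm).
    have := sv i; rewrite ev !mnmE; case/orP: (le i) => [/eqP ->|h _]; last by rewrite -!subn1 leq_sub2r.
    by rewrite mul0n => <-.
  have e1 : nu = trunc1 mu.
    apply/mnmP => i; have := em i; have := n1 i; have := sv i; rewrite ev !mnmE.
    by case: (nu i) => [|[|x]]; case: (mu i) => [|[|y]] //=; lia.
  have -> : v == mminus mu by rewrite ev; apply/eqP/mnmP.
  by rewrite e1 acoef_trunc1 eqxx mulr1.
rewrite uv /Asum raddf_sum /=; under eq_bigr do rewrite mcoeffZ term.
have ht : (mdeg (trunc1 mu) < (mdeg mu).+1)%N.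
  by rewrite ltnS !mdegE; apply: leq_sum => i _; rewrite mnmE; case: ifP.
rewrite (bigD1 (BMultinom ht)) //= eqxx big1 ?addr0 // => nu ne.
by have -> : (bmnm nu == trunc1 mu) = false by apply: negbTE ne.
Qed.

End QueueFamilyCoefficients.

Definition noninc (n : nat) (la : 'X_{1..n}) :=
  forall i j : 'I_n, (i <= j)%N -> (la j <= la i)%N.

(** * Cherednik equations for the queue polynomials *)

Section Eigenfunction.
Variable m : nat.
Local Notation P := {mpoly Kqt[m.+1]}.
Local Notation Top := (@Top m.+1).
Local Notation adjL := (@adjL m.+1).
Local Notation adjR := (@adjR m.+1).
Local Notation swp := (@swp m.+1).
Implicit Types (mu nu ka la : 'X_{1..m.+1}) (i j : 'I_m) (f g p : P).

Definition swpn (k : nat) ka : 'X_{1..m.+1} := oapp (fun i : 'I_m => swp i ka) ka (insub k).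
Definition swpw (w : seq nat) ka := foldr swpn ka w.

Lemma swpnE i ka : swpn i ka = swp i ka.
Proof. by rewrite /swpn valK. Qed.

Lemma inord_adjL i : inord i = adjL i.
Proof. by apply: val_inj; rewrite /= inordK // ltnS ltnW. Qed.
Lemma inord_adjR i : inord i.+1 = adjR i.
Proof. by apply: val_inj; rewrite /= inordK // ltnS. Qed.

Lemma swpn_inord k l ka : (k < m)%N -> (l <= m)%N ->
  swpn k ka (inord l) = ka (inord (if l == k then k.+1 else if l == k.+1 then k else l)).
Proof.
move=> km lm; rewrite -[k]/(val (Ordinal km)) swpnE.
have [->|n1] := eqVneq l (Ordinal km); first by rewrite inord_adjL swpL inord_adjR.
have [->|n2] := eqVneq l (Ordinal km).+1; first by rewrite inord_adjR swpR inord_adjL.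
rewrite swpE tpermD //.
  by rewrite -inord_adjL -val_eqE /= !inordK // 1?eq_sym // ltnW.
by rewrite -inord_adjR -val_eqE /= !inordK // 1?eq_sym.
Qed.

(** The effect on compositions of the words in [hi] and [lo]: part k travels to the last column,
    respectively to the first. *)
Definition hiC k ka := swpw (rev (iota k (m - k))) ka.
Definition loC k ka := swpw (iota 0 k) ka.

Lemma hiC_S k ka : (k < m)%N -> hiC k ka = hiC k.+1 (swpn k ka).
Proof.
by move=> km; rewrite /hiC -(subnSK km) /= rev_cons -cats1 /swpw foldr_cat.
Qed.

Lemma loC_S k ka : loC k.+1 ka = loC k (swpn k ka).
Proof. by rewrite /loC -(addn1 k) iotaD cats1 /swpw foldr_rcons. Qed.

Lemma hiC_inord k l ka : (k <= m)%N -> (l <= m)%N ->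
  hiC k ka (inord l) = ka (inord (if l < k then l else if l < m then l.+1 else k))%N.
Proof.
move=> km lm; have [e le_e] : exists e, (m - k)%N = e by exists (m - k)%N.
elim: e k km ka le_e => [|e IH] k km ka le_e.
  have -> : k = m by lia.
  rewrite /hiC subnn /=; case: ltnP => // h; by have -> : l = m by lia.
have k1 : (k < m)%N by lia.
rewrite hiC_S // IH; [|lia|lia]; rewrite swpn_inord //; last by repeat case: ifP; lia.
congr (ka (inord _)); repeat case: ifP; lia.
Qed.

Lemma loC_inord k l ka : (k <= m)%N -> (l <= m)%N ->
  loC k ka (inord l) = ka (inord (if l == 0 then k else if l <= k then l.-1 else l))%N.
Proof.
move=> + lm; elim: k ka => [|k IH] ka km.
  by congr (ka (inord _)); repeat case: ifP; lia.
rewrite loC_S IH; last lia; rewrite swpn_inord //; last by repeat case: ifP; lia.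
congr (ka (inord _)); repeat case: ifP; lia.
Qed.

Lemma inord_S l : (l < m)%N -> inord l.+1 = ordS (inord l : 'I_m.+1).
Proof.
move=> lm; apply: val_inj; rewrite ordS_val -val_eqE /= !inordK //; last exact: ltnW.
by rewrite (ltn_eqF lm).
Qed.

Lemma rotm_hiC k ka : (k <= m)%N -> rotm (hiC k ka) = loC k ka.
Proof.
move=> km; apply/mnmP => i; rewrite -(inord_val i); have := ltn_ord i.
move: (val i) => {i} [|l] lm; rewrite loC_inord //.
  have -> : inord 0 = ordS (ord_max : 'I_m.+1) by apply: val_inj; rewrite ordS_val eqxx /= inordK.
  rewrite rotmE; have -> : ord_max = inord m :> 'I_m.+1 by apply: val_inj; rewrite /= inordK.
  by rewrite hiC_inord // ltnNge km ltnn.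
rewrite inord_S // rotmE hiC_inord //; last exact: ltnW.
congr (ka (inord _)); repeat case: ifP; lia.
Qed.

Lemma Tn_Ffam d k ka : (k < m)%N -> (ka (inord k.+1) <= ka (inord k))%N ->
  exists a, Tn k (Ffam d ka) = tpar ^+ a *: Ffam d (swpn k ka).
Proof.
move=> km; rewrite -[k]/(val (Ordinal km)) TnE swpnE inord_adjL inord_adjR leq_eqVlt.
have [T1 T2] := @Ffam_Top m.+1 d (Ordinal km) ka.
case/orP => [/eqP e|h]; last by exists 0%N; rewrite scale1r; exact: T1.
by exists 1%N; rewrite swp_id //; exact: T2.
Qed.

(** Part k moves right past parts that are not larger, so each T meets a descent or a tie; a tie
    costs a factor t. *)
Lemma hi_Ffam d k ka : (k <= m)%N -> (forall l, k < l <= m -> ka (inord l) <= ka (inord k))%N ->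
  exists a, hi k (Ffam d ka) = tpar ^+ a *: Ffam d (hiC k ka).
Proof.
move=> km; have [e le_e] : exists e, (m - k)%N = e by exists (m - k)%N.
elim: e k km ka le_e => [|e IH] k km ka le_e h.
  exists 0%N; have -> : k = m by lia.
  by rewrite scale1r /hi /hiC subnn.
have k1 : (k < m)%N by lia.
have [a Ha] := @Tn_Ffam d k ka k1 (h k.+1 ltac:(lia)).
have h' l : (k.+1 < l <= m)%N -> (swpn k ka (inord l) <= swpn k ka (inord k.+1))%N.
  move=> hl; rewrite !swpn_inord //; try lia.
  have -> : (l == k) = false by lia.
  have -> : (l == k.+1) = false by lia.
  have -> : (k.+1 == k) = false by lia.
  by rewrite eqxx; apply: h; lia.
have [b Hb] := IH k.+1 k1 (swpn k ka) ltac:(lia) h'.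
exists (a + b)%N; rewrite hi_S // Ha hiZ hiC_S // Hb scalerA exprD; reflexivity.
Qed.

Lemma lo_Ffam d k ka : (k <= m)%N -> (forall l, l < k -> ka (inord k) <= ka (inord l))%N ->
  exists a, lo k (Ffam d ka) = tpar ^+ a *: Ffam d (loC k ka).
Proof.
elim: k ka => [|k IH] ka km h; first by exists 0%N; rewrite scale1r.
have [a Ha] := @Tn_Ffam d k ka km (h k ltac:(lia)).
have h' l : (l < k)%N -> (swpn k ka (inord k) <= swpn k ka (inord l))%N.
  move=> hl; rewrite !swpn_inord //; try lia.
  have -> : (l == k) = false by lia.
  have -> : (l == k.+1) = false by lia.
  by rewrite eqxx; apply: h; lia.
have [b Hb] := IH (swpn k ka) ltac:(lia) h'.
exists (a + b)%N; rewrite lo_S // Ha loZ loC_S // Hb scalerA exprD; reflexivity.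
Qed.

Lemma noninc_inord la k l : noninc la -> (k <= l <= m)%N -> (la (inord l) <= la (inord k))%N.
Proof. by move=> h kl; apply: h; rewrite !inordK //; lia. Qed.

(** For nonincreasing parts both words meet only descents and ties, and rotation takes the end of
    the first path to the end of the second. Only the exponent of q is recorded. *)
Lemma Ffam_eigen d la k : noninc la -> (k <= m)%N ->
  exists a b, Omega (hi k (Ffam d la)) =
    (qpar ^- la (inord k) * (tpar ^+ a / tpar ^+ b)) *: lo k (Ffam d la).
Proof.
move=> nla km.
have h1 l : (k < l <= m)%N -> (la (inord l) <= la (inord k))%N.
  by move=> h; apply: noninc_inord nla _; lia.
have h2 l : (l < k)%N -> (la (inord k) <= la (inord l))%N.
  by move=> h; apply: noninc_inord nla _; lia.
have [a Ha] := @hi_Ffam d k la km h1; have [b Hb] := @lo_Ffam d k la km h2.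
exists a, b; rewrite Ha Hb OmegaZ Omega_Ffam rotm_hiC // !scalerA.
have -> : hiC k la ord_max = la (inord k).
  have -> : ord_max = inord m :> 'I_m.+1 by apply: val_inj; rewrite /= inordK.
  by rewrite hiC_inord // ltnNge km ltnn.
congr (_ *: _); rewrite -mulrA divfK ?expf_neq0 ?tpar_neq0 //; exact: mulrC.
Qed.

End Eigenfunction.

Lemma eigen_scalar_cross (F : fieldType) (q q' k e a b : F) :
  q != 0 -> q' != 0 -> k != 0 -> e != 0 -> a != 0 -> b != 0 ->
  k^-1 / (q * e^-1) = q'^-1 * (a / b) -> q' * (e * b) = q * (k * a).
Proof.
move=> q0 q0' k0 e0 a0 b0 h.
have -> : q' * (e * b) = q' * b * (q * k) * (k^-1 / (q * e^-1)) by field; rewrite ?q0 ?k0 ?e0.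
by rewrite h; field; rewrite ?q0' ?b0.
Qed.

Lemma eigen_combination (K : fieldType) (V : lmodType K) (I : finType) (Q : pred I)
    (L l p : I -> V) (c x : I -> K) (g : K) (Lr lr : V) :
  Lr + \sum_(k | Q k) c k *: L k = g *: (lr + \sum_(k | Q k) c k *: l k) ->
  \sum_(k | Q k) (c k * (x k - g)) *: l k =
    - (\sum_(k | Q k) c k *: (L k - x k *: l k)) - (Lr - g *: lr).
Proof.
move=> h; have -> : \sum_(k | Q k) c k *: (L k - x k *: l k) =
    \sum_(k | Q k) c k *: L k - \sum_(k | Q k) (c k * x k) *: l k.
  by rewrite -sumrB; apply: eq_bigr => k _; rewrite scalerBr scalerA.
have -> : \sum_(k | Q k) (c k * (x k - g)) *: l k =
    \sum_(k | Q k) (c k * x k) *: l k - g *: \sum_(k | Q k) c k *: l k.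
  by rewrite scaler_sumr -sumrB; apply: eq_bigr => k _; rewrite mulrBr scalerBl scalerA [g * _]mulrC.
move: h; rewrite scalerDr.
move: (\sum_(k | Q k) (c k * x k) *: l k) (\sum_(k | Q k) c k *: l k) => A B.
move: (\sum_(k | Q k) c k *: L k) (g *: B) (g *: lr) => C v u h.
have -> : C = u + v - Lr by rewrite -h addrC addKr.
by rewrite opprB [- (Lr - u)]opprB [u + v - Lr]addrAC; move: (u - Lr) => w; rewrite opprD addrA addrAC addrNK.
Qed.

(** * Expansion in the interpolation polynomials *)

Section Spectral.
Variable m : nat.
Local Notation P := {mpoly Kqt[m.+1]}.
Implicit Types (mu nu ka la : 'X_{1..m.+1}) (f g p : P).

Variable Pf : 'X_{1..m.+1} -> P.
Hypothesis PfP : forall nu, isP nu (Pf nu).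

Lemma meval_layer d (c : 'X_{1..m.+1} -> Kqt) nu : (mdeg nu <= d)%N ->
  (\sum_(ka : 'X_{1..m.+1 < d.+1} | mdeg ka == d) c ka *: Pf ka).@[spec nu] =
  if mdeg nu == d then c nu * (Pf nu).@[spec nu] else 0.
Proof.
move=> nd; rewrite raddf_sum /=.
have z (ka : 'X_{1..m.+1 < d.+1}) : mdeg ka == d -> bmnm ka != nu ->
    (c ka *: Pf ka).@[spec nu] = 0.
  move=> /eqP e ne; rewrite mevalZ; have [_ _ ->] := PfP ka; rewrite ?mulr0 ?e //.
  by rewrite eq_sym.
case: ifP => [/eqP e|ne]; last first.
  by apply: big1 => ka kd; apply: z => //; apply/eqP => ek; rewrite -ek kd in ne.
have hn : (mdeg nu < d.+1)%N by rewrite e.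
rewrite (bigD1 (BMultinom hn)) /=; last by apply/eqP.
by rewrite mevalZ big1 ?addr0 // => ka /andP[k1 k2]; apply: z.
Qed.

(** The polynomials of a new degree layer correct the values there without disturbing those at
    smaller degree. *)
Lemma interpolation d (g : 'X_{1..m.+1} -> Kqt) :
  exists2 r : P, (msize r <= d)%N & forall nu, (mdeg nu < d)%N -> r.@[spec nu] = g nu.
Proof.
elim: d => [|d [r r1 r2]]; first by exists 0; rewrite ?msize0.
pose c ka := (g ka - r.@[spec ka]) / (Pf ka).@[spec ka].
exists (r + \sum_(ka : 'X_{1..m.+1 < d.+1} | mdeg ka == d) c ka *: Pf ka).
  apply: msizeD_leq; first exact: leqW.
  apply: msize_sum_leq => ka /eqP kd; apply: msizeZ_leq.
  by have [+ _ _] := PfP ka; rewrite kd.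
move=> nu nd; rewrite mevalD meval_layer //; case: eqP => [_|ne].
  by have [_ n0 _] := PfP nu; rewrite /c divfK // addrC subrK.
by rewrite addr0 r2 // ltn_neqAle; apply/andP; split; [apply/eqP | exact: nd].
Qed.

(** After subtracting an interpolant of lower degree, f vanishes at all smaller spectral vectors,
    and the layer of degree d matches its remaining values. *)
Lemma msize_span d f : (msize f <= d.+1)%N ->
  exists c : 'X_{1..m.+1} -> Kqt, (msize (f - \sum_(ka : 'X_{1..m.+1 < d.+1} | mdeg ka == d) c ka *: Pf ka) <= d)%N.
Proof.
move=> fd; have [r r1 r2] := interpolation d (fun nu => f.@[spec nu]).
pose c ka := (f - r).@[spec ka] / (Pf ka).@[spec ka]; exists c.
set S := \sum_(_ | _) _; suff -> : f - S = r by [].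
apply/eqP; rewrite subr_eq addrC -subr_eq -subr_eq0; apply/eqP; apply: (@vanish_eq0 m d).
  apply: msizeB_leq; first by apply: msizeB_leq fd (leqW r1).
  apply: msize_sum_leq => ka /eqP kd; apply: msizeZ_leq.
  by have [+ _ _] := PfP ka; rewrite kd.
move=> nu nd; rewrite mevalB meval_layer //; case: eqP => [_|ne].
  by have [_ n0 _] := PfP nu; rewrite /c divfK // subrr.
by rewrite subr0 mevalB r2 ?subrr // ltn_neqAle nd andbT; apply/eqP.
Qed.

Lemma eigen_scalar_neq la ka (k : 'I_m.+1) a b : ka k != la k ->
  tpar ^- k / spec ka k - qpar ^- la k * (tpar ^+ a / tpar ^+ b) != 0.
Proof.
apply: contraNneq => /eqP; rewrite subr_eq0 => /eqP h.
have q0 e : qpar ^+ e != 0 by exact: expf_neq0 qpar_neq0.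
have t0 e : tpar ^+ e != 0 by exact: expf_neq0 tpar_neq0.
have := eigen_scalar_cross (q0 _) (q0 _) (t0 _) (t0 _) (t0 _) (t0 _) h.
by rewrite -!exprD => /qt_monomial_inj [->].
Qed.

(* The exponents of q in the eigenvalues of P_ka recover ka. *)
Lemma eigen_top la f : (msize f <= (mdeg la).+1)%N ->
  (forall k, (k <= m)%N -> exists a b, Omega (hi k f) =
    (qpar ^- la (inord k) * (tpar ^+ a / tpar ^+ b)) *: lo k f) ->
  exists c, (msize (f - c *: Pf la) <= mdeg la)%N.
Proof.
move=> fd H; have [c] := msize_span fd; set d := mdeg la; set S := \sum_(_ | _) _ => Sd.
suff c0 ka : mdeg ka = d -> ka != la -> c ka = 0.
  exists (c la); suff <- : S = c la *: Pf la by [].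
  rewrite /S (bigD1 (BMultinom (ltnSn d))) /= ?eqxx // big1 ?addr0 // => ka /andP[/eqP k1 k2].
  by rewrite c0 ?scale0r.
move=> kd ne; have [k kk] : exists k, ka k != la k.
  apply/existsP; apply: contraNT ne; rewrite negb_exists => /forallP h.
  by apply/eqP/mnmP => k; apply/eqP; have := h k; rewrite negbK.
have km : (k <= m)%N by rewrite -ltnS.
have [a [b]] := H k km; rewrite inord_val; set ga := _ * _ => He.
pose x nu := tpar ^- k / spec nu k.
(* The expansion of f with each coefficient multiplied by the difference of eigenvalues. The two
   eigenvector equations make [lo k G] of lower degree, and [lo k] is invertible without raising
   degrees. *)
pose G := \sum_(nu : 'X_{1..m.+1 < d.+1} | mdeg nu == d) (c nu * (x nu - ga)) *: Pf nu.
have Gd : (msize G <= d)%N.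
  apply: (@msize_Tw_inj m (iota 0 k)); rewrite Tw_sum.
  under eq_bigr do rewrite TwZ.
  rewrite (@eigen_combination Kqt P _ (fun nu : 'X_{1..m.+1 < d.+1} => mdeg nu == d)
    (fun nu : 'X_{1..m.+1 < d.+1} => Omega (hi k (Pf nu))) (fun nu : 'X_{1..m.+1 < d.+1} => lo k (Pf nu)) (fun nu : 'X_{1..m.+1 < d.+1} => Pf nu)
    (fun nu : 'X_{1..m.+1 < d.+1} => c nu) (fun nu : 'X_{1..m.+1 < d.+1} => x nu) ga (Omega (hi k (f - S))) (lo k (f - S))).
    apply: msizeB_leq.
      rewrite -scaleN1r; apply: msizeZ_leq; apply: msize_sum_leq => nu /eqP nd; apply: msizeZ_leq.
      have := Knop_eigen km (PfP nu); rewrite inord_val nd; exact.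
    apply: msizeB_leq; first exact: msize_Omega (msize_Tw _ Sd).
    exact: msizeZ_leq (msize_Tw _ Sd).
  have e1 : Omega (hi k (f - S)) + Omega (hi k S) = Omega (hi k f).
    by rewrite -OmegaD -hiD subrK.
  have e2 : lo k (f - S) + lo k S = lo k f by rewrite -loD subrK.
  have e3 : Omega (hi k S) = \sum_(nu : 'X_{1..m.+1 < d.+1} | mdeg nu == d) c nu *: Omega (hi k (Pf nu)).
    rewrite /S [hi k _]Tw_sum Omega_sum; apply: eq_bigr => nu _.
    by rewrite -[Tw _ _]/(hi k _) hiZ OmegaZ.
  have e4 : lo k S = \sum_(nu : 'X_{1..m.+1 < d.+1} | mdeg nu == d) c nu *: lo k (Pf nu).
    rewrite /S [lo k _]Tw_sum; apply: eq_bigr => nu _; exact: TwZ.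
  by rewrite -e3 -e4 e1 e2.
have G0 : G = 0.
  apply: Van_eq0 Gd; apply: Van_sum => nu /eqP nd; apply: VanZ.
  have := Van_isP (PfP nu); rewrite nd; exact.
have := meval_layer (fun nu => c nu * (x nu - ga)) (eq_leq kd).
rewrite -/G G0 meval0 kd eqxx => /esym /eqP.
have [_ n0 _] := PfP ka.
rewrite mulf_eq0 (negbTE n0) orbF mulf_eq0.
have /negbTE -> := eigen_scalar_neq a b kk; by rewrite orbF => /eqP.
Qed.

End Spectral.

(** * Reduced words and the polynomials f* *)

Section Words.
Variable n : nat.
Local Notation P := {mpoly Kqt[n]}.
Implicit Types (mu nu ka la : 'X_{1..n}) (i : 'I_n.-1) (s : 'S_n) (w : seq 'I_n.-1) (f g p : P).

Lemma pactM s s' mu : pact s (pact s' mu) = pact (s' * s)%g mu.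
Proof. by apply/mnmP => j; rewrite !mnmE invMg permM. Qed.

Lemma pact1 mu : pact 1%g mu = mu.
Proof. by apply/mnmP => j; rewrite mnmE invg1 perm1. Qed.

Lemma pact_cons i w mu : pact (wperm (i :: w)) mu = swp i (pact (wperm w) mu).
Proof. by rewrite [RHS]pactM. Qed.

(** Inversions are counted against the nonincreasing order, so partitions have none. *)
Definition invs mu : {set 'I_n * 'I_n} := [set p : 'I_n * 'I_n | (p.1 < p.2)%N && (mu p.1 < mu p.2)%N].
Definition inv mu := #|invs mu|.

Lemma inv_swp i mu : (mu (adjL i) < mu (adjR i))%N -> inv mu = (inv (swp i mu)).+1.
Proof.
move=> h; pose sp (p : 'I_n * 'I_n) := (sadj i p.1, sadj i p.2).
have sK : involutive sp by move=> [j k]; rewrite /sp /= !sadjK.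
have h0 : (adjL i, adjR i) \in invs mu by rewrite inE /= h ltnS leqnn.
rewrite /inv (cardsD1 (adjL i, adjR i)) h0 add1n; congr _.+1.
rewrite -(card_imset _ (inv_inj sK)); apply: eq_card => p.
rewrite -{1}(sK p) mem_imset ?inE; last exact: inv_inj sK.
case: p => j k; rewrite /= !swpE.
have [e|ne] := boolP (((j == adjL i) && (k == adjR i)) || ((j == adjR i) && (k == adjL i))).
  case/orP: e => /andP[/eqP -> /eqP ->]; rewrite ?sadjL ?sadjR.
    by rewrite [(mu (adjR i) < _)%N]ltnNge (ltnW h) !andbF.
  by rewrite /sp /= sadjL sadjR eqxx /= ltnNge leqnSn.
rewrite sadj_lt //; have -> : (sp (j, k) != (adjL i, adjR i)) = true; last by [].
apply: contraNneq ne => /(congr1 sp); rewrite sK /sp /= sadjL sadjR => -[-> ->].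
by rewrite !eqxx orbT.
Qed.

Lemma inv_swp_cases i mu :
  (inv (swp i mu) <= (inv mu).+1)%N /\
  ((inv mu < inv (swp i mu))%N -> (mu (adjR i) < mu (adjL i))%N).
Proof.
case: (ltngtP (mu (adjL i)) (mu (adjR i))) => h.
- have -> := inv_swp h; split; lia.
- have := @inv_swp i (swp i mu); rewrite swpL swpR swpK => -> //.
- by rewrite swp_id //; split; lia.
Qed.

Lemma inv_noninc la : noninc la -> inv la = 0%N.
Proof.
move=> h; apply: eq_card0 => -[j k]; rewrite inE /=; apply/andP => -[jk].
by rewrite ltnNge h // ltnW.
Qed.

Lemma inv_word la w : noninc la -> (inv (pact (wperm w) la) <= size w)%N.
Proof.
move=> h; elim: w => [|i w IH]; first by rewrite pact1 inv_noninc.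
rewrite pact_cons; exact: leq_trans (inv_swp_cases _ _).1 _.
Qed.

Lemma noninc_adj mu : (forall i, mu (adjR i) <= mu (adjL i))%N -> noninc mu.
Proof.
move=> h i [j jn] /= ij; elim: j jn ij => [|j IH] jn ij.
  have -> : Ordinal jn = i by apply: val_inj; rewrite /=; lia.
  exact: leqnn.
have [e|ne] := eqVneq (i : nat) j.+1.
  by have -> : Ordinal jn = i by apply: val_inj.
have jn1 : (j < n.-1)%N by lia.
have jn' : (j < n)%N by lia.
apply: leq_trans (IH jn' _); last by lia.
have := h (Ordinal jn1); have -> : adjL (Ordinal jn1) = Ordinal jn' by apply: val_inj.
by have -> : adjR (Ordinal jn1) = Ordinal jn by apply: val_inj.
Qed.

(** A swap at an ascent removes exactly one inversion, so sorting takes [inv mu] letters. *)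
Lemma bubble_sort mu : exists w la, [/\ noninc la, mu = pact (wperm w) la & size w = inv mu].
Proof.
have [e le_e] : exists e, inv mu = e by exists (inv mu).
elim: e mu le_e => [|e IH] mu he.
  exists [::], mu; rewrite pact1 he; split=> //; apply: noninc_adj => i; rewrite leqNgt.
  by apply/negP => /inv_swp; rewrite he.
have [/forallP h|] := boolP [forall i, (mu (adjR i) <= mu (adjL i))%N].
  by rewrite (inv_noninc (noninc_adj h)) in he.
rewrite negb_forall => /existsP[i]; rewrite -ltnNge => h.
have hi := inv_swp h; rewrite he in hi.
have [w [la [h1 h2 h3]]] := IH (swp i mu) (esym (succn_inj hi)).
by exists (i :: w), la; split=> //; [rewrite pact_cons -h2 swpK | rewrite /= h3 he -(succn_inj hi)].
Qed.

Lemma noninc_uniq la la' s : noninc la -> noninc la' -> la' = pact s la -> la = la'.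
Proof.
move=> h h' e.
have srt (ka : 'X_{1..n}) : noninc ka -> sorted geq [seq ka j | j <- enum 'I_n].
  move=> hk; rewrite sorted_map; apply: (@sub_sorted _ (relpre val ltn)) => [i j /=|].
    by move=> ij; apply: hk (ltnW ij).
  by rewrite -sorted_map val_enum_ord iota_ltn_sorted.
have pe : perm_eq [seq la j | j <- enum 'I_n] [seq la' j | j <- enum 'I_n].
  have -> : [seq la' j | j <- enum 'I_n] = [seq la j | j <- [seq (s^-1)%g j | j <- enum 'I_n]].
    by rewrite -[RHS]map_comp; apply: eq_map => j; rewrite e mnmE.
  apply: perm_map; apply: uniq_perm; rewrite ?enum_uniq ?(map_inj_uniq (@perm_inj _ _)) ?enum_uniq //.
  move=> i; rewrite mem_enum; apply/esym/mapP; exists (s i); rewrite ?mem_enum //.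
  by rewrite permK.
have geq_tr : transitive geq by move=> x y z /= h1 h2; exact: leq_trans h2 h1.
have geq_as : antisymmetric geq by move=> x y h1; apply: anti_leq; rewrite andbC.
have /eq_in_map em := sorted_eq geq_tr geq_as (srt _ h) (srt _ h') pe.
by apply/mnmP => i; apply: em; rewrite mem_enum.
Qed.

(** Its parts are distinct and decreasing, so permutations act on it faithfully and the length of s
    is the number of inversions of its image. Facts about reduced words thus follow from sorting
    compositions. *)
Definition stair : 'X_{1..n} := [multinom (n - i)%N | i < n].

Lemma stair_lt (i j : 'I_n) : (stair i < stair j)%N = (j < i)%N.
Proof. rewrite !mnmE; have := ltn_ord i; have := ltn_ord j; lia. Qed.

Lemma noninc_stair : noninc stair.
Proof. by move=> i j ij; rewrite leqNgt stair_lt -leqNgt. Qed.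

Lemma plen_stair s : plen s = inv (pact s stair).
Proof.
rewrite /plen /inv; pose sp (p : 'I_n * 'I_n) := (s p.2, s p.1).
have sp_inj : injective sp by move=> [a b] [c d] [/perm_inj -> /perm_inj ->].
rewrite -(card_imset _ sp_inj); apply: eq_card => -[j k].
have -> : (j, k) = sp ((s^-1)%g k, (s^-1)%g j) by rewrite /sp /= !permKV.
rewrite mem_imset // !inE /= !permKV andbC; congr (_ && _).
by have := stair_lt ((s^-1)%g j) ((s^-1)%g k); rewrite !mnmE => ->.
Qed.

Lemma reduced_word s : exists w, wperm w = s /\ size w = plen s.
Proof.
have [w [la [h1 h2 h3]]] := bubble_sort (pact s stair).
exists w; rewrite plen_stair; split=> //.
have e : la = stair.
  apply: (@noninc_uniq _ _ (wperm w * s^-1)%g h1 noninc_stair).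
  by rewrite -pactM -h2 pactM mulgV pact1.
apply/invg_inj/permP => j; move/mnmP: h2 => /(_ j); rewrite e !mnmE => hj.
move: hj; move: ((s^-1)%g j) ((wperm w)^-1%g j) => x y hj.
by apply: val_inj; move: hj (ltn_ord x) (ltn_ord y) => /=; lia.
Qed.

Lemma sortpartP mu : (exists s, pact s (sortpart mu) = mu) /\ noninc (sortpart mu).
Proof.
apply: (@epsilon_spec _ _ (fun la : 'X_{1..n} => (exists s, pact s la = mu) /\ noninc la)).
have [w [la [h1 h2 _]]] := bubble_sort mu; exists la; split=> //; by exists (wperm w).
Qed.

Lemma sigmamuP mu : pact (sigmamu mu) (sortpart mu) = mu /\
  forall s', pact s' (sortpart mu) = mu -> (plen (sigmamu mu) <= plen s')%N.
Proof.
apply: (@epsilon_spec _ _ (fun s => pact s (sortpart mu) = mu /\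
  forall s', pact s' (sortpart mu) = mu -> (plen s <= plen s')%N)).
have [[s hs] _] := sortpartP mu.
have [s' /eqP h1 h2] := @arg_minnP _ s (fun s => pact s (sortpart mu) == mu) (@plen n) (introT eqP hs).
by exists s'; split=> // s'' /eqP; exact: h2.
Qed.

(** A letter raises [inv] by at most one, and [inv] starts at 0; a word no longer than the final
    [inv] must raise it at every letter. *)
Lemma foldr_Top_ind (R : 'X_{1..n} -> P -> Prop) la f w : noninc la -> R la f ->
  (forall i ka g, (ka (adjR i) < ka (adjL i))%N -> R ka g -> R (swp i ka) (Top i g)) ->
  (size w <= inv (pact (wperm w) la))%N ->
  R (pact (wperm w) la) (foldr (fun i g => Top i g) f w).
Proof.
move=> h R0 RS; elim: w => [|i w IH]; first by rewrite pact1.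
rewrite pact_cons /= => hw; have [h1 h2] := inv_swp_cases i (pact (wperm w) la).
have h3 := inv_word w h.
apply: RS; first by apply: h2; exact: leq_ltn_trans h3 hw.
by apply: IH; rewrite -ltnS; exact: leq_trans hw h1.
Qed.

(* A reduced word of sigma_mu has as many letters as mu has inversions, so every letter swaps
   a descent. *)
Lemma fstar_ind (R : 'X_{1..n} -> P -> Prop) mu :
  (forall la, noninc la -> (exists s, pact s la = mu) -> R la (Estar la)) ->
  (forall i ka g, (ka (adjR i) < ka (adjL i))%N -> R ka g -> R (swp i ka) (Top i g)) ->
  R mu (fstar mu).
Proof.
move=> R0 RS; rewrite /fstar /Tperm; set w := epsilon _ _.
have [w1 w2] : wperm w = sigmamu mu /\ size w = plen (sigmamu mu).
  exact: (epsilon_spec _ _ (reduced_word (sigmamu mu))).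
have [p1 p2] := sortpartP mu; have [s1 s2] := sigmamuP mu.
rewrite -{1}s1 -w1; apply: foldr_Top_ind => //; first exact: R0.
rewrite w1 s1 w2; have [v [la [h1 h2 h3]]] := bubble_sort mu.
have e : sortpart mu = la.
  have [s hs] := p1.
  by apply: (@noninc_uniq _ _ (s * (wperm v)^-1)%g p2 h1); rewrite -pactM hs h2 pactM mulgV pact1.
apply: leq_trans (s2 (wperm v) _) _; first by rewrite e -h2.
by rewrite plen_stair -h3; apply: inv_word; exact: noninc_stair.
Qed.

End Words.

(** * Top homogeneous parts of E* and f*, and roots under [Omega] *)

Section StarPolynomials.
Variable m : nat.
Local Notation P := {mpoly Kqt[m.+1]}.
Local Notation Top := (@Top m.+1).
Local Notation spoly := (@spoly m.+1).
Local Notation adjL := (@adjL m.+1).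
Local Notation adjR := (@adjR m.+1).
Local Notation swp := (@swp m.+1).
Local Notation linf := (linf m).
Implicit Types (mu nu ka la : 'X_{1..m.+1}) (i : 'I_m) (f g h p : P).

Lemma mcoeff_msize d p mu : (msize p <= d)%N -> (d <= mdeg mu)%N -> p@_mu = 0.
Proof. by move=> h1 h2; apply/memN_msupp_eq0/msize_mdeg_ge; exact: leq_trans h1 h2. Qed.

Lemma isP_scale mu p p' : isP mu p -> isP mu p' -> exists c, p' = c *: p.
Proof.
move=> [s n0 z] [s' n0' z']; exists (p'.@[spec mu] / p.@[spec mu]).
apply/eqP; rewrite -subr_eq0; apply/eqP; apply: (@vanish_eq0 m (mdeg mu)).
  by apply: msizeB_leq => //; apply: msizeZ_leq.
move=> nu nd; rewrite mevalB mevalZ; have [->|ne] := eqVneq nu mu.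
  by rewrite (divfK n0) subrr.
by rewrite (z _ nd ne) (z' _ nd ne) mulr0 subrr.
Qed.

(** If p also vanished at its own spectral vector it would be 0, against its coefficient 1. *)
Lemma IsEstar_isP mu p : IsEstar mu p -> isP mu p.
Proof.
move=> [s c z]; split=> //; apply/eqP => p0.
have e : p = 0.
  apply: (vanish_eq0 s) => nu nd; have [->|ne] := eqVneq nu mu; [exact: p0 | exact: z].
by move: c; rewrite e mcoeff0 => /esym /eqP; rewrite (negbTE (oner_neq0 _)).
Qed.

(** F_la has coefficient 1 at x^la and differs from a multiple of P_la by lower degree, so x^la
    occurs in P_la and P_la can be normalised to E*_la. *)
Lemma Estar_top la : noninc la ->
  isP la (Estar la) /\
  (forall D, (forall j, la j <= D)%N -> (msize (Ffam D la - Estar la) <= mdeg la)%N).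
Proof.
move=> nla; pose Pf nu : P := epsilon (inhabits 0) (isP nu).
have PfP nu : isP nu (Pf nu) := epsilon_spec _ _ (isP_exists nu).
have key D : (forall j, la j <= D)%N -> exists c, (msize (Ffam D la - c *: Pf la) <= mdeg la)%N /\
    c * (Pf la)@_la = 1.
  move=> hD; have [|c hc] := eigen_top PfP (msize_homog (Ffam_homog D la)).
    by move=> k km; exact: Ffam_eigen.
  exists c; split=> //; have := mcoeff_msize hc (leqnn _).
  rewrite mcoeffB mcoeffZ (Ffam_coef hD (leqnn _)) eqxx => /eqP; by rewrite subr_eq0 => /eqP <-.
have [c0 [_ hc0]] := key (mdeg la) (fun j => mnm_le_mdeg la j).
have HE : IsEstar la (Estar la).
  apply: epsilon_spec; exists (c0 *: Pf la); have [s n0 z] := PfP la.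
  split; [exact: msizeZ_leq | by rewrite mcoeffZ | ].
  by move=> nu h1 h2; rewrite mevalZ (z _ h1 h2) mulr0.
have iE := IsEstar_isP HE; split=> // D hD.
have [c [h1 h2]] := key D hD; have [e He] := isP_scale (PfP la) iE.
(* For every D the scalar is the inverse of the same coefficient of P_la, hence the scalar of
   E*_la. *)
suff -> : Estar la = c *: Pf la by [].
have [_ E1 _] := HE; rewrite He mcoeffZ in E1; rewrite He; congr (_ *: _).
have n0 : (Pf la)@_la != 0 by apply: contra_eq_neq h2 => ->; rewrite mulr0 eq_sym oner_neq0.
by apply: (mulIf n0); rewrite E1 h2.
Qed.

Lemma fstar_top mu :
  Van (mdeg mu) (fstar mu) /\
  (forall D, (forall j, mu j <= D)%N -> (msize (Ffam D mu - fstar mu) <= mdeg mu)%N).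
Proof.
apply: (@fstar_ind m.+1 (fun ka f => Van (mdeg ka) f /\
  (forall D, (forall j, ka j <= D)%N -> (msize (Ffam D ka - f) <= mdeg ka)%N))) => [la nla _|i ka f h [h1 h2]].
  have [h1 h2] := Estar_top nla; split=> //; exact: Van_isP.
rewrite mdeg_swp; split=> [|D hD]; first exact: Van_Top.
rewrite -((@Ffam_Top m.+1 D i ka).1 h) -TopB; apply: msize_Top; apply: h2 => j.
by have := hD (sadj i j); rewrite swpE sadjK.
Qed.

Lemma Omega_Tw w f : all (fun k => k.+1 < m)%N w ->
  Omega (Tw w f) = Tw [seq k.+1 | k <- w] (Omega f).
Proof.
elim: w => //= k w IH /andP[km hw].
have k1 : (k < m)%N by exact: ltnW.
rewrite -[k]/(val (Ordinal k1)) TnE (Omega_Top (j := Ordinal km)) // IH //.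
by rewrite -[k.+1]/(val (Ordinal km)) TnE.
Qed.

Lemma iter_Omega_Top l i f : (i + l < m)%N ->
  iter l (@Omega m) (Top i f) = Tn (i + l)%N (iter l (@Omega m) f).
Proof.
elim: l => [|l IH] il; first by rewrite /= addn0 TnE.
have h : (i + l < m)%N by lia.
rewrite iterS IH // -[(i + l)%N]/(val (Ordinal h)) TnE.
have h' : (i + l.+1 < m)%N by [].
rewrite (Omega_Top (j := Ordinal h')); last by rewrite /= addnS.
by rewrite -[(i + l.+1)%N]/(val (Ordinal h')) TnE.
Qed.

Lemma iter_Omega_inj l : injective (iter l (@Omega m)).
Proof. by elim: l => [|l IH] x y //= /Omega_inj /IH. Qed.

Lemma iter_OmegaZ l c f : iter l (@Omega m) (c *: f) = c *: iter l (@Omega m) f.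
Proof. by elim: l => //= l ->; rewrite OmegaZ. Qed.

(* Invert Omega repeatedly: if [Omega (T_(m-l-1) .. T_0 h) = t^(m-l) h] then
   [t^(l-m) T_(m-l-1) .. T_0 h] is a preimage of [h], and it satisfies the same relation one
   step further because [T_0 h = t h]. *)
Lemma Omega_root eta p r l : isP eta p -> (r <= m.+1)%N ->
  (forall j : 'I_m.+1, (j < r)%N -> eta j = 0%N) -> (l <= r)%N ->
  exists h, [/\ Van (mdeg eta) h, iter l (@Omega m) h = p &
    (l < r)%N -> Omega (Tw (rev (iota 0 (m - l))) h) = tpar ^+ (m - l) *: h].
Proof.
move=> pP rm z; have t0 : tpar != 0 := tpar_neq0.
elim: l => [|l IH] lr.
  exists p; split=> //; first exact: Van_isP.
  by move=> r0; have := spec0_shift (z ord0 r0) pP; rewrite /hi subn0.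
have [h [h1 h2 h3]] := IH (ltnW lr); have {}h3 := h3 lr.
have [h' O' V'] : exists2 h', Omega h' = h & Van (mdeg eta) h'.
  exists (tpar ^- (m - l) *: Tw (rev (iota 0 (m - l))) h); last by apply: VanZ; exact: Van_Tw.
  rewrite (OmegaZ (tpar ^- (m - l))) h3 scalerA mulVf ?expf_neq0 //; exact: scale1r.
exists h'; split=> //; first by rewrite iterSr O'.
move=> lr'; have ml : (l < m)%N by lia.
have T0 : Tn 0 h = tpar *: h.
  have m0 : (0 < m)%N by lia.
  apply: (@iter_Omega_inj l); rewrite -[0%N]/(val (Ordinal m0)) TnE iter_Omega_Top //.
  rewrite iter_OmegaZ h2 add0n -[l]/(val (Ordinal ml)) TnE; apply: (Top_isP_eq pP).
  by rewrite !z //; apply: leq_trans lr'.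
have [e he] : exists e, (m - l)%N = e.+1 by exists (m - l.+1)%N; lia.
have -> : (m - l.+1)%N = e by lia.
have he1 : rev (iota 0 e.+1) = rcons (rev (iota 1 e)) 0 by rewrite /= rev_cons.
rewrite he he1 Tw_rcons T0 TwZ OmegaZ exprS -scalerA in h3.
have {}h3 := scalerI t0 h3.
apply: Omega_inj; rewrite OmegaZ O' Omega_Tw ?O'; last first.
  by apply/allP => k; rewrite mem_rev mem_iota => hk; lia.
by rewrite map_rev; have <- : iota 1 e = [seq k.+1 | k <- iota 0 e] := iotaDl 1 0 e.
Qed.

End StarPolynomials.

(** * Packed compositions *)

Section PackedFactorization.
Variable m : nat.
Local Notation P := {mpoly Kqt[m.+1]}.
Local Notation Top := (@Top m.+1).
Local Notation spoly := (@spoly m.+1).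
Local Notation adjL := (@adjL m.+1).
Local Notation adjR := (@adjR m.+1).
Local Notation sadj := (@sadj m.+1).
Local Notation swp := (@swp m.+1).
Local Notation linf := (linf m).
Local Notation substq := (@substq m.+1).
Implicit Types (mu nu ka la : 'X_{1..m.+1}) (i : 'I_m) (f g h p : P).

Lemma substqD f g : substq (f + g) = substq f + substq g. Proof. exact: comp_mpolyD. Qed.
Lemma substqB f g : substq (f - g) = substq f - substq g. Proof. exact: comp_mpolyB. Qed.
Lemma substqZ c f : substq (c *: f) = c *: substq f. Proof. exact: comp_mpolyZ. Qed.
Lemma substqM f g : substq (f * g) = substq f * substq g. Proof. exact: rmorphM. Qed.
Lemma substq1 : substq 1 = 1. Proof. exact: comp_mpoly1. Qed.
Lemma substqU (j : 'I_m.+1) : substq 'X_j = qpar^-1 *: 'X_j.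
Proof. by rewrite /Defs.substq comp_mpolyXU -tnth_nth tnth_mktuple. Qed.
Lemma substq_sum (I : Type) (r : seq I) (Q : pred I) (F : I -> P) :
  substq (\sum_(k <- r | Q k) F k) = \sum_(k <- r | Q k) substq (F k).
Proof. exact: raddf_sum. Qed.

Lemma iter_OmegaD l f g : iter l (@Omega m) (f + g) = iter l (@Omega m) f + iter l (@Omega m) g.
Proof. by elim: l => //= l ->; exact: OmegaD. Qed.

Lemma iter_OmegaM l f g : iter l (@Omega m) (f * g) = iter l (@Omega m) f * iter l (@Omega m) g.
Proof. by elim: l => //= l ->; exact: OmegaM. Qed.

Lemma Omega_Xinord k : (k < m)%N -> Omega 'X_(inord k) = 'X_(inord k.+1) :> P.
Proof.
move=> km; rewrite OmegaX -inord_S // -val_eqE /= inordK; last exact: ltnW.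
by rewrite (ltn_eqF km); exact: scale1r.
Qed.

Lemma Omega_Xmax : Omega 'X_ord_max = qpar^-1 *: 'X_ord0 :> P.
Proof.
by rewrite OmegaX eqxx; congr (_ *: 'X_ _); apply: val_inj; rewrite ordS_val eqxx.
Qed.

Lemma iter_OmegaX k l : (k + l <= m)%N -> iter l (@Omega m) 'X_(inord k) = 'X_(inord (k + l)).
Proof.
elim: l => [|l IH] h; first by rewrite addn0.
by rewrite iterS IH 1?ltnW -?addnS // addnS Omega_Xinord // -addnS.
Qed.

Lemma iter_Omega1 l : iter l (@Omega m) 1 = 1.
Proof. by elim: l => //= l ->; exact: Omega1. Qed.

(** In n steps each variable goes once around the circle and collects 1/q exactly once. *)
Lemma iter_Omega_substq f : iter m.+1 (@Omega m) f = substq f.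
Proof.
elim/mpoly_alg_ind: f => [|j|f g|f g|c f].
- by rewrite substq1 iter_Omega1.
- rewrite substqU; have jm : (j <= m)%N by rewrite -ltnS.
  transitivity (iter (j + (1 + (m - j))) (@Omega m) 'X_j).
    by have -> : (j + (1 + (m - j)) = m.+1)%N by lia.
  have := @iter_OmegaX j (m - j); rewrite inord_val subnKC // => /(_ (leqnn _)) E.
  rewrite iterD iterD E.
  have -> : inord m = ord_max :> 'I_m.+1 by apply: val_inj; rewrite /= inordK.
  rewrite /= Omega_Xmax iter_OmegaZ.
  have -> : ord0 = inord 0 :> 'I_m.+1 by apply: val_inj; rewrite /= inordK.
  by rewrite iter_OmegaX ?add0n // inord_val.
- by rewrite iter_OmegaM substqM => -> ->.
- by rewrite iter_OmegaD substqD => -> ->.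
- by rewrite iter_OmegaZ substqZ => ->.
Qed.

Lemma substq_spoly i f : substq (spoly i f) = spoly i (substq f).
Proof.
elim/mpoly_alg_ind: f => [|k|f g|f g|c f].
- by rewrite spoly1 substq1 spoly1.
- by rewrite spolyX !substqU spolyZ spolyX.
- move=> e1 e2; rewrite (@spolyM m.+1 i f g) (substqM (spoly i f)) (substqM f g).
  transitivity (spoly i (substq f) * spoly i (substq g)); last exact/esym/(@spolyM m.+1).
  exact (f_equal2 (fun a b : P => a * b) e1 e2).
- move=> e1 e2; rewrite (@spolyD m.+1 i f g) (substqD (spoly i f)) (substqD f g).
  transitivity (spoly i (substq f) + spoly i (substq g)); last exact/esym/(@spolyD m.+1).
  exact (f_equal2 (fun a b : P => a + b) e1 e2).
- move=> e; rewrite (@spolyZ m.+1 i c f) (substqZ c (spoly i f)) (substqZ c f).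
  transitivity (c *: spoly i (substq f)); last exact/esym/(@spolyZ m.+1).
  exact (f_equal (fun a : P => c *: a) e).
Qed.

Lemma substq_Top i f : substq (Top i f) = Top i (substq f).
Proof.
apply: Top_unique; rewrite -substq_spoly.
apply: (scalerI (invr_neq0 qpar_neq0)).
have := congr1 substq (@TopP m.+1 i f).
rewrite !(substqM, substqB, substqZ, substqU) scalerA [tpar * _]mulrC -scalerA -!scalerBr.
by rewrite -!scalerAl -scalerBr.
Qed.

Lemma isP_iter_up k mu p : isP mu p ->
  isP (iter k (@up m) mu) (iter k (fun f => linf * Omega f) p).
Proof. by move=> pP; elim: k => //= k IH; exact: isP_up. Qed.

Definition prodc k : P := \prod_(0 <= j < k) ('X_(inord j) - (tpar ^- m)%:MP).

(** For k at most m the last variable does not occur in [prodc k], so [Omega] only shifts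
    indices. *)
Lemma prodc_S k : (k <= m)%N -> prodc k.+1 = linf * Omega (prodc k).
Proof.
move=> km; rewrite /prodc big_nat_recl //; congr (_ * _).
  congr ('X_ _ - _); by apply: val_inj; rewrite /= inordK.
elim: k km => [|k IH] km; first by rewrite !big_nil Omega1.
rewrite !big_nat_recr //= IH ?(ltnW km) // OmegaM; congr (_ * _).
rewrite OmegaB Omega_Xinord //; congr (_ - _).
by rewrite -[_%:MP]mulr1 mul_mpolyC OmegaZ Omega1.
Qed.

Lemma iter_linf_Omega k p : (k <= m.+1)%N ->
  iter k (fun f => linf * Omega f) p = prodc k * iter k (@Omega m) p.
Proof.
elim: k => [|k IH] km; first by rewrite /prodc big_nil mul1r.
rewrite iterS (IH (ltnW km)) (OmegaM (prodc k)) mulrA -(prodc_S km) iterS; exact: erefl.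
Qed.

Lemma iter_up_surj k la : (k <= m.+1)%N -> (forall j : 'I_m.+1, (j < k)%N -> la j <> 0%N) ->
  exists2 eta, la = iter k (@up m) eta &
    forall l, (l + k <= m)%N -> eta (inord l) = la (inord (l + k)).
Proof.
move=> + nz; elim: k nz => [|k IH] nz km.
  by exists la => // l; rewrite addn0.
have [v h1 h2] := IH (fun j jk => nz j (ltnW jk)) (ltnW km).
have v0 : v ord0 != 0%N.
  have -> : ord0 = inord 0 :> 'I_m.+1 by apply: val_inj; rewrite /= inordK.
  by rewrite h2 //; apply/eqP/nz; rewrite inordK.
have [u eu] := up_surj v0; exists u; first by rewrite iterSr -eu.
move=> l lk; have lm : (l < m)%N by lia.
have := h2 l.+1 ltac:(lia); rewrite addSnnS => <-.
rewrite inord_S // eu upE -val_eqE /= inordK; last exact: ltnW.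
by rewrite (ltn_eqF lm) addn0.
Qed.

Lemma mdeg_iter_up k mu : mdeg (iter k (@up m) mu) = (mdeg mu + k)%N.
Proof. by elim: k => [|k IH]; rewrite ?addn0 //= mdeg_up IH addnS. Qed.

Definition packed k mu := forall j : 'I_m.+1, (mu j == 0%N) = (k <= j)%N.

(** Undoing [up] k times puts the n - k zeros of la in front, so the polynomial of eta is an (n -
    k)-fold [Omega] image; k further steps complete the full turn x -> x / q. *)
Lemma Estar_factor k la : (k <= m.+1)%N -> noninc la -> packed k la ->
  exists2 h, Van (mdeg la - k) h & Estar la = prodc k * substq h.
Proof.
move=> km nla pk.
have nz (j : 'I_m.+1) : (j < k)%N -> la j <> 0%N by move=> jk; apply/eqP; rewrite pk -ltnNge.
have [eta e1 e2] := iter_up_surj km nz; have [p pP] := isP_exists eta.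
have ez (j : 'I_m.+1) : (j < m.+1 - k)%N -> eta j = 0%N.
  move=> jr; rewrite -(inord_val j) e2; last by lia.
  by apply/eqP; rewrite pk inordK; lia.
have [h [h1 h2 _]] := Omega_root pP (leq_subr k m.+1) ez (leqnn _).
have E : iter k (fun f => linf * Omega f) p = prodc k * substq h.
  rewrite (iter_linf_Omega p km).
  have -> : iter k (@Omega m) p = substq h; last exact: erefl.
  by rewrite -h2 -iterD (subnKC km); exact: iter_Omega_substq.
have := isP_iter_up k pP; rewrite -e1 E => iP.
have [c ->] := isP_scale iP (Estar_top nla).1.
exists (c *: h); last by rewrite substqZ scalerAr.
by apply: VanZ; rewrite e1 mdeg_iter_up addnK.
Qed.

(** After the swap the larger part, which is nonzero, sits in column i + 1, so both columns lie in
    the support, where [prodc k] is symmetric. *)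
Lemma packed_swp k i ka : (ka (adjR i) < ka (adjL i))%N -> packed k (swp i ka) ->
  packed k ka /\ (i.+1 < k)%N.
Proof.
move=> h pk; have a := pk (adjL i); have b := pk (adjR i).
rewrite swpL in a; rewrite swpR in b.
have ik : (i.+1 < k)%N.
  by rewrite ltnNge; apply/negP => ki; move: b a; rewrite /= ki; move: h; case: (ka (adjL i)).
split=> // j; have := pk (sadj i j); rewrite swpE sadjK => ->.
rewrite /Defs.sadj; case: tpermP => [->|->|//] /=; lia.
Qed.

Lemma spoly_prodc k i : (i.+1 < k <= m.+1)%N -> spoly i (prodc k) = prodc k.
Proof.
move=> /andP[ik km].
have E : prodc k = \prod_(j : 'I_m.+1 | (j < k)%N) ('X_j - (tpar ^- m)%:MP).
  rewrite /prodc (big_nat_widen _ _ m.+1) // big_mkord.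
  by apply: eq_bigr => j _; rewrite inord_val.
rewrite E.
transitivity (\prod_(j : 'I_m.+1 | (j < k)%N) spoly i ('X_j - (tpar ^- m)%:MP)).
  by elim/big_ind2: _ => [|f f' g g' <- <-|//]; [exact: spoly1 | rewrite spolyM].
rewrite [RHS](reindex_inj (@perm_inj _ (sadj i))) /=; apply: eq_big => j.
  by rewrite /Defs.sadj; case: tpermP => [->|->|//] /=; lia.
move=> _; rewrite spolyB spolyX; congr (_ - _).
by rewrite -[_%:MP]mulr1 mul_mpolyC spolyZ spoly1.
Qed.

(** Being packed is a premise inside the induction predicate, because it is inherited backwards,
    from the swapped composition to the previous one. *)
Lemma fstar_factor k mu : (k <= m.+1)%N -> packed k mu ->
  exists2 h, Van (mdeg mu - k) h & fstar mu = prodc k * substq h.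
Proof.
move=> km; apply: (@fstar_ind m.+1 (fun ka f => packed k ka ->
  exists2 h, Van (mdeg ka - k) h & f = prodc k * substq h)) => [la nla _|i ka g h IH].
  exact: Estar_factor.
move=> /(packed_swp h) [pk ik]; have [f f1 ->] := IH pk.
exists (Top i f); first by rewrite mdeg_swp; exact: Van_Top.
by rewrite Top_mul_sym ?substq_Top // spoly_prodc // ik.
Qed.

End PackedFactorization.

(** * Comparison of top homogeneous parts *)

Section Comparison.
Variable m : nat.
Local Notation P := {mpoly Kqt[m.+1]}.
Local Notation substq := (@substq m.+1).
Implicit Types (mu nu u v : 'X_{1..m.+1}) (f g h p : P).

Lemma msize_substq f d : (msize f <= d)%N -> (msize (substq f) <= d)%N.
Proof.
move=> h; rewrite -iter_Omega_substq.
have H l : (msize (iter l (@Omega m) f) <= d)%N by elim: l => //= l IH; exact: msize_Omega.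
exact: H.
Qed.

Lemma msize_coef_leq p d : (forall u, p@_u != 0 -> (mdeg u < d)%N) -> (msize p <= d)%N.
Proof.
by move=> h; rewrite msizeE; apply/bigmax_leqP_seq => u; rewrite mcoeff_msupp => /h.
Qed.

Lemma mcoeff_substq f u : (substq f)@_u = qpar ^- mdeg u * f@_u.
Proof.
rewrite [in LHS](mpolyE f) substq_sum raddf_sum /=.
under eq_bigr do rewrite substqZ substqX !mcoeffZ mcoeffX.
rewrite [in RHS](mpolyE f) raddf_sum mulr_sumr; apply: eq_bigr => v _ /=.
rewrite mcoeffZ mcoeffX; case: eqP => [->|_]; last by rewrite !mulr0.
by rewrite !mulr1; exact: mulrC.
Qed.

Lemma msize_substq_inj f d : (msize (substq f) <= d)%N -> (msize f <= d)%N.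
Proof.
move=> h; apply: msize_coef_leq => u fu; apply: leq_trans h; apply: msize_mdeg_lt.
rewrite mcoeff_msupp mcoeff_substq; apply: (@mulf_neq0 Kqt); last exact: fu.
exact: invr_neq0 (expf_neq0 _ qpar_neq0).
Qed.

Lemma msize_mulX_inj u f d : (msize ('X_[u] * f) <= mdeg u + d)%N -> (msize f <= d)%N.
Proof.
move=> h; apply: msize_coef_leq => v fv; rewrite -(ltn_add2l (mdeg u)) -mdegD.
by apply: leq_trans h; apply: msize_mdeg_lt; rewrite mcoeff_msupp mcoeffXM_add.
Qed.

Lemma msize_prod_sub (s : seq 'I_m.+1) (c : Kqt) :
  (msize (\prod_(j <- s) ('X_j - c%:MP) : P) <= (size s).+1)%N /\
  (msize (\prod_(j <- s) ('X_j - c%:MP) - \prod_(j <- s) 'X_j : P) <= size s)%N.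
Proof.
elim: s => [|j s [IH1 IH2]].
  rewrite (big_nil _ _ _ (fun j => 'X_j - c%:MP)) (big_nil _ _ _ (fun j => 'X_j)) subrr.
  by split; [rewrite msize1 | rewrite msize0].
have X2 : (msize ('X_j : P) <= 2)%N by rewrite msizeX mdeg1.
have C2 : (msize ('X_j - c%:MP : P) <= 2)%N.
  by apply: msizeB_leq => //; rewrite msizeC; case: (c != 0).
rewrite !big_cons /=; split; first exact: (msizeM_leq (a := 1) C2 IH1).
move: (\prod_(_ <- _) _) (\prod_(_ <- _) _) IH1 IH2 => B A IH1 IH2.
have -> : ('X_j - c%:MP) * A - 'X_j * B = 'X_j * (A - B) - c *: A.
  by rewrite mulrBl mulrBr mul_mpolyC addrAC.
apply: msizeB_leq; last exact: msizeZ_leq.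
exact: (msizeM_leq (a := 1) X2 IH2).
Qed.

Lemma prodcE k : (k <= m.+1)%N ->
  prodc m k = \prod_(j : 'I_m.+1 | (j < k)%N) ('X_j - (tpar ^- m)%:MP).
Proof.
move=> km; rewrite /prodc (big_nat_widen _ _ m.+1) // big_mkord.
by apply: eq_bigr => j _; rewrite inord_val.
Qed.

Lemma prodc_suppm k mu : (k <= m.+1)%N -> packed k mu ->
  (msize (prodc m k - 'X_[suppm mu]) <= k)%N /\ mdeg (suppm mu) = k.
Proof.
move=> km pk; have sm (j : 'I_m.+1) : suppm mu j = (j < k)%N by rewrite mnmE pk -ltnNge.
have cE : size [seq j : 'I_m.+1 <- enum 'I_m.+1 | (j < k)%N] = k.
  have -> : size [seq j : 'I_m.+1 <- enum 'I_m.+1 | (j < k)%N] = count (fun x => (x < k)%N) (iota 0 m.+1).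
    by rewrite -val_enum_ord count_map size_filter.
  have -> : m.+1 = (k + (m.+1 - k))%N by rewrite subnKC.
  rewrite iotaD count_cat (eq_in_count (a2 := predT)) ?count_predT ?size_iota.
    rewrite (eq_in_count (a2 := pred0)) ?count_pred0 ?addn0 // => x; rewrite mem_iota => /andP[].
    by rewrite leqNgt => /negbTE ->.
  by move=> x; rewrite mem_iota => /andP[_ ->].
split; last first.
  rewrite mdegE -[RHS]cE -sum1_size big_filter big_enum_cond /= [RHS]big_mkcond.
  by apply: eq_bigr => j _; rewrite sm; case: (j < k)%N.
have [_] := msize_prod_sub [seq j : 'I_m.+1 <- enum 'I_m.+1 | (j < k)%N] (tpar ^- m).
rewrite cE !big_filter !big_enum_cond /= -prodcE //.
have -> : \prod_(j : 'I_m.+1 | (j < k)%N) 'X_j = 'X_[suppm mu] :> P.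
  rewrite mpolyXE_id big_mkcond; apply: eq_bigr => j _; rewrite sm.
  by case: (j < k)%N; rewrite ?expr1 ?expr0.
exact.
Qed.

(** The candidate for h: the sum of the theorem before the substitution x -> x / q. *)
Definition Hsum mu : P := \sum_(nu : 'X_{1..m.+1 < (mdeg mu).+1})
  (acoef nu mu * qpar ^+ mdeg (mminus nu)) *: fstar (mminus nu).

Lemma mdeg_mminus_packed k mu nu : (k <= m.+1)%N -> packed k mu -> acoef nu mu != 0 ->
  mdeg (mminus nu) = (mdeg mu - k)%N.
Proof.
move=> km pk /acoef_neq0_adm /mdeg_mminus ->.
by rewrite -[in RHS](mdeg_suppm mu) (prodc_suppm km pk).2 addKn.
Qed.

Lemma Van_Hsum k mu : (k <= m.+1)%N -> packed k mu -> Van (mdeg mu - k) (Hsum mu).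
Proof.
move=> km pk; apply: Van_sum => nu _; have [->|a0] := eqVneq (acoef nu mu) 0.
  by rewrite mul0r scale0r; exact: Van0.
apply: VanZ; rewrite -(mdeg_mminus_packed km pk a0); exact: (fstar_top _).1.
Qed.

Lemma Hsum_top k mu : (k <= m.+1)%N -> packed k mu ->
  (msize (substq (Hsum mu) - Asum (Ffam (mdeg mu)) (mdeg mu).+1 mu) <= mdeg mu - k)%N.
Proof.
move=> km pk; rewrite /Hsum substq_sum -sumrB; apply: msize_sum_leq => nu _.
have [->|a0] := eqVneq (acoef nu mu) 0.
  by rewrite mul0r !scale0r subr0 [substq 0]comp_mpoly0 msize0.
have e := mdeg_mminus_packed km pk a0.
(* The factor q^|nu^-| of the theorem undoes the effect of x -> x / q on the top part of f*. *)
have := substq_homog (Ffam_homog (mdeg mu) (mminus nu)).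
move=> /(congr1 ( *:%R (qpar ^+ mdeg (mminus nu)))).
rewrite scalerA divff ?expf_neq0 ?qpar_neq0 // scale1r => <-.
rewrite substqZ -scalerA -scalerBr -scalerBr; apply: msizeZ_leq; apply: msizeZ_leq.
rewrite -substqB; apply: msize_substq; rewrite -e -opprB -scaleN1r; apply: msizeZ_leq.
apply: (fstar_top (mminus nu)).2 => j; rewrite mnmE -ltnS.
apply: leq_ltn_trans (bmdeg nu); exact: leq_trans (leq_pred _) (mnm_le_mdeg nu j).
Qed.

Lemma packed_compare k mu h : (0 < k <= m.+1)%N -> packed k mu -> Van (mdeg mu - k) h ->
  fstar mu = prodc m k * substq h -> h = Hsum mu.
Proof.
move=> /andP[k0 km] pk hV hE; set e := (mdeg mu - k)%N in hV *.
have [pk1 pk2] := prodc_suppm km pk.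
have ke : mdeg mu = (k + e)%N by rewrite subnKC // -pk2 -(mdeg_suppm mu) leq_addr.
have hH := Van_Hsum km pk; apply: (Van_eq hV hH); apply: msize_substq_inj; rewrite substqB.
have h2 := Hsum_top km pk.
have h3 : (msize (Ffam (mdeg mu).+1 mu - fstar mu) <= mdeg mu)%N.
  by apply: (fstar_top mu).2 => j; apply: leqW; exact: mnm_le_mdeg.
rewrite hE /Ffam -/Ffam in h3; move: h2 h3; rewrite -/e.
have s1 : (msize (substq h) <= e.+1)%N by apply: msize_substq; exact: hV.1.
move: (Asum _ _ _) (substq (Hsum mu)) (substq h) (prodc m k) s1 pk1 => A H' S p s1 pk1 h2 h3.
(* Below degree |mu| everything is discarded: x^(supp mu) S agrees with [prodc] S = f*_mu, whose top
   part is that of F_mu = x^(supp mu) A. *)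
have h4 : (msize ('X_[suppm mu] * (S - A)) <= mdeg (suppm mu) + e)%N.
  have -> : 'X_[suppm mu] * (S - A) = - 1 *: ((p - 'X_[suppm mu]) * S)
      - ('X_[suppm mu] * A - p * S).
    by rewrite scaleN1r mulrBr mulrBl !opprB [RHS]addrA subrK.
  rewrite pk2 -ke; apply: msizeB_leq => //; apply: msizeZ_leq.
  rewrite ke -(prednK k0) addSnnS; apply: msizeM_leq => //; by rewrite prednK.
have h5 := msize_mulX_inj h4.
have -> : S - H' = (S - A) - (H' - A) by rewrite opprB addrA subrK.
exact: msizeB_leq.
Qed.

End Comparison.

(** The finite range loses nothing: an admissible nu has no part 1 and shares its parts above 1 with
    mu, so |nu| is at most |mu|, and all other coefficients vanish. *)
Theorem theorem3p3 (n k : nat) (mu : 'X_{1..n}) :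
  (1 <= k <= n)%N ->
  (forall i : 'I_n, (i < k)%N -> mu i <> 0%N) ->
  (forall i : 'I_n, (k <= i)%N -> mu i = 0%N) ->
  fstar mu =
    (\prod_(i : 'I_n | (i < k)%N) ('X_i - (tpar ^- n.-1)%:MP))
    * \sum_(nu : 'X_{1..n < (mdeg mu).+1})
        ((acoef nu mu * qpar ^+ mdeg (mminus nu)) *: substq (fstar (mminus nu))).
Proof.
case: n mu => [|m] mu kn nz z; first by case: k kn {nz z}.
have km : (k <= m.+1)%N by case/andP: kn.
have pk : packed k mu.
  move=> j; case: leqP => h; first by rewrite z.
  by apply/eqP; exact: nz.
have [h hV hE] := fstar_factor km pk.
rewrite hE (packed_compare kn pk hV hE) (prodcE km); congr (_ * _).
by rewrite /Hsum substq_sum; apply: eq_bigr => nu _; exact: substqZ.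
Qed.
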